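(* For any $\phi\in W^{1,\infty}(\omega)$ there exists $\phi_{\varepsilon\delta}\in W^{1,\infty}(\omega_\delta)\cap\mathbf V$ (with $\mathbf V$ the space defined in the context, whose elements are of grid-interpolation form, have zero gradient a.e. in $\omega^H_{\varepsilon\delta}$ and vanish a.e. on $\gamma$) such that, as $(\varepsilon,\delta)\to(0,0)$ with $\delta/\varepsilon\to0$, $$\phi_{\varepsilon\delta}\to\phi\ \text{ strongly in }L^2(\omega),$$ $$\frac\delta\varepsilon\,\mathcal T^{(1)}_{\varepsilon\delta}(\partial_2\phi_{\varepsilon\delta})\to\partial_2\phi\ \text{ strongly in }L^2(\omega\times Y_1),\qquad \frac\delta\varepsilon\,\mathcal T^{(2)}_{\varepsilon\delta}(\partial_1\phi_{\varepsilon\delta})\to\partial_1\phi\ \text{ strongly in }L^2(\omega\times Y_2).$$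
   Context: Fix $0<l<L$; $\omega=(0,L)^2$ and $\gamma=\{0\}\times(0,l)\,\cup\,(0,l)\times\{0\}$. The parameters satisfy $0<3\delta<\varepsilon<1$, $N_\varepsilon=L/\varepsilon\in\mathbb N^*$, $l/\varepsilon\in\mathbb N^*$, and $\delta/\varepsilon\to0$ as $(\varepsilon,\delta)\to(0,0)$. For $\kappa>0$, $I_\kappa=(-\kappa/2,\kappa/2)$, $I=I_1$; $\omega_\delta=(-\delta/2,L+\delta/2)^2$. For integers $p,q$, $\omega^H_{pq}=(p\varepsilon+\delta/2,(p+1)\varepsilon-\delta/2)\times(q\varepsilon+\delta/2,(q+1)\varepsilon-\delta/2)$, and $\omega^H_{\varepsilon\delta}=\bigcup_{0\le p,q\le N_\varepsilon-1}\omega^H_{pq}$. Grid-interpolation form: a function $\phi$ on $\omega_\delta$ is of this form if there is a family of reals $(\phi_{pq})_{(p,q)\in\{-1,\dots,N_\varepsilon\}^2}$ such that - $\phi=\phi_{pq}$ in $\omega^H_{pq}$; - in $R^1_{pq}=((p+\tfrac12)\varepsilon,q\varepsilon)+I_{\varepsilon-\delta}\times I_\delta$ ($0\le p\le N_\varepsilon-1$, $0\le q\le N_\varepsilon$), $\phi((p+\tfrac12)\varepsilon+z_1,q\varepsilon+z_2)=\phi_{pq}\frac{\delta+2z_2}{2\delta}+\phi_{p,q-1}\frac{\delta-2z_2}{2\delta}$; - in $R^2_{pq}=(p\varepsilon,(q+\tfrac12)\varepsilon)+I_\delta\times I_{\varepsilon-\delta}$ ($0\le p\le N_\varepsilon$,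 $0\le q\le N_\varepsilon-1$), $\phi(p\varepsilon+z_1,(q+\tfrac12)\varepsilon+z_2)=\phi_{pq}\frac{\delta+2z_1}{2\delta}+\phi_{p-1,q}\frac{\delta-2z_1}{2\delta}$; - in $R^3_{pq}=(p\varepsilon,q\varepsilon)+I_\delta^2$ ($0\le p,q\le N_\varepsilon$), $\phi(p\varepsilon+z_1,q\varepsilon+z_2)=\phi_{pq}\frac{\delta+2z_1}{2\delta}\frac{\delta+2z_2}{2\delta}+\phi_{p,q-1}\frac{\delta+2z_1}{2\delta}\frac{\delta-2z_2}{2\delta}+\phi_{p-1,q}\frac{\delta-2z_1}{2\delta}\frac{\delta+2z_2}{2\delta}+\phi_{p-1,q-1}\frac{\delta-2z_1}{2\delta}\frac{\delta-2z_2}{2\delta}$. The space $\mathbf V$ (depending on $\varepsilon,\delta$) is $$\mathbf V=\{\phi\in H^1(\omega_\delta)\;:\;\nabla\phi=0\text{ a.e. in }\omega^H_{\varepsilon\delta},\ \phi=0\text{ a.e. on }\gamma,\ \text{and }\phi\text{ is of the grid-interpolation form above}\}.$$ Unfolding: $Y_1=(0,1)\times I$, $Y_2=I\times(0,1)$, $[x'/\varepsilon]=(\lfloor x_1/\varepsilon\rfloor,\lfloor x_2/\varepsilon\rfloor)$, and $\mathbf e_1,\mathbf e_2$ is the standard basis of $\mathbb R^2$. With $\omega^{(1)}_{\varepsilon\delta}=\bigcup_{q=0}^{N_\varepsilon}(-\tfrac\delta2,L+\tfrac\delta2)\times(q\varepsilon-\tfrac\delta2,q\varepsilon+\tfrac\delta2)$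 and $\omega^{(2)}_{\varepsilon\delta}=\bigcup_{p=0}^{N_\varepsilon}(p\varepsilon-\tfrac\delta2,p\varepsilon+\tfrac\delta2)\times(-\tfrac\delta2,L+\tfrac\delta2)$: for $\psi$ measurable on $\omega^{(1)}_{\varepsilon\delta}$, $\mathcal T^{(1)}_{\varepsilon\delta}(\psi)(x',y')=\psi(\varepsilon[x'/\varepsilon]+\varepsilon y_1\mathbf e_1+\delta y_2\mathbf e_2)$ for a.e. $(x',y')\in\omega\times Y_1$; for $\psi$ measurable on $\omega^{(2)}_{\varepsilon\delta}$, $\mathcal T^{(2)}_{\varepsilon\delta}(\psi)(x',y')=\psi(\varepsilon[x'/\varepsilon]+\delta y_1\mathbf e_1+\varepsilon y_2\mathbf e_2)$ for a.e. $(x',y')\in\omega\times Y_2$.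
   Formalization: The formal statement additionally assumes that φ vanishes a.e. on γ in the sense of traces; without this the claim fails (e.g. φ = 1), since limits of elements of V in the stated sense must vanish on γ. *)

(* Defs.v *)
From HB Require Import structures.
From mathcomp Require Import all_boot all_order all_algebra.
From mathcomp Require Import all_classical all_reals all_analysis.
Set Implicit Arguments.
Unset Strict Implicit.
Unset Printing Implicit Defensive.
Import Order.TTheory GRing.Theory Num.Theory.
Import numFieldNormedType.Exports.
Local Open Scope classical_set_scope.
Local Open Scope ring_scope.

(* As a set, [plane R] is [R * R]; the alias of [R] carries the sigma-algebra
   on which [lebesgue_measure] is defined. *)
Notation plane R := ((measurableTypeR R * measurableTypeR R)%type).

Definition lebesgue2 (R : realType) : set (plane R) -> \bar R :=
  (@lebesgue_measure R \x @lebesgue_measure R)%E.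

HB.instance Definition _ (R : realType) := Measure.on (@lebesgue2 R).

Lemma lebesgue2_sigma_finite (R : realType) :
  sigma_finite setT (@lebesgue2 R).
Proof.
have /sigma_finiteP[F [TF ndF Foo]] := sigma_finiteT (@lebesgue_measure R).
exists (fun n => F n `*` F n).
  rewrite -setXTT TF predeqE => -[x y]; split.
    move=> [/= [n _ Fnx] [k _ Fky]]; exists (maxn n k) => //; split.
    - by move: x Fnx; exact/subsetPset/ndF/leq_maxl.
    - by move: y Fky; exact/subsetPset/ndF/leq_maxr.
  by move=> [n _ []/= ? ?]; split; exists n.
move=> k; have [? ?] := Foo k.
split; first exact: measurableX.
by rewrite /lebesgue2 product_measure1E// lte_mul_pinfty// ge0_fin_numE.
Qed.

HB.instance Definition _ (R : realType) :=
  Measure_isSigmaFinite.Build _ _ _ (@lebesgue2 R)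
    (@lebesgue2_sigma_finite R).

Definition lebesgue4 (R : realType) : set (plane R * plane R) -> \bar R :=
  (@lebesgue2 R \x @lebesgue2 R)%E.

HB.instance Definition _ (R : realType) := Measure.on (@lebesgue4 R).

Definition Lp d (T : measurableType d) (R : realType)
    (mu : {measure set T -> \bar R}) (p : \bar R) (U : set T) : set (T -> R) :=
  [set f | measurable_fun U f /\
           ('N[mu]_p [ EFin \o (f \_ U) ] < +oo)%E].

Definition Lp_dist d (T : measurableType d) (R : realType)
    (mu : {measure set T -> \bar R}) (p : \bar R) (U : set T)
    (f g : T -> R) : \bar R :=
  'N[mu]_p [ EFin \o ((f \- g) \_ U) ].

Definition e1 {R : realType} : R * R := (1, 0).
Definition e2 {R : realType} : R * R := (0, 1).

Fixpoint is_Cn (R : realType) (n : nat) (f : R * R -> R) : Prop :=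
  continuous f /\
  if n is m.+1 then
    (forall x, derivable f x e1 /\ derivable f x e2) /\
    is_Cn m ('D_e1 f) /\ is_Cn m ('D_e2 f)
  else True.

Definition test_function (R : realType) (U : set (R * R)) : set (R * R -> R) :=
  [set psi | (forall n, is_Cn n psi) /\
     exists K : set (R * R),
       [/\ compact K, K `<=` U & forall x, ~ K x -> psi x = 0]].

Definition weak_partial (R : realType) (U : set (R * R)) (v : R * R)
    (f g : R * R -> R) : Prop :=
  forall psi, test_function U psi ->
    (\int[@lebesgue2 R]_(x in U) (f x * 'D_v psi x)%:E =
     - \int[@lebesgue2 R]_(x in U) (g x * psi x)%:E)%E.

(* f is in W^{1,p}(U) and (d1f, d2f) represents its weak gradient, which is
   unique up to null sets. *)
Definition sobolev1 (R : realType) (p : \bar R) (U : set (R * R))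
    (f d1f d2f : R * R -> R) : Prop :=
  [/\ Lp (@lebesgue2 R) p U f,
      Lp (@lebesgue2 R) p U d1f, Lp (@lebesgue2 R) p U d2f,
      weak_partial U e1 f d1f & weak_partial U e2 f d2f].

(* The trace of f at a point x of the closure of U is 0: the mean of |f| over
   the part of U in the square of centre x and half-side r, whose area is of
   order r^2, tends to 0.  This does not depend on the representative of f. *)
Definition zero_trace_at (R : realType) (U : set (R * R)) (f : R * R -> R)
    (x : R * R) : Prop :=
  ((r ^- 2)%:E * \int[@lebesgue2 R]_(y in U `&` ball x r) `|f y|%:E)%E
    @[r --> 0^'+] --> 0%E.

(* "f = 0 a.e. on gamma" for f in a Sobolev space on U, in the sense of traces
   and for the length measure on the two segments of
   gamma = {0} x (0, l) `|` (0, l) x {0}.  It is used both for members of V and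
   for the function they approximate: by the discrete trace inequality, a limit
   of members of V in the sense of the theorem also vanishes on gamma. *)
Definition zero_on_gamma (R : realType) (l : R) (U : set (R * R))
    (f : R * R -> R) : Prop :=
  {ae @lebesgue_measure R, forall t : R, 0 < t < l ->
     zero_trace_at U f (0, t) /\ zero_trace_at U f (t, 0)}.

Definition omega (R : realType) (L : R) : set (R * R) :=
  `]0, L[ `*` `]0, L[.

Definition omega_delta (R : realType) (L delta : R) : set (R * R) :=
  `](- (delta / 2)), (L + delta / 2)[ `*` `](- (delta / 2)), (L + delta / 2)[.

(* Since 0 < l < L and 0 < eps, the naturals L / eps and l / eps are positive. *)
Definition admissible (R : realType) (L l eps delta : R) : Prop :=
  [/\ 0 < 3 * delta, 3 * delta < eps, eps < 1,
      L / eps \is a Num.nat & l / eps \is a Num.nat].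

(* For admissible parameters, L / eps itself. *)
Definition Neps (R : realType) (L eps : R) : nat := Num.truncn (L / eps).

(* The filter of (eps, delta) -> (0, 0) with delta / eps -> 0, along
   admissible parameters. *)
Definition params_to0 (R : realType) (L l : R) : set_system (R * R) :=
  filter_from [set r : R | 0 < r] (fun r => [set e : R * R |
    [/\ admissible L l e.1 e.2, e.1 < r, e.2 < r & e.2 / e.1 < r]]).

Definition Iint (R : realType) (k : R) : set R := `](- (k / 2)), (k / 2)[.

Definition cellH (R : realType) (eps delta : R) (p q : nat) : set (R * R) :=
  `](p%:R * eps + delta / 2), (p.+1%:R * eps - delta / 2)[ `*`
  `](q%:R * eps + delta / 2), (q.+1%:R * eps - delta / 2)[.

Definition omegaH (R : realType) (L eps delta : R) : set (R * R) :=
  [set x | exists p q : nat, [/\ (p < Neps L eps)%N, (q < Neps L eps)%N &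
                                 cellH eps delta p q x]].

(* Only the values c p q with -1 <= p, q <= Neps L eps are used.  The pieces
   are open and cover omega_delta up to finitely many segments, which meet
   gamma in finitely many points. *)
Definition grid_interpolation (R : realType) (L eps delta : R)
    (f : R * R -> R) : Prop :=
  let N := Neps L eps in
  let up (z : R) := (delta + 2 * z) / (2 * delta) in
  let dn (z : R) := (delta - 2 * z) / (2 * delta) in
  exists c : int -> int -> R,
  [/\ forall p q : nat, (p < N)%N -> (q < N)%N ->
        forall x, cellH eps delta p q x -> f x = c p%:Z q%:Z,
      forall p q : nat, (p < N)%N -> (q <= N)%N ->
        forall z1 z2, Iint (eps - delta) z1 -> Iint delta z2 ->
        f ((p%:R + 2^-1) * eps + z1, q%:R * eps + z2) =
          c p%:Z q%:Z * up z2 + c p%:Z (q%:Z - 1) * dn z2,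
      forall p q : nat, (p <= N)%N -> (q < N)%N ->
        forall z1 z2, Iint delta z1 -> Iint (eps - delta) z2 ->
        f (p%:R * eps + z1, (q%:R + 2^-1) * eps + z2) =
          c p%:Z q%:Z * up z1 + c (p%:Z - 1) q%:Z * dn z1 &
      forall p q : nat, (p <= N)%N -> (q <= N)%N ->
        forall z1 z2, Iint delta z1 -> Iint delta z2 ->
        f (p%:R * eps + z1, q%:R * eps + z2) =
          c p%:Z q%:Z * up z1 * up z2
          + c p%:Z (q%:Z - 1) * up z1 * dn z2
          + c (p%:Z - 1) q%:Z * dn z1 * up z2
          + c (p%:Z - 1) (q%:Z - 1) * dn z1 * dn z2].

Definition V (R : realType) (L l eps delta : R) : set (R * R -> R) :=
  [set f | exists d1f d2f : R * R -> R,
    [/\ sobolev1 2%:E (omega_delta L delta) f d1f d2f,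
        {ae @lebesgue2 R, forall x, omegaH L eps delta x ->
           d1f x = 0 /\ d2f x = 0},
        zero_on_gamma l (omega_delta L delta) f &
        grid_interpolation L eps delta f]].

Definition Y1 (R : realType) : set (R * R) := `]0, 1[ `*` Iint 1.
Definition Y2 (R : realType) : set (R * R) := Iint 1 `*` `]0, 1[.

Definition T1 (R : realType) (eps delta : R) (psi : R * R -> R)
    (z : (R * R) * (R * R)) : R :=
  psi (eps * (Num.floor (z.1.1 / eps))%:~R + eps * z.2.1,
       eps * (Num.floor (z.1.2 / eps))%:~R + delta * z.2.2).

Definition T2 (R : realType) (eps delta : R) (psi : R * R -> R)
    (z : (R * R) * (R * R)) : R :=
  psi (eps * (Num.floor (z.1.1 / eps))%:~R + delta * z.2.1,
       eps * (Num.floor (z.1.2 / eps))%:~R + eps * z.2.2).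

(* Main.v *)
Require Import Defs.
From HB Require Import structures.
From mathcomp Require Import all_boot all_order all_algebra.
From mathcomp Require Import all_classical all_reals all_analysis.
From mathcomp Require Import measurable_realfun ess_sup_inf zify ring lra.
Set Implicit Arguments.
Unset Strict Implicit.
Unset Printing Implicit Defensive.
Import Order.TTheory GRing.Theory Num.Theory.
Import numFieldNormedType.Exports.
Local Open Scope classical_set_scope.
Local Open Scope ring_scope.

(** The values to interpolate are smoothed averages of phi over the cells of the
    grid, replaced by 0 for the cells that touch gamma.

    The grid interpolation of such a table has all its variation in the joints of
    width delta.  For x in the cell (p, q), delta / eps times the unfolding of its
    derivative in direction 2 is a convex combination of the difference quotients
    (c_{p',q} - c_{p',q-1}) / eps of neighbouring cells.  The averages are taken
    against products of smooth bumps, and a bump minus its translate is the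
    derivative of a function with compact support.  Testing the weak derivative
    of phi against it shows ([meanB2], [mean_quotient2]) that the difference
    quotient is itself an average of the weak derivative d2, for a kernel of
    integral 1 and size eps^-2 supported at distance at most 3 eps from x.  The
    interpolation, as well, is a convex combination of averages of phi.

    An average of h around x differs from h x by at most a constant times the
    local oscillation of h around x ([average_local_osc]).  The integral of this
    oscillation tends to 0 with the scale, for every bounded measurable h
    ([osc_vanishes_bounded]): this is clear for the indicator of a box, extends to
    the indicators of all Borel sets by an induction on Dynkin systems, and then
    to bounded functions by approximation in L^1, the oscillation being controlled
    by the L^1 norm uniformly in the scale.

    The cells next to the axes are exceptional, and cover an area of order eps: a
    uniform bound on the errors is enough there.  For the difference quotients,
    this requires that setting the values next to gamma to 0 is a change of order
    eps.  Here the vanishing of phi on gamma is used: by the formula above the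
    averages are Lipschitz functions of the rectangle ([mean_lip1], [mean_lip2]),
    so that the average over a cell which touches gamma is within a constant times
    eps of averages over arbitrarily small squares at a point of gamma, and these
    tend to 0 ([mean_trace1]).  The errors being bounded, their convergence to 0 in
    L^1 yields the convergence in L^2 ([le_majorant]).

    Finally the interpolation is bounded and its piecewise derivatives are weak
    derivatives, by an integration by parts on each line and Fubini's theorem
    ([weak_partial_interp2_e1]).  It vanishes in a neighbourhood of gamma because
    only values of cells touching gamma are interpolated there
    ([zero_on_gamma_interp2]). *)

(** * Smooth functions of one variable *)

Section smooth_functions.
Context {R : realType}.
Implicit Types (f g : R -> R) (n : nat).

(** Class C^n, with a witness for each derivative, which turns stability under
    products and inverses into an induction on n. *)
Fixpoint Cn1 n f : Prop :=
  if n is m.+1 then exists2 g : R -> R, (forall x : R, is_derive x 1 f (g x)) & Cn1 m g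
  else continuous f.

Lemma is_derive_continuous f g :
  (forall x : R, is_derive x 1 f (g x)) -> continuous f.
Proof.
move=> fg x; apply: differentiable_continuous; apply/derivable1_diffP.
exact: ex_derive.
Qed.

Lemma Cn1_continuous n f : Cn1 n f -> continuous f.
Proof. by case: n => //= n [g /is_derive_continuous]. Qed.

Lemma Cn1_leS n f : Cn1 n.+1 f -> Cn1 n f.
Proof.
elim: n f => [|n IH] f; first exact: Cn1_continuous.
by move=> [g fg gn]; exists g => //; exact: IH.
Qed.

Lemma Cn1_ext n f g : f =1 g -> Cn1 n f -> Cn1 n g.
Proof. by move=> /funext ->. Qed.

Lemma Cn1_cst n (c : R) : Cn1 n (fun=> c).
Proof.
elim: n c => [|n IH] c; first by move=> x; exact: cst_continuous.
by exists (fun=> 0) => [x|]; [exact: is_derive_cst|exact: IH].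
Qed.

Lemma Cn1D n f g : Cn1 n f -> Cn1 n g -> Cn1 n (fun x => f x + g x).
Proof.
elim: n f g => [|n IH] f g.
  by move=> cf cg x; apply: cvgD; [exact: cf|exact: cg].
move=> [f' ff' f'n] [g' gg' g'n]; exists (fun x => f' x + g' x); last exact: IH.
by move=> x; exact: is_deriveD.
Qed.

Lemma Cn1M n f g : Cn1 n f -> Cn1 n g -> Cn1 n (fun x => f x * g x).
Proof.
elim: n f g => [|n IH] f g.
  by move=> cf cg x; apply: cvgM; [exact: cf|exact: cg].
move=> fn gn; have [f0 g0] := (Cn1_leS fn, Cn1_leS gn).
case: fn => f' ff' f'n; case: gn => g' gg' g'n.
exists (fun x => f x * g' x + g x * f' x).
  by move=> x; exact: is_deriveM.
by apply: Cn1D; apply: IH.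
Qed.

Lemma Cn1N n f : Cn1 n f -> Cn1 n (fun x => - f x).
Proof.
move=> /(Cn1M (Cn1_cst n (-1))); apply: Cn1_ext => x; exact: mulN1r.
Qed.

Lemma Cn1V n f : (forall x, f x != 0) -> Cn1 n f -> Cn1 n (fun x => (f x)^-1).
Proof.
move=> f0; elim: n f f0 => [|n IH] f f0.
  by move=> cf x; apply: cvgV => //; exact: cf.
move=> fn; have fVn := IH _ f0 (Cn1_leS fn).
case: fn => f' ff' f'n.
exists (fun x => - ((f x)^-1 * (f x)^-1) * f' x).
  move=> x; have -> : - ((f x)^-1 * (f x)^-1) = - f x ^- 2.
    by rewrite -invfM expr2.
  exact: is_deriveV.
by apply: Cn1M => //; apply: Cn1N; exact: Cn1M.
Qed.

Lemma Cn1_affine n f (a b : R) : Cn1 n f -> Cn1 n (fun x => f (a * x + b)).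
Proof.
elim: n f => [|n IH] f.
  move=> cf x; apply: (@continuous_comp _ _ _ (fun x => a * x + b) f); last exact: cf.
  apply: cvgD; last exact: cvg_cst.
  by apply: cvgM; [exact: cvg_cst|exact: cvg_id].
move=> [f' ff' f'n]; exists (fun x => f' (a * x + b) * a); last first.
  by apply: Cn1M; [exact: IH|exact: Cn1_cst].
move=> x; apply: (is_derive1_comp (ff' _)).
by apply: is_derive_eq; rewrite addr0 /GRing.scale/= mulr1.
Qed.

(** The functions t^-n exp(-1/t), extended by 0 to t <= 0: differentiating one
    of them gives a combination of two others, so they are all smooth. *)
Definition flat n (t : R) : R := if 0 < t then t^-1 ^+ n * expR (- t^-1) else 0.

(** The term of order n + 2 in the exponential series of 1/t already gives
    exp(1/t) >= t^-(n+2) / (n+2)!.  The resulting quadratic decay at 0 is what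
    makes [flat n] differentiable there. *)
Lemma flat_bound n (t : R) : `|flat n t| <= (n.+2)`!%:R * t ^+ 2.
Proof.
rewrite /flat; case: ifPn => t0; last by rewrite normr0 mulr_ge0// sqr_ge0.
have it0 : 0 < t^-1 by rewrite invr_gt0.
rewrite ger0_norm ?mulr_ge0 ?expR_ge0 ?exprn_ge0 ?(ltW it0)//.
have := @expR_ge1Dxn R t^-1 n.+1 (ltW it0) => H.
have {}H : t^-1 ^+ n.+2 / (n.+2)`!%:R <= expR t^-1.
  by apply: le_trans H; rewrite lerDr.
rewrite expRN ler_pdivrMr ?expR_gt0//.
move: H; rewrite ler_pdivrMr ?ltr0n ?fact_gt0// => H.
rewrite -(ler_pM2r (exprn_gt0 2 it0)) -exprD addn2 (le_trans H)//.
rewrite [leRHS](_ : _ = expR t^-1 * (n.+2)`!%:R)//.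
have : t != 0 by rewrite gt_eqF.
by move=> ?; field.
Qed.

Lemma is_derive_flat n (t : R) :
  is_derive t 1 (flat n) (flat n.+2 t - n%:R * flat n.+1 t).
Proof.
have [t0|t0|->] := ltgtP t 0.
- rewrite /flat !ltNge (ltW t0)/= mulr0 subr0.
  apply: (@near_eq_is_derive _ _ _ (fun=> 0)).
  near=> x; rewrite ltNge ifF//; apply/negbTE; rewrite negbK ltW//.
  by near: x; exact: lt_nbhsl.
- apply: (@near_eq_is_derive _ _ _ (fun t : R => t^-1 ^+ n * expR (- t^-1))).
    near=> x; rewrite /flat ifT//.
    by near: x; exact: lt_nbhsr.
  have tn0 : t != 0 by rewrite gt_eqF.
  have dV : is_derive t 1 (fun x : R => x^-1) (- t ^- 2).
    have := @is_deriveV R id t 1 1 tn0 (@is_derive_id _ _ _ _).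
    by rewrite /GRing.scale/= mulr1.
  have dE : is_derive t 1 (fun x : R => expR (- x^-1)) (expR (- t^-1) * t ^- 2).
    apply: (@is_derive1_comp _ expR (fun x : R => - x^-1)).
    by rewrite -[X in is_derive _ _ _ X]opprK; exact: is_deriveN.
  have dX : is_derive t 1 (fun x : R => x^-1 ^+ n) ((n%:R * t^-1 ^+ n.-1) * - t ^- 2).
    have := @is_deriveX _ _ (fun x : R => x^-1) n t 1 _ dV.
    rewrite exprfctE /GRing.scale/= => H; apply: (is_derive_eq H).
    by rewrite -mulr_natl.
  have := is_deriveM dX dE; move=> H; apply: (is_derive_eq H).
  rewrite /flat t0 /GRing.scale/=; case: n {dX H} => [|n] /=.
    rewrite !mul0r mulr0 addr0 subr0 mul1r exprVn mulrC //.
  rewrite !exprS; field.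
  by rewrite tn0.
- rewrite {2 3}/flat ltxx mulr0 subr0.
  have H : h^-1 *: (flat n (h *: 1 + 0) - flat n 0) @[h --> 0^'] --> (0 : R).
    apply/cvgrPdist_lt => e e0.
    have K0 : 0 < (n.+2)`!%:R :> R by rewrite ltr0n fact_gt0.
    near=> h.
    have h0 : h != 0 by near: h; exact: nbhs_dnbhs_neq.
    rewrite sub0r normrN {2}/flat ltxx subr0 addr0 /GRing.scale/= mulr1.
    rewrite normrM normfV ltr_pdivrMl ?normr_gt0//.
    apply: le_lt_trans (flat_bound _ _) _.
    rewrite -[h ^+ 2]real_normK ?num_real// expr2 mulrCA ltr_pM2l ?normr_gt0//.
    rewrite mulrC -ltr_pdivlMr//.
    near: h; apply: dnbhs0_lt; exact: divr_gt0.
  split; first by apply/cvg_ex; exists 0.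
  exact/cvg_lim.
Unshelve. all: by end_near. Qed.

Lemma Cn1_flat m n : Cn1 m (flat n).
Proof.
elim: m n => [|m IH] n.
  exact: is_derive_continuous (is_derive_flat n).
exists (fun t => flat n.+2 t - n%:R * flat n.+1 t); first exact: is_derive_flat.
apply: Cn1D; first exact: IH.
by apply: Cn1N; apply: Cn1M; [exact: Cn1_cst|exact: IH].
Qed.

End smooth_functions.

(** * A smooth step and its primitive *)

Section smooth_step.
Context {R : realType}.
Implicit Types (f g : R -> R).

Lemma Cn1_derive1 n f : Cn1 n.+1 f ->
  (forall x : R, is_derive x 1 f (derive1 f x)) /\ Cn1 n (derive1 f).
Proof.
move=> [g fg gn]; have gE : derive1 f = g.
  by apply/funext => x; rewrite derive1E; exact: derive_val.
by rewrite gE.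
Qed.

Lemma continuous_itv_bounded f (a b : R) : continuous f ->
  exists2 M, 0 < M & forall x, a <= x <= b -> `|f x| <= M.
Proof.
move=> cf; have [ab|ba] := leP a b; last first.
  exists 1 => // x /andP[ax xb]; have := le_trans ax xb.
  by rewrite leNgt ba.
have cnf : {within `[a, b], continuous (fun x => `|f x|)}.
  apply: continuous_subspaceT => x.
  by apply: (@continuous_comp _ _ _ f); [exact: cf|exact: norm_continuous].
have [c _ cM] := EVT_max ab cnf.
exists (`|f c| + 1); first by rewrite ltr_wpDl.
move=> x xab; apply: le_trans (cM x _) _; first by rewrite in_itv.
by rewrite lerDl.
Qed.

(** A smooth transition from 0, for t <= 1/4, to 1, for t >= 3/4: the
    denominator does not vanish, as one of its two terms is always positive. *)
Definition cutoff (t : R) : R :=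
  flat 0 (1 * t + - 4^-1) * (flat 0 (1 * t + - 4^-1) + flat 0 (- 1 * t + 3 / 4))^-1.

Lemma flat0_ge0 (t : R) : 0 <= flat 0 t.
Proof. by rewrite /flat; case: ifP => // _; rewrite expr0 mul1r expR_ge0. Qed.

Lemma flat0_gt0 (t : R) : 0 < t -> 0 < flat 0 t.
Proof. by move=> t0; rewrite /flat t0 expr0 mul1r expR_gt0. Qed.

Lemma flat_le0 n (t : R) : t <= 0 -> flat n t = 0.
Proof. by move=> t0; rewrite /flat ltNge t0. Qed.

Let den_neq0 (t : R) : flat 0 (1 * t + - 4^-1) + flat 0 (- 1 * t + 3 / 4) != 0.
Proof.
rewrite gt_eqF//; have [h|h] := ltP t (3/4).
  by rewrite ltr_wpDl ?flat0_ge0// flat0_gt0//; lra.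
by rewrite ltr_pwDl ?flat0_ge0// flat0_gt0//; lra.
Qed.

Lemma Cn1_cutoff n : Cn1 n cutoff.
Proof.
apply: Cn1M; first by apply: Cn1_affine; exact: Cn1_flat.
apply: Cn1V; first exact: den_neq0.
by apply: Cn1D; apply: Cn1_affine; exact: Cn1_flat.
Qed.

(** [smooth_step] is a bounded smooth function equal to 0 before 1/4 and to 1
    after 3/4.  Taking it as the derivative of an explicit function, rather
    than [cutoff] itself, gives a primitive whose value is known after 3/4, hence
    the exact integrals of the step and of the bump.  The step may overshoot and
    the bump change sign: only their integrals, supports and bounds matter. *)
Definition smooth_ramp (t : R) : R := (t - 2^-1) * cutoff t.
Definition smooth_step : R -> R := derive1 smooth_ramp.
Definition smooth_bump : R -> R := derive1 smooth_step.

Lemma Cn1_smooth_ramp n : Cn1 n smooth_ramp.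
Proof.
apply: Cn1M; last exact: Cn1_cutoff.
apply: Cn1D; last exact: Cn1_cst.
elim: n => [|n _]; first by move=> x; exact: cvg_id.
by exists (fun=> 1); [move=> x; exact: is_derive_id|exact: Cn1_cst].
Qed.

Lemma Cn1_smooth_step n : Cn1 n smooth_step.
Proof. exact: (Cn1_derive1 (Cn1_smooth_ramp _)).2. Qed.

Lemma Cn1_smooth_bump n : Cn1 n smooth_bump.
Proof. exact: (Cn1_derive1 (Cn1_smooth_step _)).2. Qed.

Lemma is_derive_smooth_ramp (t : R) : is_derive t 1 smooth_ramp (smooth_step t).
Proof. exact: (Cn1_derive1 (Cn1_smooth_ramp 1)).1. Qed.

Lemma is_derive_smooth_step (t : R) : is_derive t 1 smooth_step (smooth_bump t).
Proof. exact: (Cn1_derive1 (Cn1_smooth_step 1)).1. Qed.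

Lemma smooth_ramp_left (t : R) : t <= 4^-1 -> smooth_ramp t = 0.
Proof.
by move=> t4; rewrite /smooth_ramp /cutoff flat_le0 ?mul0r ?mulr0//; lra.
Qed.

Lemma smooth_ramp_right (t : R) : 3 / 4 <= t -> smooth_ramp t = t - 2^-1.
Proof.
move=> t4; rewrite /smooth_ramp /cutoff (@flat_le0 0 (- 1 * t + _)); last lra.
by rewrite addr0 divff ?mulr1// gt_eqF// flat0_gt0//; lra.
Qed.

Let derive1_near f (a : R) (t c : R) :
  (\near t, f t = a * t + c) -> derive1 f t = a.
Proof.
move=> H; rewrite derive1E (near_eq_derive (1 : R) H).
have -> : 'D_(1 : R) (fun t : R => a * t + c) t = a%:A + 0 by exact: derive_val.
by rewrite addr0 /GRing.scale/= mulr1.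
Qed.

Lemma smooth_step_left (t : R) : t < 4^-1 -> smooth_step t = 0.
Proof.
move=> t4; apply: (@derive1_near _ 0 t 0).
near=> s; rewrite mul0r addr0 smooth_ramp_left// ltW//.
by near: s; exact: lt_nbhsl.
Unshelve. all: by end_near. Qed.

Lemma smooth_step_right (t : R) : 3 / 4 < t -> smooth_step t = 1.
Proof.
move=> t4; apply: (@derive1_near _ 1 t (- 2^-1)).
near=> s; rewrite mul1r smooth_ramp_right// ltW//.
by near: s; exact: lt_nbhsr.
Unshelve. all: by end_near. Qed.

Lemma smooth_bump_left (t : R) : t < 4^-1 -> smooth_bump t = 0.
Proof.
move=> t4; apply: (@derive1_near _ 0 t 0).
near=> s; rewrite mul0r addr0 smooth_step_left//.
by near: s; exact: lt_nbhsl.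
Unshelve. all: by end_near. Qed.

Lemma smooth_bump_right (t : R) : 3 / 4 < t -> smooth_bump t = 0.
Proof.
move=> t4; apply: (@derive1_near _ 0 t 1).
near=> s; rewrite mul0r add0r smooth_step_right//.
by near: s; exact: lt_nbhsr.
Unshelve. all: by end_near. Qed.

Lemma smooth_step_bump_bounded : exists2 C, 1 <= C &
  forall t, `|smooth_step t| <= C /\ `|smooth_bump t| <= C.
Proof.
have [M M0 HM] := @continuous_itv_bounded _ (4^-1) (3/4)
  (Cn1_continuous (Cn1_smooth_step 0)).
have [N N0 HN] := @continuous_itv_bounded _ (4^-1) (3/4)
  (Cn1_continuous (Cn1_smooth_bump 0)).
exists (1 + M + N) => [|t]; first lra.
have [t1|t1] := ltP t 4^-1.
  by rewrite smooth_step_left// smooth_bump_left// normr0; split; lra.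
have [t2|t2] := ltP (3/4) t.
  by rewrite smooth_step_right// smooth_bump_right// normr0 normr1; split; lra.
have t12 : 4^-1 <= t <= 3/4 by apply/andP.
by split; [have := HM _ t12; lra|have := HN _ t12; lra].
Qed.

End smooth_step.

(** The three profiles attached to the interval from s to s + h, normalised so
    that each is the derivative of the next one.  Their argument is (t - s) / h
    written as an affine function of t, under which smoothness is stable. *)
HB.lock Definition bump_at (R : realType) (s h t : R) : R :=
  h^-1 * smooth_bump (h^-1 * t + - (h^-1 * s)).
HB.lock Definition step_at (R : realType) (s h t : R) : R :=
  smooth_step (h^-1 * t + - (h^-1 * s)).
HB.lock Definition ramp_at (R : realType) (s h t : R) : R :=
  h * smooth_ramp (h^-1 * t + - (h^-1 * s)).

Section scaled.
Context {R : realType}.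
Variables s h : R.
Implicit Types (f : R -> R) (t : R).
Hypothesis h0 : 0 < h.

Let hn0 : h != 0. Proof. by rewrite gt_eqF. Qed.

Let argE t : h^-1 * t + - (h^-1 * s) = (t - s) / h.
Proof. by field. Qed.

Let dc f f' (t : R) : (forall x : R, is_derive x 1 f (f' x)) ->
  is_derive t 1 (fun t => f (h^-1 * t + - (h^-1 * s)))
   (f' (h^-1 * t + - (h^-1 * s)) * h^-1).
Proof.
move=> H; apply: (is_derive1_comp (H _)).
by apply: is_derive_eq; rewrite subr0 /GRing.scale/= mulr1.
Qed.

Lemma is_derive_step_at (t : R) : is_derive t 1 (step_at s h) (bump_at s h t).
Proof.
rewrite bump_at.unlock step_at.unlock.
by apply: (is_derive_eq (dc t is_derive_smooth_step)); rewrite mulrC.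
Qed.

Lemma is_derive_ramp_at (t : R) : is_derive t 1 (ramp_at s h) (step_at s h t).
Proof.
rewrite ramp_at.unlock step_at.unlock.
have := @is_deriveZ _ _ _ _ h t 1 _ (dc t is_derive_smooth_ramp).
by move=> H; apply: (is_derive_eq H); rewrite /GRing.scale/= mulrCA divff// mulr1.
Qed.

Lemma Cn1_bump_at n : Cn1 n (bump_at s h).
Proof.
rewrite bump_at.unlock; apply: Cn1M; first exact: Cn1_cst.
by apply: Cn1_affine; exact: Cn1_smooth_bump.
Qed.

Lemma Cn1_step_at n : Cn1 n (step_at s h).
Proof. by rewrite step_at.unlock; apply: Cn1_affine; exact: Cn1_smooth_step. Qed.

Lemma step_at_left t : t < s + h / 4 -> step_at s h t = 0.
Proof.
by move=> H; rewrite step_at.unlock smooth_step_left// argE ltr_pdivrMr//; lra.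
Qed.

Lemma step_at_right t : s + 3 / 4 * h < t -> step_at s h t = 1.
Proof.
by move=> H; rewrite step_at.unlock smooth_step_right// argE ltr_pdivlMr//; lra.
Qed.

Lemma bump_at_out t : t < s + h / 4 \/ s + 3 / 4 * h < t -> bump_at s h t = 0.
Proof.
rewrite bump_at.unlock argE => -[H|H].
  by rewrite smooth_bump_left ?mulr0// ltr_pdivrMr//; lra.
by rewrite smooth_bump_right ?mulr0// ltr_pdivlMr//; lra.
Qed.

Lemma ramp_at_left t : t <= s -> ramp_at s h t = 0.
Proof.
move=> H; rewrite ramp_at.unlock smooth_ramp_left ?mulr0// argE ler_pdivrMr//. have := h0; lra.
Qed.

Lemma ramp_at_right t : s + h <= t -> ramp_at s h t = t - s - h / 2.
Proof.
move=> H; rewrite ramp_at.unlock argE smooth_ramp_right ?ler_pdivlMr//; last by have := h0; lra.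
by field.
Qed.

Lemma step_at_bound M t : (forall u, `|smooth_step u| <= M) ->
  `|step_at s h t| <= M.
Proof. by move=> bM; rewrite step_at.unlock. Qed.

Lemma bump_at_bound M t : (forall u, `|smooth_bump u| <= M) ->
  `|bump_at s h t| <= M / h.
Proof.
move=> bM; rewrite bump_at.unlock normrM normfV (gtr0_norm h0) mulrC.
by rewrite ler_wpM2r ?invr_ge0 ?(ltW h0).
Qed.

End scaled.

Section ftc.
Context {R : realType}.
Local Notation mu := (@lebesgue_measure R).

Lemma integral_oo_cc (a b : R) (f : R -> R) : continuous f ->
  (\int[mu]_(x in `]a, b[) (f x)%:E = \int[mu]_(x in `[a, b]) (f x)%:E)%E.
Proof.
move=> cf; apply/esym; apply: (@integral_itv_bndoo _ _ _ (EFin \o f)); apply/measurable_EFinP.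
exact: measurable_funTS (continuous_measurable_fun cf).
Qed.

Lemma FTC_oo (a b : R) (f g : R -> R) : a <= b ->
  (forall x : R, is_derive x 1 f (g x)) -> continuous g ->
  (\int[mu]_(x in `]a, b[) (g x)%:E = (f b - f a)%:E)%E.
Proof.
rewrite le_eqVlt => /predU1P[->|ab] fg cg.
  by rewrite set_itvoo0 integral_set0 subrr.
have cf := is_derive_continuous fg.
rewrite integral_oo_cc// (@continuous_FTC2 _ g f)//.
- exact: continuous_subspaceT.
- split.
  + by move=> x _; exact: ex_derive.
  + by apply: cvg_at_right_filter; exact: cf.
  + by apply: cvg_at_left_filter; exact: cf.
- by move=> x _; rewrite derive1E; exact: derive_val.
Qed.

Lemma integral_bump_at (a b s h : R) : 0 < h -> a <= s -> s + h <= b ->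
  (\int[mu]_(x in `]a, b[) (bump_at s h x)%:E = 1)%E.
Proof.
move=> h0 sa sb; rewrite (FTC_oo _ (is_derive_step_at s h)).
- rewrite (@step_at_left _ s h h0 a); last lra.
  by rewrite (@step_at_right _ s h h0 b) ?subr0//; lra.
- lra.
- exact: Cn1_continuous (Cn1_bump_at s h 0).
Qed.

(** Both ramps vanish at a, and at b they are affine functions that differ by
    t - s. *)
Lemma integral_step_atB (a b s t h : R) : 0 < h -> a <= s -> s + h <= b ->
  a <= t -> t + h <= b ->
  (\int[mu]_(x in `]a, b[) (step_at s h x - step_at t h x)%:E = (t - s)%:E)%E.
Proof.
move=> h0 sa sb ta tb.
have dB (x : R) : is_derive x 1 (fun x => ramp_at s h x - ramp_at t h x)
    (step_at s h x - step_at t h x).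
  by apply: is_deriveB; exact: is_derive_ramp_at.
rewrite (FTC_oo _ dB).
- rewrite (ramp_at_right h0 sb) (ramp_at_right h0 tb).
  by rewrite (ramp_at_left h0 sa) (ramp_at_left h0 ta); congr (_%:E); lra.
- lra.
- by move=> x; apply: cvgB; exact: Cn1_continuous (Cn1_step_at _ h 0) _.
Qed.

End ftc.

(** * Products of smooth functions as test functions *)

Section product_test_functions.
Context {R : realType}.
Implicit Types (F : R * R -> R) (x : R * R).

(* A partial derivative of F is the derivative of a slice of F, because the
   difference quotients are the same functions. *)
Let e1E x (h : R) : h *: e1 + x = (h *: 1 + x.1, x.2).
Proof.
have -> : h *: e1 + x = (h *: 1 + x.1, h *: 0 + x.2) by [].
by rewrite scaler0 add0r.
Qed.

Let e2E x (h : R) : h *: e2 + x = (x.1, h *: 1 + x.2).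
Proof.
have -> : h *: e2 + x = (h *: 0 + x.1, h *: 1 + x.2) by [].
by rewrite scaler0 add0r.
Qed.

Let quot1E F x :
  (fun h : R => h^-1 *: ((F \o shift x) (h *: e1) - F x)) =
  (fun h : R => h^-1 *: (((fun t => F (t, x.2)) \o shift x.1) (h *: (1 : R)) -
                         F (x.1, x.2))).
Proof.
by apply/funext => h; rewrite /= e1E -surjective_pairing.
Qed.

Lemma derivable_e1 F x :
  derivable F x e1 = derivable (fun t : R => F (t, x.2)) x.1 1.
Proof. by rewrite /derivable quot1E. Qed.

Lemma derive_e1 F x : 'D_e1 F x = 'D_1 (fun t : R => F (t, x.2)) x.1.
Proof. by rewrite /derive quot1E. Qed.

Let quot2E F x :
  (fun h : R => h^-1 *: ((F \o shift x) (h *: e2) - F x)) =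
  (fun h : R => h^-1 *: (((fun t => F (x.1, t)) \o shift x.2) (h *: (1 : R)) -
                         F (x.1, x.2))).
Proof.
by apply/funext => h; rewrite /= e2E -surjective_pairing.
Qed.

Lemma derivable_e2 F x :
  derivable F x e2 = derivable (fun t : R => F (x.1, t)) x.2 1.
Proof. by rewrite /derivable quot2E. Qed.

Lemma derive_e2 F x : 'D_e2 F x = 'D_1 (fun t : R => F (x.1, t)) x.2.
Proof. by rewrite /derive quot2E. Qed.

Lemma is_derive_prod1 (a a' b : R -> R) x :
  (forall t : R, is_derive t 1 a (a' t)) ->
  derivable (fun y : R * R => a y.1 * b y.2) x e1 /\
  'D_e1 (fun y : R * R => a y.1 * b y.2) x = a' x.1 * b x.2.
Proof.
move=> aa'; have H : is_derive x.1 1 (fun t => a t * b x.2) (a' x.1 * b x.2).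
  have := @is_deriveM _ _ a (fun=> b x.2) x.1 1 _ _ (aa' _) (is_derive_cst _ _ _).
  by move=> H; apply: (is_derive_eq H); rewrite /GRing.scale/= mulr0 add0r mulrC.
rewrite derivable_e1 derive_e1; split => /=; first exact: ex_derive.
exact: derive_val.
Qed.

Lemma is_derive_prod2 (a b b' : R -> R) x :
  (forall t : R, is_derive t 1 b (b' t)) ->
  derivable (fun y : R * R => a y.1 * b y.2) x e2 /\
  'D_e2 (fun y : R * R => a y.1 * b y.2) x = a x.1 * b' x.2.
Proof.
move=> bb'; have H : is_derive x.2 1 (fun t => a x.1 * b t) (a x.1 * b' x.2).
  have := @is_deriveM _ _ (fun=> a x.1) b x.2 1 _ _ (is_derive_cst _ _ _) (bb' _).
  by move=> H; apply: (is_derive_eq H); rewrite /GRing.scale/= mulr0 addr0.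
rewrite derivable_e2 derive_e2; split => /=; first exact: ex_derive.
exact: derive_val.
Qed.

Lemma is_Cn_prod n (a b : R -> R) : Cn1 n a -> Cn1 n b ->
  is_Cn n (fun y : R * R => a y.1 * b y.2).
Proof.
elim: n a b => [|n IH] a b na nb.
  split => // x; apply: cvgM.
  - apply: (@continuous_comp _ _ _ fst a); [exact: cvg_fst|exact: na].
  - apply: (@continuous_comp _ _ _ snd b); [exact: cvg_snd|exact: nb].
have [ca cb] := (Cn1_continuous na, Cn1_continuous nb).
have [ia ib] := (Cn1_leS na, Cn1_leS nb).
have [a' da na'] := na; have [b' db nb'] := nb; split.
  move=> x; apply: cvgM.
  - apply: (@continuous_comp _ _ _ fst a); [exact: cvg_fst|exact: ca].
  - apply: (@continuous_comp _ _ _ snd b); [exact: cvg_snd|exact: cb].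
split.
  move=> x; split; first exact: (is_derive_prod1 b x da).1.
  exact: (is_derive_prod2 a x db).1.
split.
- rewrite (_ : 'D_e1 _ = fun y => a' y.1 * b y.2); first exact: IH.
  by apply/funext => x; exact: (is_derive_prod1 b x da).2.
- rewrite (_ : 'D_e2 _ = fun y => a y.1 * b' y.2); first exact: IH.
  by apply/funext => x; exact: (is_derive_prod2 a x db).2.
Qed.

Lemma test_function_prod (U : set (R * R)) (a b : R -> R) (p q r s : R) :
  (forall n, Cn1 n a) -> (forall n, Cn1 n b) ->
  (forall t, t < p \/ q < t -> a t = 0) ->
  (forall t, t < r \/ s < t -> b t = 0) ->
  `[p, q] `*` `[r, s] `<=` U ->
  test_function U (fun y : R * R => a y.1 * b y.2).
Proof.
move=> na nb a0 b0 subU; split; first by move=> n; exact: is_Cn_prod.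
exists (`[p, q] `*` `[r, s]); split => //.
  by apply: compact_setX; exact: segment_compact.
move=> [x y] /= H.
have [/andP[px xq]|] := boolP (p <= x <= q); last first.
  rewrite negb_and -!ltNge => /orP xpq; rewrite a0 ?mul0r//.
have [/andP[ry ys]|] := boolP (r <= y <= s); last first.
  rewrite negb_and -!ltNge => /orP xpq; rewrite b0 ?mulr0//.
by exfalso; apply: H; split; rewrite /= in_itv/=; apply/andP.
Qed.

End product_test_functions.

(** * Integrals of nonnegative functions and measurability in the plane *)

(** The integral of a nonnegative function is the supremum of the integrals of
    the simple functions below it: a function that is not known to be measurable
    is thus still controlled by any bound on it. *)
Lemma ge0_le_integral_dominated d (T : measurableType d) (R : realType)
    (mu : {measure set T -> \bar R}) (D : set T) (f g : T -> \bar R) :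
  (forall x, D x -> 0 <= f x)%E -> (forall x, D x -> f x <= g x)%E ->
  (\int[mu]_(x in D) f x <= \int[mu]_(x in D) g x)%E.
Proof.
move=> f0 fg; have g0 x : D x -> (0 <= g x)%E.
  by move=> Dx; apply: le_trans (fg _ Dx); exact: f0.
rewrite !ge0_integralE//; apply: ereal_sup_le => _ [h hf <-]; exists h => // x.
apply: le_trans (hf x) _; rewrite /patch; case: ifPn => //.
by rewrite inE => /fg.
Qed.

(* Tonelli on a product of sets follows from Tonelli on the whole space, applied
   to the extension of f by 0. *)
Section tonelli_on_rectangle.
Context d1 d2 (T1 : measurableType d1) (T2 : measurableType d2) (R : realType).
Variables (m1 : {sigma_finite_measure set T1 -> \bar R})
          (m2 : {sigma_finite_measure set T2 -> \bar R}).
Variables (D1 : set T1) (D2 : set T2) (f : T1 * T2 -> \bar R).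
Hypotheses (mD1 : measurable D1) (mD2 : measurable D2).
Hypotheses (mf : measurable_fun setT f) (f0 : forall z, (0 <= f z)%E).

Let fD := f \_ (D1 `*` D2).

Let mfD : measurable_fun setT fD.
Proof.
have := (measurable_restrictT f (measurableX mD1 mD2)).1; apply.
exact: measurable_funTS.
Qed.

Let fD0 z : (0 <= fD z)%E. Proof. by apply: erestrict_ge0. Qed.

Let fDE x y : fD (x, y) =
  if (x \in D1) && (y \in D2) then f (x, y) else 0%E.
Proof. by rewrite /fD /patch in_setX. Qed.

Lemma tonelli_rect1 :
  (\int[m1 \x m2]_(z in D1 `*` D2) f z =
   \int[m1]_(x in D1) \int[m2]_(y in D2) f (x, y))%E.
Proof.
rewrite integral_mkcond fubini_tonelli1// [RHS]integral_mkcond.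
apply: eq_integral => x _; rewrite /fubini_F [RHS]/patch.
case: ifPn => xD; last first.
  by apply: integral0_eq => y _; rewrite -/fD fDE (negbTE xD).
rewrite [RHS]integral_mkcond; apply: eq_integral => y _.
by rewrite -/fD fDE xD /= /patch.
Qed.

Lemma tonelli_rect2 :
  (\int[m1 \x m2]_(z in D1 `*` D2) f z =
   \int[m2]_(y in D2) \int[m1]_(x in D1) f (x, y))%E.
Proof.
rewrite integral_mkcond fubini_tonelli2// [RHS]integral_mkcond.
apply: eq_integral => y _; rewrite /fubini_G [RHS]/patch.
case: ifPn => yD; last first.
  by apply: integral0_eq => x _; rewrite -/fD fDE (negbTE yD) andbF.
rewrite [RHS]integral_mkcond; apply: eq_integral => x _.
by rewrite -/fD fDE yD andbT /patch.
Qed.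

End tonelli_on_rectangle.

Section plane.
Context {R : realType}.
Local Notation mu2 := (@lebesgue2 R).

Lemma measurable_rect (i j : interval R) :
  measurable ([set` i] `*` [set` j] : set (plane R)).
Proof. by apply: measurableX; exact: measurable_itv. Qed.

Lemma lebesgue2_rect (a b c d : R) : a <= b -> c <= d ->
  mu2 (`]a, b[ `*` `]c, d[) = ((b - a) * (d - c))%:E.
Proof.
move=> ab cd; transitivity
  (lebesgue_measure (`]a, b[%classic : set R) *
   lebesgue_measure (`]c, d[%classic : set R))%E.
  by apply: product_measure1E; exact: measurable_itv.
rewrite !lebesgue_measure_itv/= !lte_fin.
have H (x y : R) : x <= y ->
    (if x < y then (y%:E - x%:E)%E else 0%E) = (y - x)%:E :> \bar R.
  by rewrite le_eqVlt => /predU1P[->|->//]; rewrite ltxx subrr.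
by rewrite !H.
Qed.

Lemma measurable_omega (L : R) : measurable (omega L : set (plane R)).
Proof. exact: measurable_rect. Qed.

Lemma lebesgue2_omega (L : R) : 0 <= L -> mu2 (omega L) = (L * L)%:E.
Proof. by move=> L0; rewrite lebesgue2_rect// subr0. Qed.

(** An open set is the union of the boxes with rational vertices that it
    contains, and there are countably many of them. *)
Lemma open_measurable_plane (U : set (R * R)) :
  open U -> measurable (U : set (plane R)).
Proof.
move=> oU.
pose box (q : (rat * rat) * (rat * rat)) : set (plane R) :=
  `]ratr q.1.1, ratr q.1.2[ `*` `]ratr q.2.1, ratr q.2.2[.
pose F q := if pselect (box q `<=` U) then box q else set0.
have -> : U = \bigcup_q F q.
  apply/seteqP; split => [x Ux|x [q _]]; last first.
    by rewrite /F; case: pselect => // qU; exact: qU.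
  have /nbhs_ballP[e /= e0 eU] := open_nbhs_nbhs (conj oU Ux).
  have rat_near (y : R) : exists p : rat * rat,
      [/\ y - e < ratr p.1, ratr p.1 < y, y < ratr p.2 & ratr p.2 < y + e].
    have [|p] := @rat_in_itvoo R (y - e) y; first by rewrite ltrBlDr ltrDl.
    have [|q] := @rat_in_itvoo R y (y + e); first by rewrite ltrDl.
    by rewrite !in_itv/= => /andP[? ?] /andP[? ?]; exists (p, q).
  have [p [p1 p2 p3 p4]] := rat_near x.1.
  have [q [q1 q2 q3 q4]] := rat_near x.2.
  exists (p, q) => //; rewrite /F; case: pselect => [?|[]].
    by split; rewrite /= in_itv/=; apply/andP.
  move=> y [/=]; rewrite !in_itv/= => /andP[y1 y2] /andP[y3 y4].
  apply: eU; split; rewrite /ball/= ltr_norml; apply/andP; split; lra.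
apply: countable_bigcupT_measurable; first exact: countableP.
by move=> q; rewrite /F; case: pselect => ?; [exact: measurable_rect|exact: measurable0].
Qed.

Lemma continuous_measurable_plane (f : R * R -> R) :
  continuous f -> measurable_fun setT (f : plane R -> R).
Proof.
move=> /continuousP cf; apply: (measurability _ (RGenOpens.measurableE R)) => //.
move=> _ [_ [a [b ->] <-]]; rewrite setTI; apply: open_measurable_plane.
by apply: cf; exact: interval_open.
Qed.

End plane.

Section ereal_limits.
Local Open Scope ereal_scope.
Context {R : realType} {T : Type} {F : set_system T} {FF : Filter F}.

Lemma cvge0_lt (f : T -> \bar R) (eta : R) : (0 < eta)%R ->
  f x @[x --> F] --> 0 -> \forall x \near F, f x < eta%:E.
Proof.
move=> eta0 f0; apply: (f0 [set y | y < eta%:E]); apply: open_nbhs_nbhs.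
by split; [exact: open_ereal_lt_ereal|rewrite /= lte_fin].
Qed.

Lemma ge0_cvge0 (f : T -> \bar R) : (forall x, 0 <= f x) ->
  (forall eta : R, (0 < eta)%R -> \forall x \near F, f x <= eta%:E) ->
  f x @[x --> F] --> 0.
Proof.
move=> f0 H; have fin e : (0 < e)%R ->
    \forall x \near F, f x \is a fin_num /\ (fine (f x) <= e)%R.
  move=> e0; apply: filterS (H _ e0) => x fxe.
  have ffin : f x \is a fin_num.
    by rewrite ge0_fin_numE// (le_lt_trans fxe)// ltry.
  by split => //; rewrite -lee_fin fineK.
apply/fine_cvgP; split.
  by apply: filterS (fin 1%R ltr01) => x [].
apply/cvgrPdist_lt => e e0; have e2 : (0 < e / 2)%R by rewrite divr_gt0.
apply: filterS (fin _ e2) => x [_ fxe].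
rewrite sub0r normrN /= ger0_norm ?fine_ge0//; lra.
Qed.

End ereal_limits.

(** * Mean oscillation at a small scale *)

Section oscillation.
Context {R : realType}.
Variable L : R.
Hypothesis L0 : 0 < L.
Local Notation mu2 := (@lebesgue2 R).
Local Notation mu4 := (@lebesgue4 R).
Local Notation om := (omega L : set (plane R)).
Implicit Types (r eta : R) (g h k : plane R -> R).

Definition close_pairs r : set (plane R * plane R) :=
  [set z | `|z.1.1 - z.2.1| < r /\ `|z.1.2 - z.2.2| < r].

(** For fixed x, four times the uniform density on the square of centre x and
    half-side r. *)
Definition avg_kernel r (z : plane R * plane R) : R :=
  r ^- 2 * \1_(close_pairs r) z.

Lemma measurable_close_pairs r : measurable (close_pairs r).
Proof.
have m1 : measurable_fun setT
    (fun z : plane R * plane R => `|z.1.1 - z.2.1| : measurableTypeR R).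
  apply: measurableT_comp => //; apply: measurable_funB.
    exact: measurableT_comp measurable_fst measurable_fst.
  exact: measurableT_comp measurable_fst measurable_snd.
have m2 : measurable_fun setT
    (fun z : plane R * plane R => `|z.1.2 - z.2.2| : measurableTypeR R).
  apply: measurableT_comp => //; apply: measurable_funB.
    exact: measurableT_comp measurable_snd measurable_fst.
  exact: measurableT_comp measurable_snd measurable_snd.
have -> : close_pairs r =
  (setT `&` (fun z => `|z.1.1 - z.2.1|) @^-1` `]-oo, r[) `&`
  (setT `&` (fun z => `|z.1.2 - z.2.2|) @^-1` `]-oo, r[).
  apply/seteqP; split => z /=; rewrite !in_itv/=; first by move=> [].
  by move=> [[_ ?] [_ ?]].
apply: measurableI.
- by apply: m1 => //; exact: measurable_itv.
- by apply: m2 => //; exact: measurable_itv.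
Qed.

Lemma measurable_avg_kernel r : measurable_fun setT (avg_kernel r).
Proof.
apply: measurable_funM; first exact: measurable_cst.
by apply: measurable_indic; exact: measurable_close_pairs.
Qed.

Lemma avg_kernel_ge0 r z : 0 <= avg_kernel r z.
Proof. by rewrite /avg_kernel mulr_ge0// invr_ge0 sqr_ge0. Qed.

Lemma avg_kernelC r x y : avg_kernel r (x, y) = avg_kernel r (y, x).
Proof.
rewrite /avg_kernel !indicE; congr (_ * (nat_of_bool _)%:R).
by apply/idP/idP; rewrite !inE /close_pairs/= => -[? ?]; split; rewrite distrC.
Qed.

Lemma avg_kernel_mass r x : 0 < r ->
  (\int[mu2]_(y in om) (avg_kernel r (x, y))%:E <= 4%:E)%E.
Proof.
move=> r0.
have -> : (4 : R) = r ^- 2 * ((x.1 + r - (x.1 - r)) * (x.2 + r - (x.2 - r))).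
  by field; rewrite gt_eqF.
pose Q : set (plane R) := `]x.1 - r, x.1 + r[ `*` `]x.2 - r, x.2 + r[.
have mQ : measurable Q by exact: measurable_rect.
apply: (@le_trans _ _ (\int[mu2]_(y in om) ((r ^- 2)%:E * (\1_Q y)%:E))%E).
  apply: ge0_le_integral_dominated => y _; first by rewrite lee_fin avg_kernel_ge0.
  rewrite -EFinM lee_fin /avg_kernel ler_wpM2l// ?invr_ge0 ?sqr_ge0//.
  rewrite !indicE; case: (boolP ((x, y) \in _)) => // H.
  suff -> : y \in Q by [].
  move: H; rewrite !inE /close_pairs/= => -[].
  rewrite !ltr_norml => /andP[? ?] /andP[? ?].
  by split; rewrite /= in_itv/=; apply/andP; split; lra.
rewrite ge0_integralZl//; last 3 first.
- exact: measurable_omega.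
- by apply/measurable_EFinP; exact: measurable_indic.
- by rewrite lee_fin invr_ge0 sqr_ge0.
rewrite EFinM lee_wpmul2l ?lee_fin ?invr_ge0 ?sqr_ge0//.
rewrite integral_indic//; last exact: measurable_omega.
rewrite -lebesgue2_rect; [|lra|lra].
apply: le_measure; rewrite ?inE//.
by apply: measurableI => //; exact: measurable_omega.
Qed.

Let mom : measurable om. Proof. exact: measurable_omega. Qed.

Let mker_fst r k : measurable_fun setT k ->
  measurable_fun setT (fun z : plane R * plane R => (avg_kernel r z * k z.1)%:E).
Proof.
move=> mk; apply/measurable_EFinP; apply: measurable_funM.
  exact: measurable_avg_kernel.
exact: measurableT_comp mk measurable_fst.
Qed.

Let mker_snd r k : measurable_fun setT k ->
  measurable_fun setT (fun z : plane R * plane R => (avg_kernel r z * k z.2)%:E).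
Proof.
move=> mk; apply/measurable_EFinP; apply: measurable_funM.
  exact: measurable_avg_kernel.
exact: measurableT_comp mk measurable_snd.
Qed.

Lemma integral_kernel_fst r k : 0 < r ->
  measurable_fun setT k -> (forall x, 0 <= k x) ->
  (\int[mu4]_(z in om `*` om) (avg_kernel r z * k z.1)%:E <=
   4%:E * \int[mu2]_(x in om) (k x)%:E)%E.
Proof.
move=> r0 mk k0.
rewrite /lebesgue4 tonelli_rect1//; last 2 first.
- exact: mker_fst.
- by move=> z; rewrite lee_fin mulr_ge0 ?avg_kernel_ge0.
rewrite -ge0_integralZl//; last 2 first.
- by apply/measurable_EFinP; exact: measurable_funTS.
- by move=> x _; rewrite lee_fin.
apply: ge0_le_integral_dominated => x _.
  by apply: integral_ge0 => y _; rewrite lee_fin mulr_ge0 ?avg_kernel_ge0.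
under eq_integral do rewrite /= mulrC EFinM.
rewrite ge0_integralZl//; last 3 first.
- apply/measurable_EFinP; apply: measurable_funTS.
  exact: measurableT_comp (measurable_avg_kernel r) (pair1_measurable x).
- by move=> y _; rewrite lee_fin avg_kernel_ge0.
- by rewrite lee_fin.
by rewrite muleC lee_wpmul2r ?lee_fin//; exact: avg_kernel_mass.
Qed.

Lemma integral_kernel_snd r k : 0 < r ->
  measurable_fun setT k -> (forall x, 0 <= k x) ->
  (\int[mu4]_(z in om `*` om) (avg_kernel r z * k z.2)%:E <=
   4%:E * \int[mu2]_(x in om) (k x)%:E)%E.
Proof.
move=> r0 mk k0.
rewrite /lebesgue4 tonelli_rect2//; last 2 first.
- exact: mker_snd.
- by move=> z; rewrite lee_fin mulr_ge0 ?avg_kernel_ge0.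
rewrite -ge0_integralZl//; last 2 first.
- by apply/measurable_EFinP; exact: measurable_funTS.
- by move=> x _; rewrite lee_fin.
apply: ge0_le_integral_dominated => x _.
  by apply: integral_ge0 => y _; rewrite lee_fin mulr_ge0 ?avg_kernel_ge0.
under eq_integral do rewrite /= mulrC EFinM avg_kernelC.
rewrite ge0_integralZl//; last 3 first.
- apply/measurable_EFinP; apply: measurable_funTS.
  exact: measurableT_comp (measurable_avg_kernel r) (pair1_measurable x).
- by move=> y _; rewrite lee_fin avg_kernel_ge0.
- by rewrite lee_fin.
by rewrite muleC lee_wpmul2r ?lee_fin//; exact: avg_kernel_mass.
Qed.

Definition osc r h : \bar R :=
  (\int[mu4]_(z in om `*` om) (avg_kernel r z * `|h z.2 - h z.1|)%:E)%E.

Definition local_osc r h (x : plane R) : \bar R :=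
  (\int[mu2]_(y in om) (avg_kernel r (x, y) * `|h y - h x|)%:E)%E.

Let mosc r h : measurable_fun setT h ->
  measurable_fun setT
   (fun z : plane R * plane R => (avg_kernel r z * `|h z.2 - h z.1|)%:E).
Proof.
move=> mh; apply/measurable_EFinP; apply: measurable_funM.
  exact: measurable_avg_kernel.
apply: measurableT_comp => //; apply: measurable_funB.
  exact: measurableT_comp mh measurable_snd.
exact: measurableT_comp mh measurable_fst.
Qed.

Lemma local_osc_ge0 r h x : (0 <= local_osc r h x)%E.
Proof.
by apply: integral_ge0 => y _; rewrite lee_fin mulr_ge0 ?avg_kernel_ge0.
Qed.

Lemma measurable_local_osc r h : measurable_fun setT h ->
  measurable_fun setT (local_osc r h).
Proof.
move=> mh.
pose f (z : plane R * plane R) : \bar R :=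
  ((fun z : plane R * plane R => (avg_kernel r z * `|h z.2 - h z.1|)%:E)
    \_ (setT `*` om)) z.
have -> : local_osc r h = fubini_F mu2 f.
  apply/funext => x; rewrite /local_osc /fubini_F [LHS]integral_mkcond.
  by apply: eq_integral => y _; rewrite /f /patch in_setX in_setT.
apply: measurable_fun_fubini_tonelli_F.
  have := (measurable_restrictT
    (fun z : plane R * plane R => (avg_kernel r z * `|h z.2 - h z.1|)%:E)
    (measurableX (@measurableT _ (plane R)) mom)).1; apply.
  by apply: measurable_funTS; exact: mosc.
move=> z; rewrite /f /patch; case: ifP => // _.
by rewrite lee_fin mulr_ge0 ?avg_kernel_ge0.
Qed.

Lemma integral_local_osc r h : measurable_fun setT h ->
  (\int[mu2]_(x in om) local_osc r h x = osc r h)%E.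
Proof.
move=> mh; rewrite /osc /lebesgue4 [RHS]tonelli_rect1//; first exact: mosc.
by move=> z; rewrite lee_fin mulr_ge0 ?avg_kernel_ge0.
Qed.

Lemma osc_le_add r h g k : measurable_fun setT g -> measurable_fun setT k ->
  (forall x y, `|h y - h x| <= `|g y - g x| + `|k y - k x|) ->
  (osc r h <= osc r g + osc r k)%E.
Proof.
move=> mg mk H; rewrite /osc -ge0_integralD//; last 5 first.
- exact: measurableX.
- by move=> z _; rewrite lee_fin mulr_ge0 ?avg_kernel_ge0.
- by apply: measurable_funTS; exact: mosc.
- by move=> z _; rewrite lee_fin mulr_ge0 ?avg_kernel_ge0.
- by apply: measurable_funTS; exact: mosc.
apply: ge0_le_integral_dominated => z _.
  by rewrite lee_fin mulr_ge0 ?avg_kernel_ge0.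
by rewrite -EFinD lee_fin -mulrDr ler_wpM2l ?avg_kernel_ge0.
Qed.

(** The kernel has mass at most 4 in each of its two variables, so that each of
    `|h x| and `|h y| contributes 4 times the L^1 norm of h.  This makes the
    vanishing of the oscillation stable under L^1 limits. *)
Lemma osc_le_L1 r h : 0 < r -> measurable_fun setT h ->
  (osc r h <= 8%:E * \int[mu2]_(x in om) `|h x|%:E)%E.
Proof.
move=> r0 mh.
have mah : measurable_fun setT (fun x => `|h x|) by exact: measurableT_comp.
apply: (@le_trans _ _
  (\int[mu4]_(z in om `*` om) (avg_kernel r z * `|h z.1|)%:E +
   \int[mu4]_(z in om `*` om) (avg_kernel r z * `|h z.2|)%:E)%E).
  rewrite -ge0_integralD//; last 5 first.
  - exact: measurableX.
  - by move=> z _; rewrite lee_fin mulr_ge0 ?avg_kernel_ge0.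
  - by apply: measurable_funTS; exact: (mker_fst r mah).
  - by move=> z _; rewrite lee_fin mulr_ge0 ?avg_kernel_ge0.
  - by apply: measurable_funTS; exact: (mker_snd r mah).
  apply: ge0_le_integral_dominated => z _.
    by rewrite lee_fin mulr_ge0 ?avg_kernel_ge0.
  rewrite -EFinD lee_fin -mulrDr ler_wpM2l ?avg_kernel_ge0//.
  by rewrite (le_trans (ler_normB _ _))// addrC.
have -> : 8%:E = (4%:E + 4%:E :> \bar R)%E by rewrite -EFinD; congr (_%:E); lra.
rewrite ge0_muleDl//; apply: leeD.
- by apply: integral_kernel_fst.
- by apply: integral_kernel_snd.
Qed.

(** This is the L^1 continuity of the small translations of h, averaged over the
    translations, which is all that convergence of local averages needs. *)
Definition osc_vanishes h := measurable_fun setT h /\ forall eta, 0 < eta ->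
  exists2 r0 : R, 0 < r0 & forall r, 0 < r -> r < r0 -> (osc r h <= eta%:E)%E.

Lemma osc_vanishes_le h g k : osc_vanishes g -> osc_vanishes k ->
  measurable_fun setT h ->
  (forall x y, `|h y - h x| <= `|g y - g x| + `|k y - k x|) ->
  osc_vanishes h.
Proof.
move=> [mg Hg] [mk Hk] mh H; split => // eta eta0.
have e2 : 0 < eta / 2 by rewrite divr_gt0.
have [r1 r10 H1] := Hg _ e2; have [r2 r20 H2] := Hk _ e2.
exists (Num.min r1 r2); first by rewrite lt_min r10.
move=> r r0; rewrite lt_min => /andP[rr1 rr2].
apply: le_trans (osc_le_add r mg mk H) _.
by rewrite [eta]splitr EFinD leeD// ?H1 ?H2.
Qed.

Lemma osc_vanishes_cst (c : R) : osc_vanishes (fun=> c).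
Proof.
split; first exact: measurable_cst.
move=> eta eta0; exists 1 => // r r0 _; rewrite /osc integral0_eq ?lee_fin ?ltW//.
by move=> z _; rewrite subrr normr0 mulr0.
Qed.

Lemma osc_vanishesZ (c : R) h : osc_vanishes h -> osc_vanishes (fun x => c * h x).
Proof.
move=> [mh H]; split; first exact: measurable_funM.
move=> eta eta0; have c1 : 0 < `|c| + 1 by rewrite ltr_wpDl.
have [r0 r00 Hr] := H _ (divr_gt0 eta0 c1); exists r0 => // r rp rr0.
have -> : eta = (`|c| + 1) * (eta / (`|c| + 1)).
  by field; rewrite gt_eqF.
rewrite EFinM; apply: (@le_trans _ _ ((`|c| + 1)%:E * osc r h)%E); last first.
  by rewrite lee_wpmul2l ?lee_fin ?(ltW c1)//; exact: Hr.
rewrite /osc -ge0_integralZl//; last 3 first.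
- exact: measurableX.
- by apply: measurable_funTS; exact: mosc.
- by move=> z _; rewrite lee_fin mulr_ge0 ?avg_kernel_ge0.
apply: ge0_le_integral_dominated => z _.
  by rewrite lee_fin mulr_ge0 ?avg_kernel_ge0.
rewrite -EFinM lee_fin -mulrBr normrM mulrCA ler_wpM2r//.
  by rewrite mulr_ge0 ?avg_kernel_ge0.
by rewrite lerDl.
Qed.

Lemma osc_vanishesD g h : osc_vanishes g -> osc_vanishes h ->
  osc_vanishes (fun x => g x + h x).
Proof.
move=> og oh; apply: (osc_vanishes_le og oh).
  by apply: measurable_funD; [exact: og.1|exact: oh.1].
by move=> x y; rewrite opprD addrACA ler_normD.
Qed.

Lemma osc_vanishes_L1 h : measurable_fun setT h ->
  (forall eta, 0 < eta -> exists2 g, osc_vanishes g &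
     (\int[mu2]_(x in om) `|h x - g x|%:E <= eta%:E)%E) ->
  osc_vanishes h.
Proof.
move=> mh H; split => // eta eta0.
have e16 : 0 < eta / 16 by rewrite divr_gt0.
have [g [mg og] hg] := H _ e16.
have e2 : 0 < eta / 2 by rewrite divr_gt0.
have [r0 r00 Hr] := og _ e2; exists r0 => // r rp rr0.
have mhg : measurable_fun setT (fun x => h x - g x) by exact: measurable_funB.
apply: (@le_trans _ _ (osc r g + osc r (fun x => (h x - g x)%R))%E).
  apply: osc_le_add => // x y.
  rewrite (_ : h y - h x = (g y - g x) + ((h y - g y) - (h x - g x))); last ring.
  exact: ler_normD.
rewrite [eta in leRHS]splitr EFinD leeD// ?Hr//.
apply: le_trans (osc_le_L1 rp mhg) _.
have -> : eta / 2 = 8 * (eta / 16) by lra.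
by rewrite EFinM lee_wpmul2l.
Qed.

End oscillation.

(** * Bounded measurable functions have vanishing oscillation *)

Section boxes.
Context {R : realType}.

(** Half-open boxes are stable under intersection and generate the Borel sets of
    the plane, as needed for an induction on Dynkin systems. *)
Definition boxes : set (set (plane R)) :=
  [set Q | exists a b c d : R, Q = `]a, b] `*` `]c, d]].

Let sub_sigma (f : R -> R -> R -> R -> set (plane R)) (p : plane R -> R)
    (mE : forall a b c d, boxes (f a b c d)) :
  (forall a b, p @^-1` `]a, b] = \bigcup_n f a b (- n%:R) n%:R) ->
  forall A : set (measurableTypeR R), measurable A -> <<s boxes >> (p @^-1` A).
Proof.
move=> pE; suff : (@measurable _ (measurableTypeR R)) `<=`
  [set A | <<s boxes >> (p @^-1` A)] by [].
apply: smallest_sub => //.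
  split.
  - by rewrite /= preimage_set0; exact: sigma_algebra0.
  - by move=> A /=; rewrite setTD preimage_setC; exact: sigma_algebraC.
  - by move=> F mF /=; rewrite preimage_bigcup; exact: sigma_algebra_bigcup.
move=> _ [[a b] _ <-] /=; rewrite pE; apply: sigma_algebra_bigcup => n.
exact: sub_sigma_algebra.
Qed.

Let in_itv_nat (y : R) : exists n : nat, - n%:R < y /\ y <= n%:R.
Proof.
exists (Num.bound `|y|).
have := archi_boundP (normr_ge0 y).
by rewrite ltr_norml => /andP[? /ltW].
Qed.

Lemma measurable_plane_boxes : @measurable _ (plane R) = <<s boxes >>.
Proof.
apply/seteqP; split; last first.
  apply: smallest_sub; first exact: sigma_algebra_measurable.
  by move=> _ [a [b [c [d ->]]]]; exact: measurable_rect.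
apply: smallest_sub; first exact: smallest_sigma_algebra.
rewrite subUset; split => _ [A mA <-]; rewrite setTI.
- apply: (sub_sigma (f := fun a b c d => `]a, b] `*` `]c, d])) mA => [a b c d|a b].
    by exists a, b, c, d.
  apply/seteqP; split => [[x y] /= xab|[x y] [n _ []]//].
  have [n [n1 n2]] := in_itv_nat y; exists n => //; split => //=.
  by rewrite in_itv/= n1.
- apply: (sub_sigma (f := fun a b c d => `]c, d] `*` `]a, b])) mA => [a b c d|a b].
    by exists c, d, a, b.
  apply/seteqP; split => [[x y] /= xab|[x y] [n _ []]//].
  have [n [n1 n2]] := in_itv_nat x; exists n => //; split => //=.
  by rewrite in_itv/= n1.
Qed.

Lemma boxes_setI : setI_closed boxes.
Proof.
move=> _ _ [a [b [c [d ->]]]] [a' [b' [c' [d' ->]]]].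
exists (Num.max a a'), (Num.min b b'), (Num.max c c'), (Num.min d d').
apply/seteqP; split => [[x y]|[x y]] /=; rewrite !in_itv/= !gt_max !le_min.
  by move=> [[/andP[-> ->] /andP[-> ->]] [/andP[-> ->] /andP[-> ->]]].
by move=> [/andP[/andP[-> ->] /andP[-> ->]] /andP[/andP[-> ->] /andP[-> ->]]].
Qed.

End boxes.

Section strips.
Context {R : realType}.
Variable L : R.
Hypothesis L0 : 0 < L.
Local Notation mu2 := (@lebesgue2 R).
Local Notation om := (omega L : set (plane R)).

Definition strip1 (p q : R) : set (plane R) := `]p, q[ `*` setT.
Definition strip2 (p q : R) : set (plane R) := setT `*` `]p, q[.

Lemma measurable_strip1 p q : measurable (strip1 p q).
Proof. by apply: measurableX => //; exact: measurable_itv. Qed.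

Lemma measurable_strip2 p q : measurable (strip2 p q).
Proof. by apply: measurableX => //; exact: measurable_itv. Qed.

Lemma lebesgue2_strip1 p q : p <= q ->
  (mu2 (strip1 p q `&` om) <= ((q - p) * L)%:E)%E.
Proof.
move=> pq; rewrite -[in leRHS](subr0 L) -lebesgue2_rect ?(ltW L0)//.
apply: le_measure; rewrite ?inE//.
- by apply: measurableI; [exact: measurable_strip1|exact: measurable_omega].
- exact: measurable_rect.
- by move=> [x y] [[/= ? _] [/= _ ?]].
Qed.

Lemma lebesgue2_strip2 p q : p <= q ->
  (mu2 (strip2 p q `&` om) <= (L * (q - p))%:E)%E.
Proof.
move=> pq; rewrite -[in leRHS](subr0 L) -lebesgue2_rect ?(ltW L0)//.
apply: le_measure; rewrite ?inE//.
- by apply: measurableI; [exact: measurable_strip2|exact: measurable_omega].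
- exact: measurable_rect.
- by move=> [x y] [[/= _ ?] [/= ? _]].
Qed.

Lemma lebesgue2_setU_om (A B : set (plane R)) (a b : R) :
  measurable A -> measurable B ->
  (mu2 (A `&` om) <= a%:E)%E -> (mu2 (B `&` om) <= b%:E)%E ->
  (mu2 ((A `|` B) `&` om) <= (a + b)%:E)%E.
Proof.
move=> mA mB Aa Bb; have mom : measurable om by exact: measurable_omega.
rewrite setIUl EFinD; apply: le_trans (leeD Aa Bb).
by apply: measureU2; exact: measurableI.
Qed.

End strips.

Section oscillation_of_bounded_functions.
Context {R : realType}.
Variable L : R.
Hypothesis L0 : 0 < L.
Local Notation mu2 := (@lebesgue2 R).
Local Notation om := (omega L : set (plane R)).

(** The indicator takes different values at two points closer than r only if the
    first one is at distance less than r from one of the four lines that carry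
    the sides of the box. *)
Lemma osc_vanishes_box (a b c d : R) :
  osc_vanishes L (\1_(`]a, b] `*` `]c, d]) : plane R -> R).
Proof.
split; first by apply: measurable_indic; exact: measurable_rect.
(* Four strips of area at most 2 r L each, and a kernel of mass at most 4. *)
move=> eta eta0; exists (eta / (32 * L)); first by rewrite divr_gt0// mulr_gt0.
move=> r r0; rewrite ltr_pdivlMr ?mulr_gt0// => rL.
pose S := strip1 (a - r) (a + r) `|` strip1 (b - r) (b + r) `|`
          strip2 (c - r) (c + r) `|` strip2 (d - r) (d + r).
have mS : measurable S.
  by do 3?apply: measurableU; [exact: measurable_strip1..| |];
    exact: measurable_strip2.
apply: (@le_trans _ _ (4%:E * \int[mu2]_(x in om) (\1_S x)%:E)%E).
  apply: le_trans; last first.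
    apply: (integral_kernel_fst L r0) => //; exact: measurable_indic.
  apply: ge0_le_integral_dominated => -[[x1 x2] [y1 y2]] _.
    by rewrite lee_fin mulr_ge0 ?avg_kernel_ge0.
  rewrite lee_fin /avg_kernel indicE -!mulrA ler_wpM2l ?invr_ge0 ?sqr_ge0//.
  case: (boolP (_ \in close_pairs r)); last by rewrite !mul0r.
  rewrite inE /close_pairs/= !mul1r !ltr_norml => -[/andP[h1 h2] /andP[h3 h4]].
  rewrite !indicE /=; have [xS|] := boolP ((x1, x2) \in S).
    by case: (_ \in _); case: (_ \in _); rewrite ?subrr ?subr0 ?sub0r ?normrN ?normr1 ?normr0.
  rewrite notin_setE => xS.
  suff -> : ((y1, y2) \in `]a, b] `*` `]c, d]) = ((x1, x2) \in `]a, b] `*` `]c, d]).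
    by rewrite subrr normr0.
  have [n1 n2 n3 n4] : [/\ ~ (a - r < x1 < a + r), ~ (b - r < x1 < b + r),
      ~ (c - r < x2 < c + r) & ~ (d - r < x2 < d + r)].
    by split=> H; apply: xS; rewrite /S /strip1 /strip2 /=; [do 3 left|do 2 left; right|left; right|right];
      split; rewrite //= in_itv.
  have H (u v x y : R) : ~ (u - r < x < u + r) -> ~ (v - r < x < v + r) ->
    - r < x - y -> x - y < r -> (u < y <= v) = (u < x <= v).
    move=> /negP + /negP; rewrite !negb_and -!leNgt => /orP H1 /orP H2 H3 H4.
    apply/andP/andP => -[H5 H6]; split; case: H1 => ?; case: H2 => ?; lra.
  apply/idP/idP; rewrite !inE /= !in_itv /= => -[].
    by rewrite (H a b x1 y1)// (H c d x2 y2).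
  by rewrite -(H a b x1 y1)// -(H c d x2 y2).
have -> : eta = 4 * (eta / 4) by field.
rewrite EFinM lee_wpmul2l// integral_indic//; last exact: measurable_omega.
have H1 (p : R) : p - r <= p + r by lra.
apply: (@le_trans _ _ ((a + r - (a - r)) * L + (b + r - (b - r)) * L +
  L * (c + r - (c - r)) + L * (d + r - (d - r)))%:E); last by rewrite lee_fin; lra.
have ms1 := @measurable_strip1 R; have ms2 := @measurable_strip2 R.
have s1 p := lebesgue2_strip1 L0 (H1 p); have s2 p := lebesgue2_strip2 L0 (H1 p).
have m1 := measurableU _ _ (ms1 (a - r) (a + r)) (ms1 (b - r) (b + r)).
have m2 := measurableU _ _ m1 (ms2 (c - r) (c + r)).
have U1 := lebesgue2_setU_om (ms1 _ _) (ms1 _ _) (s1 a) (s1 b).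
have U2 := lebesgue2_setU_om m1 (ms2 _ _) U1 (s2 c).
exact: (lebesgue2_setU_om m2 (ms2 _ _) U2 (s2 d)).
Qed.

Lemma indic_setU_dist (T : Type) (A B : set T) (x y : T) :
  `|\1_(A `|` B) y - \1_(A `|` B) x| <=
  `|\1_A y - \1_A x| + `|\1_B y - \1_B x| :> R.
Proof.
rewrite !indicE !in_setU.
by case: (y \in A); case: (y \in B); case: (x \in A); case: (x \in B);
  rewrite /= ?subrr ?subr0 ?sub0r ?normrN ?normr1 ?normr0 ?addr0 ?add0r ?ler01 ?lerDl ?ler01.
Qed.

(** The sets whose indicator has a vanishing oscillation form a Dynkin system: a
    countable disjoint union is an L^1 limit of finite unions, as omega has
    finite measure. *)
Lemma osc_vanishes_indic (A : set (plane R)) :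
  measurable A -> osc_vanishes L (\1_A : plane R -> R).
Proof.
rewrite measurable_plane_boxes; move: A.
apply: (dynkin_induction (P := fun A => osc_vanishes L (\1_A : plane R -> R))).
- exact: measurable_plane_boxes.
- exact: boxes_setI.
- have := osc_vanishes_cst L (1 : R); congr (osc_vanishes _ _).
  by apply/funext => x; rewrite indicE in_setT.
- by move=> _ [a [b [c [d ->]]]]; exact: osc_vanishes_box.
- move=> A mA oA; have mAC := measurableC mA.
  apply: (osc_vanishes_le oA (osc_vanishes_cst L (0 : R))).
    exact: measurable_indic.
  move=> x y; rewrite subrr normr0 addr0 !indicE !in_setC.
  by case: (y \in A); case: (x \in A); rewrite /= ?subrr ?subr0 ?sub0r ?normrN.
- move=> F mF tF oF; apply: osc_vanishes_L1.
    by apply: measurable_indic; exact: bigcupT_measurable.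
  have oU n : osc_vanishes L (\1_(\big[setU/set0]_(i < n) F i) : plane R -> R).
    elim: n => [|n IH].
      have := osc_vanishes_cst L (0 : R); congr (osc_vanishes _ _).
      by apply/funext => x; rewrite big_ord0 indicE in_set0.
    apply: (osc_vanishes_le IH (oF n)).
      by apply: measurable_indic; exact: bigsetU_measurable.
    by move=> x y; rewrite big_ord_recr /=; exact: indic_setU_dist.
  pose E n := (\bigcup_k F k `\` \big[setU/set0]_(i < n) F i) `&` om.
  have mE n : measurable (E n).
    apply: measurableI; last exact: measurable_omega.
    apply: measurableD; first exact: bigcupT_measurable.
    exact: bigsetU_measurable.
  have E0 : \bigcap_n E n = set0.
    rewrite -subset0 => x Ex; have [[k _ Fkx] _] := (Ex 0%N I).1.
    have [[_ H] _] := Ex k.+1 I; apply: H.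
    by rewrite big_ord_recr /=; right.
  have Ecvg : mu2 (E n) @[n --> \oo] --> mu2 (\bigcap_n E n).
    apply: nonincreasing_cvg_mu => //.
    - apply: le_lt_trans (ltry (L * L)).
      rewrite -lebesgue2_omega ?(ltW L0)//; apply: le_measure; rewrite ?inE//.
        exact: measurable_omega.
      by move=> x [].
    - exact: bigcapT_measurable.
    - move=> m n mn; apply/subsetPset; apply: setSI; apply: setDS.
      exact: subset_bigsetU.
  rewrite E0 in Ecvg.
  move=> eta eta0; rewrite measure0 in Ecvg.
  have Elim : \forall n \near \oo, (mu2 (E n) < eta%:E)%E.
    exact: cvge0_lt Ecvg.
  case: Elim => n _ /(_ n (leqnn n)) En.
  exists (\1_(\big[setU/set0]_(i < n) F i) : plane R -> R) => //.
  apply: le_trans (ltW En).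
  rewrite /E -integral_indic; [|exact: measurable_omega|]; last first.
    apply: measurableD; first exact: bigcupT_measurable.
    exact: bigsetU_measurable.
  apply: ge0_le_integral_dominated => x _; first by rewrite lee_fin.
  rewrite lee_fin !indicE in_setD.
  have H : (x \in \big[setU/set0]_(i < n) F i) -> (x \in \bigcup_k F k).
    rewrite !inE -bigcup_mkord => -[k _ Fk]; by exists k.
  case: (boolP (x \in \big[setU/set0]_(i < n) F i)) H => [_ /(_ isT) ->|_ _].
    by rewrite subrr normr0.
  by rewrite subr0 andbT; case: (_ \in _); rewrite ?normr1 ?normr0.
Qed.

End oscillation_of_bounded_functions.

Section bounded_oscillation.
Import HBSimple.
Context {R : realType}.
Variable L : R.
Hypothesis L0 : 0 < L.
Local Notation mu2 := (@lebesgue2 R).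
Local Notation mu4 := (@lebesgue4 R).
Local Notation om := (omega L : set (plane R)).

Let mom : measurable om. Proof. exact: measurable_omega. Qed.

Lemma osc_vanishes_sfun (g : {sfun (plane R) >-> R}) : osc_vanishes L g.
Proof.
have -> : (g : plane R -> R) =
    fun x => \sum_(y <- finmap.enum_fset (fset_set (range g))) y * \1_(g @^-1` [set y]) x.
  by apply/funext => x; rewrite fimfunE fsbig_finite.
elim: (finmap.enum_fset (fset_set (range g))) => [|y s IH].
  have := osc_vanishes_cst L (0 : R); congr (osc_vanishes _ _).
  by apply/funext => x; rewrite big_nil.
have H := osc_vanishesD (osc_vanishesZ y (osc_vanishes_indic L0
  (measurable_funPTI g (measurable_set1 y)))) IH.
move: H; congr (osc_vanishes _ _).
by apply/funext => x; rewrite big_cons.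
Qed.

Lemma osc_vanishes_bounded (h : plane R -> R) (C : R) :
  measurable_fun setT h -> (forall x, `|h x| <= C) -> osc_vanishes L h.
Proof.
move=> mh hC; apply: osc_vanishes_L1 => //.
have ih : mu2.-integrable om (EFin \o h).
  apply: measurable_bounded_integrable => //.
  - apply: le_lt_trans (ltry (L * L)).
    by rewrite -lebesgue2_omega ?(ltW L0).
  - exact: measurable_funTS.
  - exists C; split; first exact: num_real.
    by move=> M CM x _ /=; apply: le_trans (hC x) (ltW CM).
have [g [_ _ gh]] := approximation_sfun_integrable mom ih.
move=> eta eta0; have [n _ /(_ n (leqnn n)) /= ngh] := cvge0_lt eta0 gh.
by exists (g n); [exact: osc_vanishes_sfun|apply: le_trans (ltW ngh)].
Qed.

(** ** Square-integrable errors controlled by an oscillation *)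

(** In omega, the points at distance less than 2 eps from one of the axes.  The
    cells around any other point stay away from gamma, and this strip has an area
    of order eps. *)
Definition low_edges (eps : R) : set (plane R) :=
  strip1 (- eps) (2 * eps) `|` strip2 (- eps) (2 * eps).

(** Bound for the square of an error that is at most C everywhere, and at most C
    times a local oscillation away from the low edges: the square of such an
    error is at most C times the error itself, so that L^1 estimates suffice for
    convergence in L^2. *)
Definition majorant (C : R) (h : plane R -> R) (eps : R) (x : plane R) : \bar R :=
  (C%:E * (C%:E * local_osc L (3 * eps) h x + (C * \1_(low_edges eps) x)%:E))%E.

Let mle eps : measurable (low_edges eps).
Proof.
by apply: measurableU; [exact: measurable_strip1|exact: measurable_strip2].
Qed.

Let mC (C : R) eps : measurable_fun setT
  (fun x : plane R => (C * \1_(low_edges eps) x)%:E).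
Proof.
apply/measurable_EFinP; apply: measurable_funM; first exact: measurable_cst.
exact: measurable_indic.
Qed.

Lemma majorant_ge0 C h eps x : 0 <= C -> (0 <= majorant C h eps x)%E.
Proof.
move=> C0; rewrite /majorant mule_ge0// adde_ge0//.
  by rewrite mule_ge0// local_osc_ge0.
by rewrite lee_fin mulr_ge0.
Qed.

Lemma measurable_majorant C h eps : measurable_fun setT h ->
  measurable_fun setT (majorant C h eps).
Proof.
move=> mh; apply: measurable_funeM; apply: emeasurable_funD => //.
by apply: measurable_funeM; exact: measurable_local_osc.
Qed.

Lemma le_majorant C h eps x (v : R) : `|v| <= C ->
  (`|v|%:E <= C%:E * local_osc L (3 * eps) h x + (C * \1_(low_edges eps) x)%:E)%E ->
  ((`|v| ^+ 2)%:E <= majorant C h eps x)%E.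
Proof.
move=> vC vB; have C0 : 0 <= C by apply: le_trans vC.
rewrite expr2 EFinM; apply: (@le_trans _ _ (C%:E * `|v|%:E)%E).
  by rewrite lee_wpmul2r.
by rewrite lee_wpmul2l.
Qed.

Lemma integral_majorant (C : R) (h : plane R -> R) : 0 < C -> osc_vanishes L h ->
  forall eta, 0 < eta -> exists2 r0 : R, 0 < r0 & forall eps, 0 < eps -> eps < r0 ->
    (\int[mu2]_(x in om) majorant C h eps x <= eta%:E)%E.
Proof.
move=> C0 [mh H] eta eta0.
have CC0 : 0 < C * C by rewrite mulr_gt0.
have e1 : 0 < eta / (2 * (C * C)) by rewrite divr_gt0// mulr_gt0.
have [r1 r10 Hr] := H _ e1.
have D0 : 0 < 12 * L * (C * C) by rewrite !mulr_gt0.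
(* The oscillation at scale 3 eps and the area 6 L eps of the low edges account
   for eta / 2 each. *)
exists (Num.min (r1 / 3) (eta / (12 * L * (C * C)))).
  by rewrite lt_min !divr_gt0.
move=> eps eps0; rewrite lt_min ltr_pdivlMr// ltr_pdivlMr// => /andP[h1 h2].
rewrite ge0_integralZl//; last 3 first.
- apply: measurable_funTS; apply: emeasurable_funD => //.
  by apply: measurable_funeM; exact: measurable_local_osc.
- move=> x _; rewrite adde_ge0 ?mule_ge0 ?local_osc_ge0 ?lee_fin ?(ltW C0)//.
  by rewrite mulr_ge0// ltW.
- by rewrite lee_fin ltW.
rewrite ge0_integralD//; last 4 first.
- by move=> x _; rewrite mule_ge0 ?local_osc_ge0 ?lee_fin ?(ltW C0).
- apply: measurable_funTS; apply: measurable_funeM.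
  exact: measurable_local_osc.
- by move=> x _; rewrite lee_fin mulr_ge0// ltW.
- by apply: measurable_funTS; exact: (mC C eps).
rewrite ge0_integralZl//; last 3 first.
- by apply: measurable_funTS; exact: measurable_local_osc.
- by move=> x _; exact: local_osc_ge0.
- by rewrite lee_fin ltW.
rewrite integral_local_osc//.
under [X in (_ + X)%E]eq_integral do rewrite EFinM.
rewrite ge0_integralZl//; last 2 first.
- by apply: measurable_funTS; apply/measurable_EFinP; exact: measurable_indic.
- by rewrite lee_fin ltW.
rewrite integral_indic// -ge0_muleDr ?mule_ge0//; last first.
  by apply: integral_ge0 => z _; rewrite lee_fin mulr_ge0 ?avg_kernel_ge0.
rewrite muleA -EFinM.
have eps2 : - eps <= 2 * eps by lra.
have M := lebesgue2_setU_om (measurable_strip1 _ _) (measurable_strip2 _ _)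
  (lebesgue2_strip1 L0 eps2) (lebesgue2_strip2 L0 eps2).
have O : (osc L (3 * eps) h <= (eta / (2 * (C * C)))%:E)%E.
  by apply: Hr; [rewrite mulr_gt0|rewrite mulrC].
apply: (@le_trans _ _ ((C * C)%:E * ((eta / (2 * (C * C)))%:E +
   ((2 * eps - - eps) * L + L * (2 * eps - - eps))%:E))%E).
  by rewrite lee_wpmul2l ?lee_fin ?(ltW CC0)//; exact: leeD O M.
rewrite -EFinD -EFinM lee_fin mulrDr.
have -> : C * C * (eta / (2 * (C * C))) = eta / 2 by field; rewrite gt_eqF.
rewrite [leRHS]splitr lerD2l; lra.
Qed.

Lemma integral_fst_rect (Y : set (plane R)) (B : plane R -> \bar R) :
  measurable Y -> mu2 Y = 1%:E -> measurable_fun setT B -> (forall x, 0 <= B x)%E ->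
  (\int[mu4]_(z in om `*` Y) B z.1 = \int[mu2]_(x in om) B x)%E.
Proof.
move=> mY Y1 mB B0; rewrite /lebesgue4 [LHS]tonelli_rect1//; last first.
  exact: measurableT_comp mB measurable_fst.
apply: eq_integral => x _ /=; rewrite integral_cst//.
by transitivity (B x * mu2 Y)%E => //; rewrite Y1 mule1.
Qed.

Lemma Lp_dist2_le d (T : measurableType d) (mu : {measure set T -> \bar R})
    (U : set T) (f g : T -> R) (B : T -> \bar R) (eta : R) :
  0 < eta -> (forall x, U x -> (`|f x - g x| ^+ 2)%:E <= B x)%E ->
  (\int[mu]_(x in U) B x <= (eta ^+ 2)%:E)%E ->
  (Lp_dist mu 2%:E U f g <= eta%:E)%E.
Proof.
move=> eta0 fgB HB; rewrite /Lp_dist unlock /=.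
have -> : eta%:E = ((eta ^+ 2)%:E `^ 2^-1 :> \bar R)%E.
  rewrite poweR_EFin -powR_mulrn ?ltW// -powRrM mulfV// powRr1//; exact: ltW.
apply: gt0_ler_poweR; rewrite ?invr_ge0 ?in_itv/= ?leey ?andbT//.
  - by apply: integral_ge0 => x _; rewrite lee_fin powR_ge0.
  - by rewrite lee_fin sqr_ge0.
apply: le_trans HB; rewrite [leRHS]integral_mkcond.
apply: ge0_le_integral_dominated => x _; first by rewrite lee_fin powR_ge0.
rewrite /patch /=; case: ifPn => xU.
  by rewrite powR_mulrn//; apply: fgB; exact: set_mem.
by rewrite normr0 powR0.
Qed.

End bounded_oscillation.

(** * Averages against a kernel *)

Section fubini_on_rectangle.
Context d1 d2 (T1 : measurableType d1) (T2 : measurableType d2) (R : realType).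
Variables (m1 : {sigma_finite_measure set T1 -> \bar R})
          (m2 : {sigma_finite_measure set T2 -> \bar R}).
Variables (D1 : set T1) (D2 : set T2) (f : T1 * T2 -> \bar R).
Hypotheses (mD1 : measurable D1) (mD2 : measurable D2).
Hypothesis (intf : (m1 \x m2)%E.-integrable (D1 `*` D2) f).

Let fD := f \_ (D1 `*` D2).

Let ifD : (m1 \x m2)%E.-integrable setT fD.
Proof. by apply/(integrable_mkcond f (measurableX mD1 mD2)). Qed.

Let fDE x y : fD (x, y) =
  if (x \in D1) && (y \in D2) then f (x, y) else 0%E.
Proof. by rewrite /fD /patch in_setX. Qed.

Lemma fubini_rect1 :
  (\int[m1 \x m2]_(z in D1 `*` D2) f z =
   \int[m1]_(x in D1) \int[m2]_(y in D2) f (x, y))%E.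
Proof.
rewrite [LHS]integral_mkcond -(integral12_prod_meas1 ifD) [RHS]integral_mkcond.
apply: eq_integral => x _; rewrite /fubini_F [RHS]/patch.
case: ifPn => xD; last first.
  by apply: integral0_eq => y _; rewrite fDE (negbTE xD).
rewrite [RHS]integral_mkcond; apply: eq_integral => y _.
by rewrite fDE xD /= /patch.
Qed.

Lemma fubini_rect2 :
  (\int[m1 \x m2]_(z in D1 `*` D2) f z =
   \int[m2]_(y in D2) \int[m1]_(x in D1) f (x, y))%E.
Proof.
rewrite [LHS]integral_mkcond -(integral21_prod_meas1 ifD) [RHS]integral_mkcond.
apply: eq_integral => y _; rewrite /fubini_G [RHS]/patch.
case: ifPn => yD; last first.
  by apply: integral0_eq => x _; rewrite fDE (negbTE yD) andbF.
rewrite [RHS]integral_mkcond; apply: eq_integral => x _.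
by rewrite fDE yD andbT /patch.
Qed.

End fubini_on_rectangle.

Section bounded_integrands.
Context {R : realType}.
Local Notation mu1 := (@lebesgue_measure R).
Local Notation mu2 := (@lebesgue2 R).

Lemma integrable_bounded_rect (a b c d : R) (f : plane R -> R) (M : R) :
  a <= b -> c <= d -> measurable_fun setT f ->
  (forall y, (`]a, b[ `*` `]c, d[) y -> `|f y| <= M) ->
  mu2.-integrable (`]a, b[ `*` `]c, d[) (EFin \o f).
Proof.
move=> ab cd mf fM; apply: measurable_bounded_integrable.
- exact: measurable_rect.
- apply: le_lt_trans (ltry ((b - a) * (d - c))).
  by rewrite -lebesgue2_rect.
- exact: measurable_funTS.
- exists M; split; first exact: num_real.
  by move=> N MN x Dx /=; apply: le_trans (fM _ Dx) (ltW MN).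
Qed.

Lemma integrable_bounded_itv (a b : R) (f : R -> R) (M : R) :
  measurable_fun setT (f : measurableTypeR R -> R) ->
  (forall y, `]a, b[%classic y -> `|f y| <= M) ->
  mu1.-integrable `]a, b[ (EFin \o f).
Proof.
move=> mf fM; apply: measurable_bounded_integrable.
- exact: measurable_itv.
- have H : (lebesgue_measure (`]a, b[%classic : set R) < +oo)%E.
    by rewrite lebesgue_measure_itv/=; case: ifP => _; rewrite ?ltry// -EFinD ltry.
  exact: H.
- exact: measurable_funTS.
- exists M; split; first exact: num_real.
  by move=> N MN x Dx /=; apply: le_trans (fM _ Dx) (ltW MN).
Qed.

Variable L : R.
Hypothesis L0 : 0 < L.
Local Notation om := (omega L : set (plane R)).

Let mom : measurable om. Proof. exact: measurable_omega. Qed.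

Lemma integrable_om (f : plane R -> R) (M : R) :
  measurable_fun setT f -> (forall y, `|f y| <= M) ->
  mu2.-integrable om (EFin \o f).
Proof.
by move=> mf fM; apply: (integrable_bounded_rect (M := M)) => //; exact: ltW.
Qed.

Lemma measurable_prod (a b : R -> R) : continuous a -> continuous b ->
  measurable_fun setT (fun y : plane R => a y.1 * b y.2).
Proof.
move=> ca cb; apply: measurable_funM.
- apply: (@measurableT_comp _ _ _ _ _ _ (a : measurableTypeR R -> R)) => //.
  exact: continuous_measurable_fun.
- apply: (@measurableT_comp _ _ _ _ _ _ (b : measurableTypeR R -> R)) => //.
  exact: continuous_measurable_fun.
Qed.

Lemma integral_prod (a b : R -> R) (A B M : R) :
  continuous a -> continuous b ->
  (forall t, `|a t| <= M) -> (forall t, `|b t| <= M) ->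
  (\int[mu1]_(x in `]0%R, L[) (a x)%:E = A%:E)%E ->
  (\int[mu1]_(x in `]0%R, L[) (b x)%:E = B%:E)%E ->
  (\int[mu2]_(y in om) (a y.1 * b y.2)%:E = (A * B)%:E)%E.
Proof.
move=> ca cb aM bM IA IB.
have M0 : 0 <= M by apply: le_trans (aM 0).
have ib : mu1.-integrable `]0%R, L[ (EFin \o b).
  apply: (integrable_bounded_itv (M := M)) => //.
  exact: continuous_measurable_fun.
have ia : mu1.-integrable `]0%R, L[ (EFin \o a).
  apply: (integrable_bounded_itv (M := M)) => //.
  exact: continuous_measurable_fun.
have iab : mu2.-integrable om (fun y => (a y.1 * b y.2)%:E).
  apply: (@integrable_om (fun y => a y.1 * b y.2) (M * M)).
    exact: measurable_prod.
  by move=> y; rewrite normrM ler_pM.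
rewrite /omega [LHS](fubini_rect1 _ _ iab); try exact: measurable_itv.
under eq_integral => x _.
  under eq_integral do rewrite /= EFinM.
  rewrite integralZl//=.
  over.
rewrite /= IB integralZr//.
by rewrite EFinM; congr (_ * _)%E.
Qed.

Lemma integral_rect_bound (g : plane R -> R) (M a b c d : R) :
  a <= b -> c <= d -> 0 <= M -> measurable_fun setT g ->
  (forall y, (`]a, b[ `*` `]c, d[) y -> `|g y| <= M) ->
  (forall y, om y -> ~ (`]a, b[ `*` `]c, d[) y -> g y = 0) ->
  `|\int[mu2]_(y in om) g y| <= M * ((b - a) * (d - c)).
Proof.
move=> ab cd M0 mg gM g0.
pose Q : set (plane R) := `]a, b[ `*` `]c, d[.
have mQ : measurable Q by exact: measurable_rect.
have gQ y : om y -> `|g y| <= M * \1_Q y.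
  move=> omy; rewrite indicE; have [yQ|] := boolP (y \in Q).
    by rewrite mulr1; apply: gM; exact: set_mem.
  by rewrite notin_setE => yQ; rewrite g0// normr0 mulr0.
have gi : mu2.-integrable om (EFin \o g).
  apply: measurable_bounded_integrable => //.
  - by apply: le_lt_trans (ltry (L * L)); rewrite -lebesgue2_omega ?(ltW L0).
  - exact: measurable_funTS.
  - exists M; split; first exact: num_real.
    move=> N MN x Dx /=; apply: le_trans (gQ _ Dx) _; apply: le_trans (ltW MN).
    by rewrite ler_piMr// indicE; case: (_ \in _).
rewrite -lee_fin EFin_normr_Rintegral//.
apply: le_trans (le_abse_integral _ _ _) _ => //.
  exact: measurable_int gi.
apply: (@le_trans _ _ (\int[mu2]_(y in om) (M%:E * (\1_Q y)%:E))%E).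
  apply: ge0_le_integral_dominated => y Dy; first exact: abse_ge0.
  by rewrite -EFinM lee_fin; exact: gQ.
rewrite ge0_integralZl//; last first.
  by apply: measurable_funTS; apply/measurable_EFinP; exact: measurable_indic.
rewrite EFinM lee_wpmul2l// integral_indic// -lebesgue2_rect//.
by apply: le_measure; rewrite ?inE//; exact: measurableI.
Qed.

(** If K has integral 1, the K-average of h differs from h x by the K-average
    of h y - h x. *)
Lemma average_local_osc (h K : plane R -> R) (x : plane R) (M N c r : R) :
  0 < r -> 0 <= c ->
  measurable_fun setT h -> measurable_fun setT K ->
  (forall y, `|h y| <= M) -> (forall y, `|K y| <= N) ->
  (\int[mu2]_(y in om) (K y)%:E = 1)%E ->
  (forall y, om y -> `|K y| <= c * avg_kernel r (x, y)) ->
  (`|\int[mu2]_(y in om) (h y * K y) - h x|%:E <=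
   c%:E * local_osc L r h x)%E.
Proof.
move=> r0 c0 mh mK hM KN K1 Kc.
have iK : mu2.-integrable om (EFin \o K) by exact: integrable_om mK KN.
have ihK : mu2.-integrable om (EFin \o (fun y => h y * K y)).
  apply: (@integrable_om _ (M * N)); first exact: measurable_funM.
  by move=> y; rewrite normrM ler_pM.
have ihxK : mu2.-integrable om (EFin \o (fun y => h x * K y)).
  apply: (@integrable_om _ (M * N)); first exact: measurable_funM.
  by move=> y; rewrite normrM ler_pM.
have E : \int[mu2]_(y in om) (h y * K y) - h x =
    \int[mu2]_(y in om) (h y * K y - h x * K y).
  rewrite RintegralB// RintegralZl//; congr (_ - _).
  by rewrite /Rintegral K1 /= mulr1.
rewrite E EFin_normr_Rintegral//; last first.
  exact: (integrableB _ ihK ihxK).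
apply: le_trans (le_abse_integral _ _ _) _ => //.
  by apply: measurable_funTS; apply/measurable_EFinP; apply: measurable_funB;
    exact: measurable_funM.
rewrite -ge0_integralZl//; last 2 first.
- apply: measurable_funTS; apply/measurable_EFinP; apply: measurable_funM.
    exact: measurableT_comp (measurable_avg_kernel r) (pair1_measurable x).
  apply: measurableT_comp => //; exact: measurable_funB.
- by move=> y _; rewrite lee_fin mulr_ge0 ?avg_kernel_ge0.
apply: ge0_le_integral_dominated => y Dy; first exact: abse_ge0.
rewrite -EFinM lee_fin -mulrBl normrM mulrC mulrA ler_wpM2r//.
exact: Kc.
Qed.

End bounded_integrands.

(** * Smoothed averages of phi over rectangles *)

Section bump_means.
Context {R : realType}.
Local Notation mu2 := (@lebesgue2 R).
Variables (L : R) (phi d1 d2 : plane R -> R) (C Cs : R).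
Hypotheses (L0 : 0 < L) (C0 : 0 < C) (Cs1 : 1 <= Cs).
Hypothesis step_bump_Cs :
  forall t : R, `|smooth_step t| <= Cs /\ `|smooth_bump t| <= Cs.
Hypotheses (mphi : measurable_fun setT phi) (md1 : measurable_fun setT d1)
           (md2 : measurable_fun setT d2).
Hypotheses (phiC : forall x, `|phi x| <= C) (d1C : forall x, `|d1 x| <= C)
           (d2C : forall x, `|d2 x| <= C).
Hypotheses (W1 : weak_partial (omega L) e1 phi d1)
           (W2 : weak_partial (omega L) e2 phi d2).
Local Notation om := (omega L : set (plane R)).

Let mom : measurable om. Proof. exact: measurable_omega. Qed.
Let Cs0 : 0 < Cs. Proof. by rewrite (lt_le_trans _ Cs1). Qed.

(** The average of phi on [s, s + h] * [t, t + k] against a product of bumps.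
    The two side lengths are independent so that a rectangle can be moved or
    resized in one direction at a time. *)
Definition mean (s t h k : R) : R :=
  \int[mu2]_(y in om) (phi y * (bump_at s h y.1 * bump_at t k y.2)).

Let bump_le s h t : 0 < h -> `|bump_at s h t| <= Cs / h.
Proof. by move=> h0; apply: bump_at_bound => // u; exact: (step_bump_Cs u).2. Qed.

Let step_le s h t : `|step_at s h t| <= Cs.
Proof. by apply: step_at_bound => u; exact: (step_bump_Cs u).1. Qed.

Lemma step_atB_bound s h s' h' t : `|step_at s h t - step_at s' h' t| <= 2 * Cs.
Proof.
apply: le_trans (ler_normB _ _) _.
by rewrite mulr_natl mulr2n lerD.
Qed.

Let cbump s h : continuous (@bump_at R s h).
Proof. exact: Cn1_continuous (Cn1_bump_at s h 0). Qed.

Let cstep s h s' h' : continuous (fun t : R => step_at s h t - step_at s' h' t).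
Proof.
by move=> x; apply: cvgB; exact: Cn1_continuous (Cn1_step_at _ _ 0) _.
Qed.

Let Cn1_stepB s h s' h' n : Cn1 n (fun t : R => step_at s h t - step_at s' h' t).
Proof. by apply: Cn1D; [|apply: Cn1N]; exact: Cn1_step_at. Qed.

Let is_derive_stepB s h s' h' (t : R) :
  is_derive t 1 (fun t : R => step_at s h t - step_at s' h' t)
    (bump_at s h t - bump_at s' h' t).
Proof. by apply: is_deriveB; exact: is_derive_step_at. Qed.

Let min_lt (a b c : R) : c < Num.min a b -> c < a /\ c < b.
Proof. by rewrite lt_min => /andP. Qed.

Let max_lt (a b c : R) : Num.max a b < c -> a < c /\ b < c.
Proof. by rewrite gt_max => /andP. Qed.

Let step_out (s h s' h' t : R) : 0 < h -> 0 < h' ->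
  t < Num.min (s + h / 4) (s' + h' / 4) \/
  Num.max (s + 3 / 4 * h) (s' + 3 / 4 * h') < t ->
  step_at s h t - step_at s' h' t = 0.
Proof.
move=> h0 h0' [/min_lt[H1 H2]|/max_lt[H1 H2]].
  by rewrite !step_at_left ?subrr.
by rewrite !step_at_right ?subrr.
Qed.

Let sub_om (s h t k t' k' : R) : 0 < h -> 0 < k -> 0 < k' ->
  0 <= s -> s + h <= L -> 0 <= t -> t + k <= L -> 0 <= t' -> t' + k' <= L ->
  forall u v : R, s + h / 4 <= u <= s + 3 / 4 * h ->
   Num.min (t + k / 4) (t' + k' / 4) <= v <= Num.max (t + 3 / 4 * k) (t' + 3 / 4 * k') ->
   [/\ 0 < u, u < L, 0 < v & v < L].
Proof.
move=> h0 k0 k0' s0 sL t0 tL t0' tL' u v /andP[u1 u2] /andP[v1 v2].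
have : 0 < Num.min (t + k / 4) (t' + k' / 4) by rewrite lt_min; apply/andP; split; lra.
have : Num.max (t + 3 / 4 * k) (t' + 3 / 4 * k') < L by rewrite gt_max; apply/andP; split; lra.
by move=> ? ?; split; lra.
Qed.

Lemma Rintegral_weak_partial (v : R * R) (f g psi : R * R -> R) :
  weak_partial (omega L) v f g -> test_function (omega L) psi ->
  \int[mu2]_(y in om) (f y * 'D_v psi y) = - \int[mu2]_(y in om) (g y * psi y).
Proof. by move=> H /H E; rewrite /Rintegral E fineN. Qed.

Let iphi (a b : R -> R) M N : continuous a -> continuous b ->
  (forall t, `|a t| <= M) -> (forall t, `|b t| <= N) ->
  mu2.-integrable om (EFin \o (fun y => phi y * (a y.1 * b y.2))).
Proof.
move=> ca cb aM bN; apply: (@integrable_om _ _ L0 _ (C * (M * N))).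
  by apply: measurable_funM => //; exact: measurable_prod.
by move=> y; rewrite !normrM ler_pM ?mulr_ge0// ler_pM.
Qed.

(** Moving the rectangle in direction 2 changes the second bump by the derivative
    of a difference of steps, and this difference has compact support.  Tested
    against the weak derivative, the change of the average becomes an integral of
    d2. *)
Lemma meanB2 s t t' h k k' : 0 < h -> 0 < k -> 0 < k' ->
  0 <= s -> s + h <= L -> 0 <= t -> t + k <= L -> 0 <= t' -> t' + k' <= L ->
  mean s t h k - mean s t' h k' =
  \int[mu2]_(y in om)
    (d2 y * (bump_at s h y.1 * (step_at t' k' y.2 - step_at t k y.2))).
Proof.
move=> h0 k0 k0' s0 sL t0 tL t0' tL'.
pose psi (y : R * R) : R := bump_at s h y.1 * (step_at t' k' y.2 - step_at t k y.2).
have tpsi : test_function (omega L) psi.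
  apply: (@test_function_prod _ _ (bump_at s h)
    (fun u => step_at t' k' u - step_at t k u) (s + h / 4) (s + 3 / 4 * h)
    (Num.min (t' + k' / 4) (t + k / 4)) (Num.max (t' + 3 / 4 * k') (t + 3 / 4 * k))).
  - by move=> n; exact: Cn1_bump_at.
  - by move=> n; exact: Cn1_stepB.
  - by move=> u; exact: bump_at_out.
  - by move=> u; exact: step_out.
  - move=> [u v] [/=]; rewrite !in_itv/= => Hu Hv.
    have [u0 uL v0 vL] := sub_om h0 k0' k0 s0 sL t0' tL' t0 tL Hu Hv.
    by rewrite /omega; split; rewrite /= in_itv/=; apply/andP.
have dpsi y : 'D_e2 psi y =
    bump_at s h y.1 * (bump_at t' k' y.2 - bump_at t k y.2).
  exact: (is_derive_prod2 (bump_at s h) y (is_derive_stepB t' k' t k)).2.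
rewrite -[RHS]opprK -(Rintegral_weak_partial W2 tpsi) /mean -RintegralB//; last 2 first.
- by apply: (@iphi _ _ (Cs / h) (Cs / k)) => // u; exact: bump_le.
- by apply: (@iphi _ _ (Cs / h) (Cs / k')) => // u; exact: bump_le.
rewrite -mulN1r -RintegralZl//.
  by apply: eq_Rintegral => y _; rewrite dpsi -!mulrBr mulN1r -!mulrN opprB.
rewrite (_ : (fun y => phi y * 'D_e2 psi y) = (fun y => phi y * (bump_at s h y.1 *
   (bump_at t' k' y.2 - bump_at t k y.2)))); last first.
  by apply/funext => y; rewrite dpsi.
apply: (@iphi (bump_at s h) (fun u => bump_at t' k' u - bump_at t k u)
  (Cs / h) (Cs / k' + Cs / k)) => //.
- by move=> u; apply: cvgB; exact: cbump.
- by move=> u; exact: bump_le.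
- by move=> u; apply: le_trans (ler_normB _ _) _; apply: lerD; exact: bump_le.
Qed.

Lemma meanB1 s s' t h h' k : 0 < h -> 0 < h' -> 0 < k ->
  0 <= s -> s + h <= L -> 0 <= s' -> s' + h' <= L -> 0 <= t -> t + k <= L ->
  mean s t h k - mean s' t h' k =
  \int[mu2]_(y in om)
    (d1 y * ((step_at s' h' y.1 - step_at s h y.1) * bump_at t k y.2)).
Proof.
move=> h0 h0' k0 s0 sL s0' sL' t0 tL.
pose psi (y : R * R) : R := (step_at s' h' y.1 - step_at s h y.1) * bump_at t k y.2.
have tpsi : test_function (omega L) psi.
  apply: (@test_function_prod _ _ (fun u => step_at s' h' u - step_at s h u)
    (bump_at t k) (Num.min (s' + h' / 4) (s + h / 4))
    (Num.max (s' + 3 / 4 * h') (s + 3 / 4 * h)) (t + k / 4) (t + 3 / 4 * k)).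
  - by move=> n; exact: Cn1_stepB.
  - by move=> n; exact: Cn1_bump_at.
  - by move=> u; exact: step_out.
  - by move=> u; exact: bump_at_out.
  - move=> [u v] [/=]; rewrite !in_itv/= => Hu Hv.
    have [v0 vL u0 uL] := sub_om k0 h0' h0 t0 tL s0' sL' s0 sL Hv Hu.
    by rewrite /omega; split; rewrite /= in_itv/=; apply/andP.
have dpsi y : 'D_e1 psi y =
    (bump_at s' h' y.1 - bump_at s h y.1) * bump_at t k y.2.
  exact: (is_derive_prod1 (bump_at t k) y (is_derive_stepB s' h' s h)).2.
rewrite -[RHS]opprK -(Rintegral_weak_partial W1 tpsi) /mean -RintegralB//; last 2 first.
- by apply: (@iphi _ _ (Cs / h) (Cs / k)) => // u; exact: bump_le.
- by apply: (@iphi _ _ (Cs / h') (Cs / k)) => // u; exact: bump_le.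
rewrite -mulN1r -RintegralZl//.
  by apply: eq_Rintegral => y _; rewrite dpsi -mulrBr -mulrBl mulN1r -mulrN -mulNr opprB.
rewrite (_ : (fun y => phi y * 'D_e1 psi y) = (fun y => phi y *
   ((bump_at s' h' y.1 - bump_at s h y.1) * bump_at t k y.2))); last first.
  by apply/funext => y; rewrite dpsi.
apply: (@iphi (fun u => bump_at s' h' u - bump_at s h u) (bump_at t k)
  (Cs / h' + Cs / h) (Cs / k)) => //.
- by move=> u; apply: cvgB; exact: cbump.
- by move=> u; apply: le_trans (ler_normB _ _) _; apply: lerD; exact: bump_le.
- by move=> u; exact: bump_le.
Qed.

Let itv_out (a b x : R) : ~ `]a, b[%classic x -> x <= a \/ b <= x.
Proof.
rewrite /= in_itv/= => /negP; rewrite negb_and -!leNgt => /orP[]; by [left|right].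
Qed.

(** The kernel of [meanB2] is bounded by 2 Cs^2 / h on a rectangle of area
    h (b - a) and vanishes elsewhere. *)
Lemma mean_lip2 s t t' h k k' a b : 0 < h -> 0 < k -> 0 < k' ->
  0 <= s -> s + h <= L -> 0 <= t -> t + k <= L -> 0 <= t' -> t' + k' <= L ->
  a <= t -> t + k <= b -> a <= t' -> t' + k' <= b ->
  `|mean s t h k - mean s t' h k'| <= 2 * C * Cs ^+ 2 * (b - a).
Proof.
move=> h0 k0 k0' s0 sL t0 tL t0' tL' at_ tb at' tb'.
rewrite meanB2//.
have -> : 2 * C * Cs ^+ 2 * (b - a) =
    (C * (Cs / h * (2 * Cs))) * ((s + h - s) * (b - a)).
  by field; rewrite gt_eqF.
apply: integral_rect_bound => //.
- lra.
- lra.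
- by rewrite !mulr_ge0 ?invr_ge0 ?ltW.
- apply: measurable_funM => //.
  exact: (measurable_prod (@cbump _ _) (@cstep _ _ _ _)).
- move=> y _; rewrite !normrM ler_pM ?mulr_ge0// ler_pM//; first exact: bump_le.
  exact: step_atB_bound.
- move=> [u v] _ uv; have [uI|/itv_out uI] := pselect (`]s, (s + h)[%classic u).
    have /itv_out vI : ~ `]a, b[%classic v by move=> vI; apply: uv; split.
    rewrite /= step_out ?mulr0//; case: vI => vI; [left|right].
      by rewrite lt_min; apply/andP; split; lra.
    by rewrite gt_max; apply/andP; split; lra.
  by rewrite /= bump_at_out ?mul0r ?mulr0//; case: uI => uI; [left|right]; lra.
Qed.

Lemma mean_lip1 s s' t h h' k a b : 0 < h -> 0 < h' -> 0 < k ->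
  0 <= s -> s + h <= L -> 0 <= s' -> s' + h' <= L -> 0 <= t -> t + k <= L ->
  a <= s -> s + h <= b -> a <= s' -> s' + h' <= b ->
  `|mean s t h k - mean s' t h' k| <= 2 * C * Cs ^+ 2 * (b - a).
Proof.
move=> h0 h0' k0 s0 sL s0' sL' t0 tL as_ sb as' sb'.
rewrite meanB1//.
have -> : 2 * C * Cs ^+ 2 * (b - a) =
    (C * ((2 * Cs) * (Cs / k))) * ((b - a) * (t + k - t)).
  by field; rewrite gt_eqF.
apply: integral_rect_bound => //.
- lra.
- lra.
- by rewrite !mulr_ge0 ?invr_ge0 ?ltW.
- apply: measurable_funM => //.
  exact: (measurable_prod (@cstep _ _ _ _) (@cbump _ _)).
- move=> y _; rewrite !normrM ler_pM ?mulr_ge0// ler_pM//; last exact: bump_le.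
  exact: step_atB_bound.
- move=> [u v] _ uv; have [vI|/itv_out vI] := pselect (`]t, (t + k)[%classic v).
    have /itv_out uI : ~ `]a, b[%classic u by move=> uI; apply: uv; split.
    rewrite /= step_out ?mul0r ?mulr0//; case: uI => uI; [left|right].
      by rewrite lt_min; apply/andP; split; lra.
    by rewrite gt_max; apply/andP; split; lra.
  by rewrite /= bump_at_out ?mulr0//; case: vI => vI; [left|right]; lra.
Qed.

Let avg_kernel_in (c eps N : R) (a b : R -> R) (x : plane R) (p q p' q' : R) :
  0 < eps -> 0 <= c -> x.1 - 3 * eps <= p -> q <= x.1 + 3 * eps ->
  x.2 - 3 * eps <= p' -> q' <= x.2 + 3 * eps ->
  (forall t, t <= p \/ q <= t -> a t = 0) ->
  (forall t, t <= p' \/ q' <= t -> b t = 0) ->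
  (forall u v, `|a u * b v| <= N) -> N = c / (3 * eps) ^+ 2 ->
  forall y, om y -> `|a y.1 * b y.2| <= c * avg_kernel (3 * eps) (x, y).
Proof.
move=> eps0 c0 H1 H2 H3 H4 a0 b0 abN NE y _; rewrite {}NE in abN.
have K0 := avg_kernel_ge0 (3 * eps) (x, y).
have [y1|/itv_out y1] := pselect (`]p, q[%classic y.1); last first.
  by rewrite a0// mul0r normr0 mulr_ge0.
have [y2|/itv_out y2] := pselect (`]p', q'[%classic y.2); last first.
  by rewrite b0// mulr0 normr0 mulr_ge0.
apply: le_trans (abN _ _) _; rewrite /avg_kernel indicE mem_set ?mulr1//.
move: y1 y2; rewrite /= !in_itv/= => /andP[? ?] /andP[? ?].
by split; rewrite /= ltr_norml; apply/andP; split; lra.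
Qed.

(** The product of bumps has integral 1, and it is dominated by the averaging
    kernel of radius 3 eps as its support stays at that distance from x. *)
Lemma mean_near s t eps (x : plane R) : 0 < eps ->
  0 <= s -> s + eps <= L -> 0 <= t -> t + eps <= L ->
  x.1 - 3 * eps <= s -> s + eps <= x.1 + 3 * eps ->
  x.2 - 3 * eps <= t -> t + eps <= x.2 + 3 * eps ->
  (`|mean s t eps eps - phi x|%:E <=
   (18 * Cs ^+ 2)%:E * local_osc L (3 * eps) phi x)%E.
Proof.
move=> eps0 s0 sL t0 tL H1 H2 H3 H4.
have bb u v : `|bump_at s eps u * bump_at t eps v| <= Cs / eps * (Cs / eps).
  by rewrite normrM ler_pM ?bump_le.
apply: (@average_local_osc _ _ L0 _
    (fun y => bump_at s eps y.1 * bump_at t eps y.2) _ C (Cs / eps * (Cs / eps))) => //.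
- by rewrite mulr_gt0.
- by rewrite mulr_ge0// sqr_ge0.
- exact: measurable_prod.
- rewrite (@integral_prod _ _ L0 _ _ 1 1 (Cs / eps)) ?mulr1//.
  + by move=> u; exact: bump_le.
  + by move=> u; exact: bump_le.
  + exact: integral_bump_at.
  + exact: integral_bump_at.
- apply: (avg_kernel_in eps0 _ H1 H2 H3 H4
    (N := 18 * Cs ^+ 2 / (3 * eps) ^+ 2)) => //.
  + by rewrite mulr_ge0// sqr_ge0.
  + by move=> u uu; apply: bump_at_out; lra.
  + by move=> u uu; apply: bump_at_out; lra.
  + move=> u v; apply: le_trans (bb u v) _.
    have -> : Cs / eps * (Cs / eps) = 9 * Cs ^+ 2 / (3 * eps) ^+ 2.
      by field; rewrite gt_eqF.
    rewrite ler_wpM2r ?invr_ge0 ?sqr_ge0// ler_wpM2r ?sqr_ge0//; lra.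
Qed.

(** By [meanB2] the difference quotient is an average of d2 against a kernel of
    integral 1, since two steps shifted by eps enclose the area eps. *)
Lemma mean_quotient2 s t eps (x : plane R) : 0 < eps ->
  0 <= s -> s + eps <= L -> 0 <= t - eps -> t + eps <= L ->
  x.1 - 3 * eps <= s -> s + eps <= x.1 + 3 * eps ->
  x.2 - 3 * eps <= t - eps -> t + eps <= x.2 + 3 * eps ->
  (`|(mean s t eps eps - mean s (t - eps) eps eps) / eps - d2 x|%:E <=
   (18 * Cs ^+ 2)%:E * local_osc L (3 * eps) d2 x)%E.
Proof.
move=> eps0 s0 sL t0 tL H1 H2 H3 H4.
have epsn0 : eps != 0 by rewrite gt_eqF.
pose a u := bump_at s eps u.
pose b u := eps^-1 * (step_at (t - eps) eps u - step_at t eps u).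
have cb : continuous b.
  by move=> u; apply: cvgM; [exact: cvg_cst|exact: cstep].
have aB u : `|a u| <= Cs / eps by exact: bump_le.
have bB u : `|b u| <= 2 * Cs / eps.
  rewrite normrM normfV (gtr0_norm eps0) mulrC ler_wpM2r ?invr_ge0 ?(ltW eps0)//.
  exact: step_atB_bound.
have bb u v : `|a u * b v| <= Cs / eps * (2 * Cs / eps) by rewrite normrM ler_pM.
have -> : (mean s t eps eps - mean s (t - eps) eps eps) / eps =
    \int[mu2]_(y in om) (d2 y * (a y.1 * b y.2)).
  rewrite meanB2//; [|lra|lra]; rewrite mulrC -RintegralZl//.
    by apply: eq_Rintegral => y _; rewrite /a /b mulrCA; congr (_ * _); rewrite mulrCA.
  apply: (@integrable_om _ _ L0 _ (C * (Cs / eps * (2 * Cs)))).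
    by apply: measurable_funM => //; exact: (measurable_prod (@cbump _ _) (@cstep _ _ _ _)).
  move=> y; rewrite !normrM ler_pM ?mulr_ge0// ler_pM//.
  exact: step_atB_bound.
apply: (@average_local_osc _ _ L0 _
    (fun y => a y.1 * b y.2) _ C (Cs / eps * (2 * Cs / eps))) => //.
- by rewrite mulr_gt0.
- by rewrite mulr_ge0// sqr_ge0.
- by apply: measurable_prod => //; exact: cbump.
- rewrite (@integral_prod _ _ L0 a b 1 1 (2 * Cs / eps)) ?mulr1//.
  + exact: cbump.
  + move=> u; apply: le_trans (aB u) _; rewrite ler_wpM2r ?invr_ge0 ?(ltW eps0)//.
    by have := Cs0; lra.
  + exact: integral_bump_at.
  + have I1 := @integral_step_atB _ 0 L (t - eps) t eps eps0 t0.
    under eq_integral do rewrite EFinM.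
    rewrite integralZl//=; last first.
      apply: (@integrable_bounded_itv _ _ _
        (fun u => step_at (t - eps) eps u - step_at t eps u) (2 * Cs)).
        exact: continuous_measurable_fun.
      by move=> u _; exact: step_atB_bound.
    rewrite I1 ?subKr; [|lra|lra|lra].
    by rewrite -EFinM mulVf.
- apply: (avg_kernel_in eps0 _ H1 H2 H3 H4
    (N := 18 * Cs ^+ 2 / (3 * eps) ^+ 2)) => //.
  + by rewrite mulr_ge0// sqr_ge0.
  + by move=> u uu; apply: bump_at_out; lra.
  + move=> u uu; rewrite /b step_out ?mulr0//; case: uu => uu; [left|right].
      by rewrite lt_min; apply/andP; split; lra.
    by rewrite gt_max; apply/andP; split; lra.
  + move=> u v; apply: le_trans (bb u v) _.
    have -> : Cs / eps * (2 * Cs / eps) = 18 * Cs ^+ 2 / (3 * eps) ^+ 2 by field.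
    by [].
Qed.

Lemma mean_quotient1 s t eps (x : plane R) : 0 < eps ->
  0 <= s - eps -> s + eps <= L -> 0 <= t -> t + eps <= L ->
  x.1 - 3 * eps <= s - eps -> s + eps <= x.1 + 3 * eps ->
  x.2 - 3 * eps <= t -> t + eps <= x.2 + 3 * eps ->
  (`|(mean s t eps eps - mean (s - eps) t eps eps) / eps - d1 x|%:E <=
   (18 * Cs ^+ 2)%:E * local_osc L (3 * eps) d1 x)%E.
Proof.
move=> eps0 s0 sL t0 tL H1 H2 H3 H4.
have epsn0 : eps != 0 by rewrite gt_eqF.
pose b u := bump_at t eps u.
pose a u := eps^-1 * (step_at (s - eps) eps u - step_at s eps u).
have ca : continuous a.
  by move=> u; apply: cvgM; [exact: cvg_cst|exact: cstep].
have bB u : `|b u| <= Cs / eps by exact: bump_le.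
have aB u : `|a u| <= 2 * Cs / eps.
  rewrite normrM normfV (gtr0_norm eps0) mulrC ler_wpM2r ?invr_ge0 ?(ltW eps0)//.
  exact: step_atB_bound.
have bb u v : `|a u * b v| <= 2 * Cs / eps * (Cs / eps) by rewrite normrM ler_pM.
have -> : (mean s t eps eps - mean (s - eps) t eps eps) / eps =
    \int[mu2]_(y in om) (d1 y * (a y.1 * b y.2)).
  rewrite meanB1//; [|lra|lra]; rewrite mulrC -RintegralZl//.
    by apply: eq_Rintegral => y _; rewrite /a /b mulrCA; congr (_ * _); rewrite mulrA.
  apply: (@integrable_om _ _ L0 _ (C * (2 * Cs * (Cs / eps)))).
    by apply: measurable_funM => //; exact: (measurable_prod (@cstep _ _ _ _) (@cbump _ _)).
  move=> y; rewrite !normrM ler_pM ?mulr_ge0// ler_pM//.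
  exact: step_atB_bound.
apply: (@average_local_osc _ _ L0 _
    (fun y => a y.1 * b y.2) _ C (2 * Cs / eps * (Cs / eps))) => //.
- by rewrite mulr_gt0.
- by rewrite mulr_ge0// sqr_ge0.
- by apply: measurable_prod => //; exact: cbump.
- rewrite (@integral_prod _ _ L0 a b 1 1 (2 * Cs / eps)) ?mulr1//.
  + exact: cbump.
  + move=> u; apply: le_trans (bB u) _; rewrite ler_wpM2r ?invr_ge0 ?(ltW eps0)//.
    by have := Cs0; lra.
  + have I1 := @integral_step_atB _ 0 L (s - eps) s eps eps0 s0.
    under eq_integral do rewrite EFinM.
    rewrite integralZl//=; last first.
      apply: (@integrable_bounded_itv _ _ _
        (fun u => step_at (s - eps) eps u - step_at s eps u) (2 * Cs)).
        exact: continuous_measurable_fun.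
      by move=> u _; exact: step_atB_bound.
    rewrite I1 ?subKr; [|lra|lra|lra].
    by rewrite -EFinM mulVf.
  + exact: integral_bump_at.
- apply: (avg_kernel_in eps0 _ H1 H2 H3 H4
    (N := 18 * Cs ^+ 2 / (3 * eps) ^+ 2)) => //.
  + by rewrite mulr_ge0// sqr_ge0.
  + move=> u uu; rewrite /a step_out ?mulr0//; case: uu => uu; [left|right].
      by rewrite lt_min; apply/andP; split; lra.
    by rewrite gt_max; apply/andP; split; lra.
  + by move=> u uu; apply: bump_at_out; lra.
  + move=> u v; apply: le_trans (bb u v) _.
    have -> : 2 * Cs / eps * (Cs / eps) = 18 * Cs ^+ 2 / (3 * eps) ^+ 2 by field.
    by [].
Qed.

End bump_means.

(** * Averages next to gamma *)

Section traces.
Context {R : realType}.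
Local Notation mu2 := (@lebesgue2 R).
Variables (L : R) (phi d1 d2 : plane R -> R) (C Cs : R).
Hypotheses (L0 : 0 < L) (C0 : 0 < C) (Cs1 : 1 <= Cs).
Hypothesis step_bump_Cs :
  forall t : R, `|smooth_step t| <= Cs /\ `|smooth_bump t| <= Cs.
Hypotheses (mphi : measurable_fun setT phi) (md1 : measurable_fun setT d1)
           (md2 : measurable_fun setT d2).
Hypotheses (phiC : forall x, `|phi x| <= C) (d1C : forall x, `|d1 x| <= C)
           (d2C : forall x, `|d2 x| <= C).
Hypotheses (W1 : weak_partial (omega L) e1 phi d1)
           (W2 : weak_partial (omega L) e2 phi d2).
Local Notation om := (omega L : set (plane R)).

Let mom : measurable om. Proof. exact: measurable_omega. Qed.
Let Cs0 : 0 < Cs. Proof. by rewrite (lt_le_trans _ Cs1). Qed.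

Let bump_le s h t : 0 < h -> `|bump_at s h t| <= Cs / h.
Proof. by move=> h0; apply: bump_at_bound => // u; exact: (step_bump_Cs u).2. Qed.

Let cbump s h : continuous (@bump_at R s h).
Proof. exact: Cn1_continuous (Cn1_bump_at s h 0). Qed.

Let imean s t h : 0 < h -> mu2.-integrable om
  (EFin \o (fun y => phi y * (bump_at s h y.1 * bump_at t h y.2))).
Proof.
move=> h0; apply: (@integrable_om _ _ L0 _ (C * (Cs / h * (Cs / h)))).
  by apply: measurable_funM => //; exact: (measurable_prod (@cbump _ _) (@cbump _ _)).
by move=> y; rewrite !normrM ler_pM ?mulr_ge0// ler_pM ?bump_le.
Qed.

Lemma mean_bound s t h : 0 < h -> `|mean L phi s t h h| <= C * Cs ^+ 2.
Proof.
move=> h0.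
have -> : C * Cs ^+ 2 = (C * (Cs / h * (Cs / h))) * ((s + h - s) * (t + h - t)).
  by field; rewrite gt_eqF.
apply: integral_rect_bound => //.
- by rewrite lerDl ltW.
- by rewrite lerDl ltW.
- by rewrite !mulr_ge0 ?invr_ge0 ?ltW.
- by apply: measurable_funM => //; exact: (measurable_prod (@cbump _ _) (@cbump _ _)).
- by move=> y _; rewrite !normrM ler_pM ?mulr_ge0// ler_pM ?bump_le.
- move=> [u v] _ uv.
  have [uI|uI] := boolP (s < u < s + h); last first.
    rewrite /= (@bump_at_out _ s) ?mul0r ?mulr0//.
    by move: uI; rewrite negb_and -!leNgt => /orP[]; [left|right]; lra.
  have [vI|vI] := boolP (t < v < t + h); last first.
    rewrite /= (@bump_at_out _ t) ?mulr0//.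
    by move: vI; rewrite negb_and -!leNgt => /orP[]; [left|right]; lra.
  by exfalso; apply: uv; split; rewrite /= in_itv.
Qed.

(** The kernel of the average is at most (Cs / r)^2 and its support lies in the
    ball, the intersection of which with omega enters the definition of a zero
    trace. *)
Lemma mean_le_ball_average s t r (x : R * R) : 0 < r ->
  x.1 - r <= s -> s <= x.1 -> x.2 - r <= t -> t <= x.2 ->
  (`|mean L phi s t r r|%:E <= (Cs ^+ 2)%:E *
    ((r ^- 2)%:E * \int[mu2]_(y in omega L `&` ball x r) `|phi y|%:E))%E.
Proof.
move=> r0 H1 H2 H3 H4.
have mball : measurable (ball x r : set (plane R)).
  by apply: open_measurable_plane; exact: ball_open.
have mphi' D : measurable_fun D (fun y : plane R => `|phi y|%:E).
  by apply: measurable_funTS; apply/measurable_EFinP; exact: measurableT_comp.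
rewrite EFin_normr_Rintegral//; last exact: imean.
apply: le_trans (le_abse_integral _ _ _) _ => //.
  exact: measurable_int (imean s t r0).
rewrite muleA -EFinM [X in (_ * X)%E]integral_mkcondr -ge0_integralZl//; last 3 first.
- have := (measurable_restrict (fun y : plane R => `|phi y|%:E) mball mom).1.
  by apply.
- by move=> y _; apply: erestrict_ge0 => z _; rewrite lee_fin.
- by rewrite lee_fin mulr_ge0 ?invr_ge0 ?sqr_ge0.
apply: ge0_le_integral_dominated => y Dy; first exact: abse_ge0.
rewrite /patch; case: ifPn => [_|].
  rewrite -EFinM lee_fin normrM mulrC ler_wpM2r// normrM.
  have -> : Cs ^+ 2 * r ^- 2 = Cs / r * (Cs / r).
    by field; rewrite gt_eqF.
  by rewrite ler_pM ?bump_le.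
rewrite notin_setE => xy; rewrite mule0 lee_fin.
suff : bump_at s r y.1 * bump_at t r y.2 = 0 by move=> ->; rewrite mulr0 normr0.
have [uI|uI] := boolP (s < y.1 < s + r); last first.
  rewrite /= (@bump_at_out _ s) ?mul0r ?mulr0//.
  by move: uI; rewrite negb_and -!leNgt => /orP[]; [left|right]; lra.
have [vI|vI] := boolP (t < y.2 < t + r); last first.
  rewrite /= (@bump_at_out _ t) ?mulr0//.
  by move: vI; rewrite negb_and -!leNgt => /orP[]; [left|right]; lra.
exfalso; apply: xy; move: uI vI => /andP[? ?] /andP[? ?].
by split; rewrite /ball /= ltr_norml; apply/andP; split; lra.
Qed.

Lemma zero_trace_small_radius (x : R * R) (b eta : R) :
  zero_trace_at (omega L) phi x -> 0 < b -> 0 < eta ->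
  exists r : R, [/\ 0 < r, r < b & forall s t : R,
    x.1 - r <= s -> s <= x.1 -> x.2 - r <= t -> t <= x.2 ->
    `|mean L phi s t r r| <= eta].
Proof.
move=> tr b0 eta0; have e1 : 0 < eta / Cs ^+ 2 by rewrite divr_gt0// exprn_gt0.
have N1 := cvge0_lt e1 tr.
have N2 : \forall r \near (0 : R)^'+, r < b by exact: nbhs_right_lt.
have N3 : \forall r \near (0 : R)^'+, 0 < r by exact: nbhs_right_gt.
have FF : ProperFilter ((0 : R)^'+) by apply: at_right_proper_filter.
have [r [[r1 r2] r3]] := @filter_ex _ _ FF _
  (@filterI _ _ FF _ _ (@filterI _ _ FF _ _ N1 N2) N3).
exists r; split => // s t H1 H2 H3 H4; rewrite -lee_fin.
apply: le_trans (mean_le_ball_average r3 H1 H2 H3 H4) _.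
have -> : eta%:E = ((Cs ^+ 2)%:E * (eta / Cs ^+ 2)%:E)%E.
  by rewrite -EFinM; congr (_%:E); field; rewrite gt_eqF.
by rewrite lee_wpmul2l ?lee_fin ?sqr_ge0//; exact: ltW r1.
Qed.

(** A zero trace makes the averages at tau vanish as their size r tends to 0.
    From the cell of size eps one reaches such an average in two moves of
    Lipschitz cost: to height r around tau, then to width r. *)
Lemma mean_trace1 (t tau eps : R) : zero_trace_at (omega L) phi (0, tau) ->
  0 < tau -> tau < L -> 0 < eps -> eps <= L -> 0 <= t -> t + eps <= L ->
  t - eps <= tau -> tau <= t + eps ->
  `|mean L phi 0 t eps eps| <= 8 * C * Cs ^+ 2 * eps.
Proof.
move=> tr tau0 tauL eps0 epsL t0 tL H1 H2.
apply/ler_addgt0Pr => eta eta0.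
have b0 : 0 < Num.min eps (L - tau) by rewrite lt_min eps0 subr_gt0.
have [r [r0 + Hr]] := zero_trace_small_radius tr b0 eta0.
rewrite lt_min => /andP[re rL].
have M1 := Hr 0 tau; rewrite /= in M1.
have {}M1 : `|mean L phi 0 tau r r| <= eta by apply: M1; lra.
have M2 : `|mean L phi 0 t eps eps - mean L phi 0 tau eps r| <=
    2 * C * Cs ^+ 2 * (t + 2 * eps - (t - eps)).
  by apply: (mean_lip2 L0 C0 Cs1 step_bump_Cs mphi md2 phiC d2C W2) => //; lra.
have M3 : `|mean L phi 0 tau eps r - mean L phi 0 tau r r| <=
    2 * C * Cs ^+ 2 * (eps - 0).
  by apply: (mean_lip1 L0 C0 Cs1 step_bump_Cs mphi md1 phiC d1C W1) => //; lra.
have -> : mean L phi 0 t eps eps =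
  (mean L phi 0 t eps eps - mean L phi 0 tau eps r) +
  (mean L phi 0 tau eps r - mean L phi 0 tau r r) + mean L phi 0 tau r r by ring.
apply: le_trans (ler_normD _ _) _; apply: lerD => //.
apply: le_trans (ler_normD _ _) _.
apply: le_trans (lerD M2 M3) _; lra.
Qed.

Lemma mean_trace2 (s tau eps : R) : zero_trace_at (omega L) phi (tau, 0) ->
  0 < tau -> tau < L -> 0 < eps -> eps <= L -> 0 <= s -> s + eps <= L ->
  s - eps <= tau -> tau <= s + eps ->
  `|mean L phi s 0 eps eps| <= 8 * C * Cs ^+ 2 * eps.
Proof.
move=> tr tau0 tauL eps0 epsL s0 sL H1 H2.
apply/ler_addgt0Pr => eta eta0.
have b0 : 0 < Num.min eps (L - tau) by rewrite lt_min eps0 subr_gt0.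
have [r [r0 + Hr]] := zero_trace_small_radius tr b0 eta0.
rewrite lt_min => /andP[re rL].
have M1 := Hr tau 0; rewrite /= in M1.
have {}M1 : `|mean L phi tau 0 r r| <= eta by apply: M1; lra.
have M2 : `|mean L phi s 0 eps eps - mean L phi tau 0 r eps| <=
    2 * C * Cs ^+ 2 * (s + 2 * eps - (s - eps)).
  by apply: (mean_lip1 L0 C0 Cs1 step_bump_Cs mphi md1 phiC d1C W1) => //; lra.
have M3 : `|mean L phi tau 0 r eps - mean L phi tau 0 r r| <=
    2 * C * Cs ^+ 2 * (eps - 0).
  by apply: (mean_lip2 L0 C0 Cs1 step_bump_Cs mphi md2 phiC d2C W2) => //; lra.
have -> : mean L phi s 0 eps eps =
  (mean L phi s 0 eps eps - mean L phi tau 0 r eps) +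
  (mean L phi tau 0 r eps - mean L phi tau 0 r r) + mean L phi tau 0 r r by ring.
apply: le_trans (ler_normD _ _) _; apply: lerD => //.
apply: le_trans (ler_normD _ _) _.
apply: le_trans (lerD M2 M3) _; lra.
Qed.

End traces.

(** * The cell values *)

Section coefficients.
Context {R : realType}.

(** The indices -1, ..., N of the family are shifted by one so as to be natural
    numbers; the outer rows -1 and N repeat the nearest row of cells, since the
    corresponding cells do not meet omega. *)
Definition cell_of (N k : nat) : nat := minn k.-1 N.-1.

(** Cells whose closure meets the closure of gamma.  Equality with l is included:
    the joint centred at l overlaps gamma on a length delta / 2, and the
    interpolation mixes there the values of the cells on both sides of l. *)
Definition edge_cell (l eps : R) (p q : nat) : bool :=
  ((p == 0%N) && (q%:R * eps <= l)) || ((q == 0%N) && (p%:R * eps <= l)).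

Definition cell_value (L l : R) (phi : plane R -> R) (eps : R) (p q : nat) : R :=
  if edge_cell l eps p q then 0
  else mean L phi (p%:R * eps) (q%:R * eps) eps eps.

Definition coef (L l : R) (phi : plane R -> R) (eps : R) (N k m : nat) : R :=
  cell_value L l phi eps (cell_of N k) (cell_of N m).

Lemma ae_in_itv (P : R -> Prop) (a b : R) : a < b ->
  {ae @lebesgue_measure R, forall t, P t} -> exists2 t : R, a < t < b & P t.
Proof.
move=> ab [A [mA A0 PA]]; apply/not_exists2P => H.
have abA : (`]a, b[%classic : set R) `<=` A.
  move=> t /=; rewrite in_itv/= => tab; apply: PA => Pt.
  by have [] := H t.
have : (lebesgue_measure (`]a, b[%classic : set R) <= lebesgue_measure A)%E.
  by apply: le_measure; rewrite ?inE//; exact: measurable_itv.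
rewrite [leRHS]A0 lebesgue_measure_itv/= lte_fin ab -EFinD lee_fin.
by rewrite leNgt subr_gt0 ab.
Qed.

Local Notation mu2 := (@lebesgue2 R).
Variables (L l : R) (phi d1 d2 : plane R -> R) (C Cs : R).
Hypotheses (l0 : 0 < l) (lL : l < L) (C0 : 0 < C) (Cs1 : 1 <= Cs).
Hypothesis step_bump_Cs :
  forall t : R, `|smooth_step t| <= Cs /\ `|smooth_bump t| <= Cs.
Hypotheses (mphi : measurable_fun setT phi) (md1 : measurable_fun setT d1)
           (md2 : measurable_fun setT d2).
Hypotheses (phiC : forall x, `|phi x| <= C) (d1C : forall x, `|d1 x| <= C)
           (d2C : forall x, `|d2 x| <= C).
Hypotheses (W1 : weak_partial (omega L) e1 phi d1)
           (W2 : weak_partial (omega L) e2 phi d2).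
Hypothesis tr : zero_on_gamma l (omega L) phi.
Local Notation om := (omega L : set (plane R)).

Variables (eps : R) (N nl : nat).
Hypotheses (eps0 : 0 < eps) (NE : N%:R * eps = L) (nlE : nl%:R * eps = l).

Let L0 : 0 < L. Proof. exact: lt_trans lL. Qed.
Let Cs0 : 0 < Cs. Proof. by rewrite (lt_le_trans _ Cs1). Qed.

Local Notation c := (coef L l phi eps N).
Local Notation cell := (cell_of N).

Let N0 : (0 < N)%N.
Proof. by rewrite lt0n; apply: contraTneq L0 => N0; rewrite -NE N0 mul0r ltxx. Qed.

Let nl0 : (0 < nl)%N.
Proof. by rewrite lt0n; apply: contraTneq l0 => n0; rewrite -nlE n0 mul0r ltxx. Qed.

Let nat_eps_le (p q : nat) : (p%:R * eps <= q%:R * eps) = (p <= q)%N.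
Proof. by rewrite ler_pM2r// ler_nat. Qed.

Let cell_lt k : (cell k < N)%N.
Proof. by rewrite /cell_of -[X in (_ < X)%N](prednK N0) ltnS geq_minr. Qed.

Let node_bounds (p : nat) : (p < N)%N -> 0 <= p%:R * eps /\ p%:R * eps + eps <= L.
Proof.
move=> pN; split; first by rewrite mulr_ge0// ltW.
by rewrite -NE -[X in _ + X]mul1r -mulrDl natr1 nat_eps_le.
Qed.

Let epsL : eps <= L.
Proof. by have [_] := node_bounds N0; rewrite mul0r add0r. Qed.

(* A zero trace is known for almost every point of gamma only, hence in every
   cell that touches it; when q eps = l the point is taken in the cell below. *)
Let trace_near (q : nat) : q%:R * eps <= l -> exists tau : R,
  [/\ 0 < tau, tau < L, q%:R * eps - eps <= tau, tau <= q%:R * eps + eps &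
      zero_trace_at (omega L) phi (0, tau) /\ zero_trace_at (omega L) phi (tau, 0)].
Proof.
move=> ql; have qp : q.-1%:R * eps < q.-1.+1%:R * eps by rewrite ltr_pM2r// ltr_nat.
have [tau /andP[t1 t2] Ht] := ae_in_itv qp tr.
have ql' : q.-1.+1%:R * eps <= l.
  move: ql; rewrite -nlE !nat_eps_le; case: q {qp t1 t2} => //.
have tau0 : 0 < tau by apply: le_lt_trans t1; rewrite mulr_ge0// ltW.
have taul : tau < l by apply: lt_le_trans ql'.
exists tau; split => //.
- exact: lt_trans lL.
- apply: ltW; apply: le_lt_trans t1; case: q {qp t2 ql ql' Ht} => [|q] /=.
    by rewrite !mul0r sub0r oppr_le0 ltW.
  by rewrite -natr1 mulrDl mul1r addrK.
- apply: ltW; apply: lt_le_trans t2 _; case: q {qp t1 ql ql' Ht} => [|q] /=.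
    by rewrite mul0r add0r mul1r.
  by rewrite lerDl ltW.
- by apply: Ht; rewrite tau0.
Qed.

Let edge_mean p q : (p < N)%N -> (q < N)%N -> edge_cell l eps p q ->
  `|mean L phi (p%:R * eps) (q%:R * eps) eps eps| <= 8 * C * Cs ^+ 2 * eps.
Proof.
move=> pN qN; have [p0 pL] := node_bounds pN; have [q0 qL] := node_bounds qN.
move=> /orP[/andP[/eqP -> ql]|/andP[/eqP -> pl]]; rewrite mul0r.
- have [tau [t0 tL t1 t2 [tr1 _]]] := trace_near ql.
  exact: (mean_trace1 L0 C0 Cs1 step_bump_Cs mphi md1 md2 phiC d1C d2C W1 W2 tr1).
- have [tau [t0 tL t1 t2 [_ tr1]]] := trace_near pl.
  exact: (mean_trace2 L0 C0 Cs1 step_bump_Cs mphi md1 md2 phiC d1C d2C W1 W2 tr1).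
Qed.

Let cell_value_mean p q : (p < N)%N -> (q < N)%N ->
  `|cell_value L l phi eps p q - mean L phi (p%:R * eps) (q%:R * eps) eps eps| <=
  8 * C * Cs ^+ 2 * eps.
Proof.
move=> pN qN; rewrite /cell_value; case: ifPn => [E|_].
  by rewrite sub0r normrN; exact: edge_mean.
by rewrite subrr normr0 !mulr_ge0 ?sqr_ge0// ltW.
Qed.

Lemma coef_edge k m : edge_cell l eps (cell k) (cell m) -> c k m = 0.
Proof. by rewrite /coef /cell_value => ->. Qed.

Lemma coef_bound k m : `|c k m| <= C * Cs ^+ 2.
Proof.
rewrite /coef /cell_value; case: ifP => _.
  by rewrite normr0 mulr_ge0 ?sqr_ge0// ltW.
exact: (mean_bound L0 C0 Cs1 step_bump_Cs mphi phiC).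
Qed.

Let cellS k : cell k.+1 = cell k \/ cell k.+1 = (cell k).+1.
Proof.
rewrite /cell_of; lia.
Qed.

(* Twice the cost of [edge_mean], plus that of a move by one cell. *)
Let lip_bound (x y u v D : R) : `|x - u| <= 8 * D -> `|y - v| <= 8 * D ->
  `|u - v| <= 4 * D -> `|x - y| <= 20 * D.
Proof.
move=> H1 H2 H3; have -> : x - y = (x - u) - (y - v) + (u - v) by ring.
apply: le_trans (ler_normD _ _) _; apply: le_trans (lerD (ler_normB _ _) (lexx _)) _.
lra.
Qed.

(** Setting the value of an edge cell to 0 moves it by an amount of order eps by
    [edge_mean], so that the difference quotients remain bounded up to gamma. *)
Lemma coef_lip2 k m : `|c k m.+1 - c k m| <= 20 * (C * Cs ^+ 2 * eps).
Proof.
have D0 : 0 <= 20 * (C * Cs ^+ 2 * eps) by rewrite !mulr_ge0 ?sqr_ge0// ltW.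
rewrite /coef; have [->|E] := cellS m; first by rewrite subrr normr0.
have H1 := cell_value_mean (cell_lt k) (cell_lt m.+1).
have H2 := cell_value_mean (cell_lt k) (cell_lt m).
apply: (lip_bound (u := mean L phi ((cell k)%:R * eps) ((cell m.+1)%:R * eps) eps eps)
  (v := mean L phi ((cell k)%:R * eps) ((cell m)%:R * eps) eps eps)).
- by move: H1; rewrite !mulrA.
- by move: H2; rewrite !mulrA.
- have [k1 k2] := node_bounds (cell_lt k).
  have [m1 m2] := node_bounds (cell_lt m).
  have [n1 n2] := node_bounds (cell_lt m.+1).
  have nE : (cell m.+1)%:R * eps = (cell m)%:R * eps + eps.
    by rewrite E -natr1 mulrDl mul1r.
  rewrite nE in n1 n2 *; set s := (cell k)%:R * eps in k1 k2 *.
  set t := (cell m)%:R * eps in m1 m2 n1 n2 *.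
  have -> : 4 * (C * Cs ^+ 2 * eps) = 2 * C * Cs ^+ 2 * (t + 2 * eps - t) by ring.
  have := eps0 => e0.
  by apply: (mean_lip2 L0 C0 Cs1 step_bump_Cs mphi md2 phiC d2C W2) => //; lra.
Qed.

Lemma coef_lip1 k m : `|c k.+1 m - c k m| <= 20 * (C * Cs ^+ 2 * eps).
Proof.
have D0 : 0 <= 20 * (C * Cs ^+ 2 * eps) by rewrite !mulr_ge0 ?sqr_ge0// ltW.
rewrite /coef; have [->|E] := cellS k; first by rewrite subrr normr0.
have H1 := cell_value_mean (cell_lt k.+1) (cell_lt m).
have H2 := cell_value_mean (cell_lt k) (cell_lt m).
apply: (lip_bound (u := mean L phi ((cell k.+1)%:R * eps) ((cell m)%:R * eps) eps eps)
  (v := mean L phi ((cell k)%:R * eps) ((cell m)%:R * eps) eps eps)).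
- by move: H1; rewrite !mulrA.
- by move: H2; rewrite !mulrA.
- have [k1 k2] := node_bounds (cell_lt k).
  have [m1 m2] := node_bounds (cell_lt m).
  have [n1 n2] := node_bounds (cell_lt k.+1).
  have nE : (cell k.+1)%:R * eps = (cell k)%:R * eps + eps.
    by rewrite E -natr1 mulrDl mul1r.
  rewrite nE in n1 n2 *; set s := (cell k)%:R * eps in k1 k2 n1 n2 *.
  set t := (cell m)%:R * eps in m1 m2 *.
  have -> : 4 * (C * Cs ^+ 2 * eps) = 2 * C * Cs ^+ 2 * (s + 2 * eps - s) by ring.
  have := eps0 => e0.
  by apply: (mean_lip1 L0 C0 Cs1 step_bump_Cs mphi md1 phiC d1C W1) => //; lra.
Qed.

(** One constant for all the estimates below: the difference quotients account
    for the first term, the averaging kernels for the second one, and phi, d1 and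
    d2 themselves for the last one. *)
Definition coef_const : R := 40 * (C * Cs ^+ 2) + 18 * Cs ^+ 2 + C.

Let B := coef_const.

Let CC0 : 0 <= C * Cs ^+ 2. Proof. by rewrite mulr_ge0 ?sqr_ge0// ltW. Qed.

Lemma coef_const_gt0 : 0 < coef_const.
Proof.
rewrite /coef_const; have := CC0; have := C0; have := sqr_ge0 Cs; lra.
Qed.

Let B0 : 0 < B. Proof. exact: coef_const_gt0. Qed.

Let quotient_bound (u : R) : `|u| <= 20 * (C * Cs ^+ 2 * eps) ->
  `|u / eps| <= 20 * (C * Cs ^+ 2).
Proof.
move=> H; rewrite normrM normfV (gtr0_norm eps0) ler_pdivrMr//.
by rewrite -mulrA.
Qed.

Let bound_cst (u v : R) : `|u| <= 20 * (C * Cs ^+ 2) -> `|v| <= C -> `|u - v| <= B.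
Proof.
move=> H1 H2; apply: le_trans (ler_normB _ _) _; rewrite /B /coef_const.
have := CC0; have := sqr_ge0 Cs; lra.
Qed.

Lemma coef_dist k m x : `|c k m - phi x| <= B.
Proof.
apply: bound_cst => //; apply: le_trans (coef_bound k m) _.
have := CC0; lra.
Qed.

Lemma quotient2_dist k m x : `|(c k m.+1 - c k m) / eps - d2 x| <= B.
Proof. by apply: bound_cst => //; apply: quotient_bound; exact: coef_lip2. Qed.

Lemma quotient1_dist k m x : `|(c k.+1 m - c k m) / eps - d1 x| <= B.
Proof. by apply: bound_cst => //; apply: quotient_bound; exact: coef_lip1. Qed.

Section near_point.
Variables (x : plane R) (p q : nat).
Hypotheses (omx : om x) (pN : (p < N)%N) (qN : (q < N)%N).
Hypotheses (px : p%:R * eps <= x.1 < p.+1%:R * eps)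
           (qx : q%:R * eps <= x.2 < q.+1%:R * eps).

Local Notation bound h := (B%:E * local_osc L (3 * eps) h x +
  (B * \1_(low_edges eps) x)%:E)%E.

Let low_bound (u : R) (h : plane R -> R) : low_edges eps x ->
  `|u| <= B -> (`|u|%:E <= bound h)%E.
Proof.
move=> xl uB; rewrite indicE mem_set// mulr1.
apply: (@le_trans _ _ B%:E); first by rewrite lee_fin.
by rewrite leeDr// mule_ge0 ?local_osc_ge0// lee_fin ltW.
Qed.

Let high_bound (u : R) (h : plane R -> R) : ~ low_edges eps x ->
  (`|u|%:E <= (18 * Cs ^+ 2)%:E * local_osc L (3 * eps) h x)%E ->
  (`|u|%:E <= bound h)%E.
Proof.
move=> xl H; rewrite indicE memNset// mulr0 adde0; apply: le_trans H _.
rewrite lee_wpmul2r ?local_osc_ge0// lee_fin /B /coef_const.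
have := CC0; have := C0; lra.
Qed.

Let high (xl : ~ low_edges eps x) : 2 * eps <= x.1 /\ 2 * eps <= x.2.
Proof.
have e0 := eps0.
move: omx => [/=]; rewrite !in_itv/= => /andP[x1 _] /andP[x2 _].
by split; rewrite leNgt; apply/negP => H; apply: xl; [left|right];
  split; rewrite //= in_itv/=; apply/andP; split; lra.
Qed.

Let node_ge2 (r : nat) (y : R) : 2 * eps <= y -> y < r.+1%:R * eps -> (1 < r)%N.
Proof.
move=> H1 H2; have := le_lt_trans H1 H2.
by rewrite ltr_pM2r// ltr_nat ltnS.
Qed.

Let cell_near (r k : nat) : (1 < r)%N -> (r < N)%N -> (r <= k <= r.+2)%N ->
  (0 < cell k)%N /\ r%:R * eps - eps <= (cell k)%:R * eps <= r%:R * eps + eps.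
Proof.
move=> r1 rN /andP[rk kr].
have [c0 H1 H2] : [/\ 0 < cell k, r <= (cell k).+1 & cell k <= r.+1]%N.
  by move: r1 rN rk kr; clear; rewrite /cell_of => *; split; lia.
split => //.
have epsS (n : nat) : n%:R * eps + eps = n.+1%:R * eps.
  by rewrite -natr1 mulrDl mul1r.
by rewrite lerBlDr !epsS !nat_eps_le; apply/andP.
Qed.

Let not_edge (u v : nat) : (0 < u)%N -> (0 < v)%N -> edge_cell l eps u v = false.
Proof. by rewrite /edge_cell; case: u => //; case: v. Qed.

(** The cells that interpolate the value at a point x of the cell (p, q) have
    indices p - 1, p, p + 1 and q - 1, q, q + 1, that is k and m up to the shift by
    one.  Close to the axes the error is merely bounded; elsewhere the average
    over such a cell is within the local oscillation of phi. *)
Lemma coef_near k m : (p <= k <= p.+2)%N -> (q <= m <= q.+2)%N ->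
  (`|c k m - phi x|%:E <= bound phi)%E.
Proof.
move=> pk qm; have [xl|xl] := pselect (low_edges eps x).
  by apply: low_bound => //; exact: coef_dist.
apply: high_bound => //; have [x1 x2] := high xl.
move: (px) (qx) => /andP[p1 p2] /andP[q1 q2].
have [k0 /andP[k1 k2]] := cell_near (node_ge2 x1 p2) pN pk.
have [m0 /andP[m1 m2]] := cell_near (node_ge2 x2 q2) qN qm.
rewrite /coef /cell_value not_edge//.
have [k3 k4] := node_bounds (cell_lt k); have [m3 m4] := node_bounds (cell_lt m).
have e0 := eps0; rewrite -natr1 mulrDl mul1r in p2.
rewrite -natr1 mulrDl mul1r in q2.
by apply: (mean_near L0 step_bump_Cs mphi phiC) => //; lra.
Qed.

Let cell_succ (r : nat) : (0 < r)%N -> (r < N)%N -> cell r.+1 = r /\ cell r = r.-1.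
Proof. by rewrite /cell_of; clear; move=> *; split; lia. Qed.

(** In the unshifted indices the quotient is that of the cells q and q - 1, which
    share the horizontal side below x. *)
Lemma quotient2_near k : (p <= k <= p.+2)%N ->
  (`|(c k q.+1 - c k q) / eps - d2 x|%:E <= bound d2)%E.
Proof.
move=> pk; have [xl|xl] := pselect (low_edges eps x).
  by apply: low_bound => //; exact: quotient2_dist.
apply: high_bound => //; have [x1 x2] := high xl.
move: (px) (qx) => /andP[p1 p2] /andP[q1 q2].
have [k0 /andP[k1 k2]] := cell_near (node_ge2 x1 p2) pN pk.
have qq := node_ge2 x2 q2; have [E1 E2] := cell_succ (ltnW qq) qN.
rewrite /coef /cell_value E1 E2 !not_edge//; try by [exact: ltnW|rewrite -ltnS prednK// ltnW].
have [k3 k4] := node_bounds (cell_lt k); have [m3 m4] := node_bounds qN.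
have qE : q.-1%:R * eps = q%:R * eps - eps.
  by rewrite -[in RHS](prednK (ltnW qq)) -natr1 mulrDl mul1r addrK.
have qE0 : 0 <= q%:R * eps - eps by rewrite -qE mulr_ge0// ltW.
rewrite qE.
have e0 := eps0; rewrite -natr1 mulrDl mul1r in p2.
rewrite -natr1 mulrDl mul1r in q2.
by apply: (mean_quotient2 L0 Cs1 step_bump_Cs mphi md2 phiC d2C W2) => //; lra.
Qed.

Lemma quotient1_near m : (q <= m <= q.+2)%N ->
  (`|(c p.+1 m - c p m) / eps - d1 x|%:E <= bound d1)%E.
Proof.
move=> qm; have [xl|xl] := pselect (low_edges eps x).
  by apply: low_bound => //; exact: quotient1_dist.
apply: high_bound => //; have [x1 x2] := high xl.
move: (px) (qx) => /andP[p1 p2] /andP[q1 q2].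
have [m0 /andP[m1 m2]] := cell_near (node_ge2 x2 q2) qN qm.
have pp := node_ge2 x1 p2; have [E1 E2] := cell_succ (ltnW pp) pN.
rewrite /coef /cell_value E1 E2 !not_edge//; try by [exact: ltnW|rewrite -ltnS prednK// ltnW].
have [k3 k4] := node_bounds pN; have [m3 m4] := node_bounds (cell_lt m).
have pE : p.-1%:R * eps = p%:R * eps - eps.
  by rewrite -[in RHS](prednK (ltnW pp)) -natr1 mulrDl mul1r addrK.
have pE0 : 0 <= p%:R * eps - eps by rewrite -pE mulr_ge0// ltW.
rewrite pE.
have e0 := eps0; rewrite -natr1 mulrDl mul1r in p2.
rewrite -natr1 mulrDl mul1r in q2.
by apply: (mean_quotient1 L0 Cs1 step_bump_Cs mphi md1 phiC d1C W1) => //; lra.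
Qed.

End near_point.

End coefficients.

(** * Grid interpolation *)

Section interpolation.
Context {R : realType}.
Variables (eps delta : R) (N : nat).
Implicit Types (F G : nat -> R) (t : R).

(** A joint is an interval of length delta centred at a node p eps; the p-th ramp
    climbs from 0 to 1 across it. *)
Definition joint_left (p : nat) : R := p%:R * eps - delta / 2.

Definition ramp (p : nat) t : R :=
  Num.max 0 (Num.min 1 ((t - joint_left p) / delta)).

Definition joint (p : nat) : set R := `]joint_left p, (joint_left p + delta)[.

(** The sum telescopes: F k is the value between the joints k - 1 and k, and the
    p-th joint is crossed affinely. *)
Definition interp F t : R :=
  F 0%N + \sum_(p < N.+1) (F p.+1 - F p) * ramp p t.

Definition dinterp F t : R :=
  \sum_(p < N.+1) (F p.+1 - F p) * (delta^-1 * \1_(joint p) t).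

Definition interp2 (c : nat -> nat -> R) (x : R * R) : R :=
  interp (fun k => interp (c k) x.2) x.1.
Definition d1interp2 (c : nat -> nat -> R) (x : R * R) : R :=
  dinterp (fun k => interp (c k) x.2) x.1.
Definition d2interp2 (c : nat -> nat -> R) (x : R * R) : R :=
  interp (fun k => dinterp (c k) x.2) x.1.

Let interp_lin n (F : nat -> R) (G : nat -> nat -> R) (w : nat -> R) t :
  interp (fun k => F k + \sum_(m < n) G m k * w m) t =
  interp F t + \sum_(m < n) interp (G m) t * w m.
Proof.
have E1 : \sum_(m < n) interp (G m) t * w m = \sum_(m < n) G m 0%N * w m +
    \sum_(p < N.+1) (\sum_(m < n) (G m p.+1 - G m p) * w m) * ramp p t.
  under eq_bigr do rewrite /interp mulrDl mulr_suml.
  rewrite big_split /= exchange_big /=; congr (_ + _).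
  by apply: eq_bigr => p _; rewrite mulr_suml; apply: eq_bigr => m _; ring.
have E2 : \sum_(p < N.+1) (F p.+1 + \sum_(m < n) G m p.+1 * w m -
      (F p + \sum_(m < n) G m p * w m)) * ramp p t =
    \sum_(p < N.+1) (F p.+1 - F p) * ramp p t +
    \sum_(p < N.+1) (\sum_(m < n) (G m p.+1 - G m p) * w m) * ramp p t.
  rewrite -big_split /=; apply: eq_bigr => p _; rewrite -mulrDl; congr (_ * _).
  rewrite opprD addrACA -sumrB; congr (_ + _).
  by apply: eq_bigr => m _; rewrite mulrBl.
by rewrite E1 /interp E2; ring.
Qed.

Let interpB F G t : interp (fun k => F k - G k) t = interp F t - interp G t.
Proof.
rewrite /interp opprD addrACA -sumrB; congr (_ + _).
by apply: eq_bigr => p _; ring.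
Qed.

(** Interpolating in one variable is linear in the values, so that the two
    interpolations commute and each property in direction 2 follows from its
    counterpart in direction 1. *)
Lemma interp2_swap (c : nat -> nat -> R) (x y : R) :
  interp2 c (x, y) = interp2 (fun m k => c k m) (y, x).
Proof.
rewrite /interp2 /=.
have -> : (fun k => interp (c k) y) = (fun k => c k 0%N +
  \sum_(m < N.+1) (fun m k => c k m.+1 - c k m) m k * ramp m y) by [].
rewrite (@interp_lin _ (fun k => c k 0%N) (fun m k => c k m.+1 - c k m)
  (fun m => ramp m y)) [RHS]/interp; congr (_ + _).
by apply: eq_bigr => m _; rewrite interpB.
Qed.

Lemma d2interp2_swap (c : nat -> nat -> R) (x y : R) :
  d2interp2 c (x, y) = d1interp2 (fun m k => c k m) (y, x).
Proof.
rewrite /d2interp2 /d1interp2 /=.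
have -> : (fun k => dinterp (c k) y) = (fun k => 0 + \sum_(m < N.+1)
    (fun m k => c k m.+1 - c k m) m k * (delta^-1 * \1_(joint m) y)).
  by apply/funext => k; rewrite add0r.
rewrite (@interp_lin _ (fun=> 0) (fun m k => c k m.+1 - c k m)
  (fun m => delta^-1 * \1_(joint m) y)).
have -> : interp (fun=> 0) x = 0.
  by rewrite /interp big1 ?addr0// => p _; rewrite subrr mul0r.
by rewrite add0r /dinterp; apply: eq_bigr => m _; rewrite interpB.
Qed.

Hypotheses (delta0 : 0 < delta) (delta_eps : 3 * delta < eps).

Let eps0 : 0 < eps. Proof. have := delta0; have := delta_eps; lra. Qed.

Lemma ramp_ge0 p t : 0 <= ramp p t.
Proof. by rewrite /ramp le_max lexx. Qed.

Lemma ramp_le1 p t : ramp p t <= 1.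
Proof. by rewrite /ramp ge_max ler01 ge_min lexx. Qed.

Lemma ramp_left p t : t <= joint_left p -> ramp p t = 0.
Proof.
move=> H; apply/eqP; rewrite eq_le ramp_ge0 andbT /ramp ge_max lexx ge_min.
by rewrite ler_pdivrMr// mul0r subr_le0 H orbT.
Qed.

Lemma ramp_right p t : joint_left p + delta <= t -> ramp p t = 1.
Proof.
move=> H; apply/eqP; rewrite eq_le ramp_le1 /ramp le_max le_min lexx /=.
by rewrite ler_pdivlMr// mul1r lerBrDl H orbT.
Qed.

Lemma ramp_joint p t : joint_left p <= t <= joint_left p + delta ->
  ramp p t = (t - joint_left p) / delta.
Proof.
move=> /andP[H1 H2]; rewrite /ramp (min_idPr _) ?(max_idPr _)//.
  by rewrite divr_ge0 ?subr_ge0// ltW.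
by rewrite ler_pdivrMr// mul1r lerBlDl.
Qed.

Let joint_leftS (p q : nat) : (p < q)%N -> joint_left p + eps <= joint_left q.
Proof.
move=> pq; rewrite /joint_left addrAC lerB// -[X in _ + X]mul1r -mulrDl natr1.
by rewrite ler_pM2r// ler_nat.
Qed.

(** Around the P-th joint, the ramps before it have reached 1 and those after it
    are still 0. *)
Lemma interp_loc F (P : nat) t : (P <= N)%N ->
  (P%:R - 1) * eps + delta / 2 <= t -> t <= (P%:R + 1) * eps - delta / 2 ->
  interp F t = F P + (F P.+1 - F P) * ramp P t.
Proof.
move=> PN t1 t2.
have lo p : (p < P)%N -> ramp p t = 1.
  move=> pP; apply: ramp_right; have := joint_leftS pP.
  by rewrite /joint_left; have := delta0; move: t1; lra.
have hi p : (P < p)%N -> ramp p t = 0.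
  move=> pP; apply: ramp_left; have := joint_leftS pP.
  by rewrite /joint_left; move: t2; lra.
have H n : \sum_(p < n) (F p.+1 - F p) * ramp p t =
    if (n <= P)%N then F n - F 0%N else F P - F 0%N + (F P.+1 - F P) * ramp P t.
  elim: n => [|n IH]; first by rewrite big_ord0 subrr.
  rewrite big_ord_recr /= IH; case: (ltngtP n P) => nP.
  - by rewrite (lo n)// mulr1; ring.
  - by rewrite (hi n)// mulr0 addr0.
  - by rewrite nP.
by rewrite /interp H ltnNge PN /=; ring.
Qed.

Lemma dinterp_loc F (P : nat) t : (P <= N)%N -> joint P t ->
  dinterp F t = (F P.+1 - F P) / delta.
Proof.
move=> PN tP; have := tP; rewrite /joint/= in_itv/= => /andP[t1 t2].
rewrite /dinterp (bigD1 (inord P : 'I_N.+1)) //= inordK//.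
rewrite indicE mem_set// mulr1 big1 ?addr0// => p pP.
have {}pP : (p : nat) != P.
  by apply: contraNneq pP => E; apply/eqP/val_inj; rewrite /= inordK.
rewrite indicE memNset ?mulr0//= /joint/= in_itv/= => /andP[h1 h2].
have := delta0; have := delta_eps.
case: (ltngtP p P) pP => // pP _; have := joint_leftS pP; lra.
Qed.

Lemma dinterp_out F t : (forall p, ~ joint p t) -> dinterp F t = 0.
Proof.
move=> H; rewrite /dinterp big1// => p _.
by rewrite indicE memNset ?mulr0//; exact: H.
Qed.

(** Between two nodes only the joints of these nodes are met: the value is there
    a convex combination of two consecutive values among three, hence it is not
    further from a than one of them. *)
Lemma interp_near F (a : R) (p : nat) t : (p < N)%N ->
  p%:R * eps <= t -> t <= p.+1%:R * eps ->
  exists2 k, (p <= k <= p.+2)%N & `|interp F t - a| <= `|F k - a|.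
Proof.
move=> pN; rewrite -natr1 => t1 t2.
have [P PN [Pp tP]] : exists2 P, (P <= N)%N & (p <= P <= p.+1)%N /\
    interp F t = F P + (F P.+1 - F P) * ramp P t.
  have d0 := delta0; have d1 := delta_eps.
  have [h|h] := leP t ((p%:R + 2^-1) * eps).
    exists p; first exact: ltnW.
    by split; [rewrite leqnn leqnSn|apply: interp_loc; [exact: ltnW|lra|lra]].
  exists p.+1 => //; split; first by rewrite leqnn leqnSn.
  by apply: interp_loc => //; rewrite -natr1; lra.
have r0 := ramp_ge0 P t.
have r2 : 0 <= 1 - ramp P t by rewrite subr_ge0 ramp_le1.
have E : interp F t - a =
    (1 - ramp P t) * (F P - a) + ramp P t * (F P.+1 - a) by rewrite tP; ring.
have [h|h] := leP `|F P - a| `|F P.+1 - a|.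
- exists P.+1; first by move: Pp; clear; lia.
  rewrite E; apply: le_trans (ler_normD _ _) _; rewrite !normrM.
  rewrite (ger0_norm r2) (ger0_norm r0).
  by have := ler_wpM2l r2 h; lra.
- exists P; first by move: Pp; clear; lia.
  rewrite E; apply: le_trans (ler_normD _ _) _; rewrite !normrM.
  rewrite (ger0_norm r2) (ger0_norm r0).
  by have := ler_wpM2l r0 (ltW h); lra.
Qed.

Lemma interpZ (a : R) F t : interp (fun k => a * F k) t = a * interp F t.
Proof.
rewrite /interp mulrDr mulr_sumr; congr (_ + _).
by apply: eq_bigr => p _; ring.
Qed.

Let sum_bound (u : nat -> R) (K : R) : (forall p, `|u p| <= K) ->
  `|\sum_(p < N.+1) u p| <= N.+1%:R * K.
Proof.
move=> uK; apply: le_trans (ler_norm_sum _ _ _) _.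
apply: (@le_trans _ _ (\sum_(p < N.+1) K)); first exact: ler_sum.
by rewrite sumr_const card_ord mulr_natl.
Qed.

Lemma interp_bound F (M : R) t : (forall k, `|F k| <= M) ->
  `|interp F t| <= M + N.+1%:R * (2 * M).
Proof.
move=> FM; have M0 : 0 <= M by apply: le_trans (FM 0%N).
apply: le_trans (ler_normD _ _) _; apply: lerD => //.
apply: (@sum_bound (fun p => (F p.+1 - F p) * ramp p t)) => p.
rewrite normrM (ger0_norm (ramp_ge0 _ _)) -[leRHS]mulr1 ler_pM ?ramp_ge0 ?ramp_le1//.
by apply: le_trans (ler_normB _ _) _; rewrite mulr_natl mulr2n lerD.
Qed.

Lemma dinterp_bound F (M : R) t : (forall k, `|F k| <= M) ->
  `|dinterp F t| <= N.+1%:R * (2 * M * delta^-1).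
Proof.
move=> FM; have M0 : 0 <= M by apply: le_trans (FM 0%N).
apply: (@sum_bound (fun p => (F p.+1 - F p) * (delta^-1 * \1_(joint p) t))) => p.
rewrite normrM ler_pM//.
  by apply: le_trans (ler_normB _ _) _; rewrite mulr_natl mulr2n lerD.
rewrite normrM normfV (gtr0_norm delta0) ler_piMr ?invr_ge0 ?(ltW delta0)//.
by rewrite indicE; case: (_ \in _); rewrite ?normr1 ?normr0.
Qed.

Lemma measurable_ramp p : measurable_fun setT (ramp p : measurableTypeR R -> R).
Proof.
apply: measurable_maxr; first exact: measurable_cst.
apply: measurable_minr; first exact: measurable_cst.
apply: measurable_funM; last exact: measurable_cst.
by apply: measurable_funB => //; exact: measurable_cst.
Qed.

Lemma measurable_joint p :
  measurable_fun setT (\1_(joint p) : measurableTypeR R -> R).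
Proof. by apply: measurable_indic; exact: measurable_itv. Qed.

Section measurable_interp.
Context d (T : measurableType d).

Lemma measurable_interp (F : nat -> T -> R) (t : T -> R) :
  (forall k, measurable_fun setT (F k)) -> measurable_fun setT t ->
  measurable_fun setT (fun x => interp (fun k => F k x) (t x)).
Proof.
move=> mF mt; apply: measurable_funD => //; apply: measurable_sum => p.
apply: measurable_funM; first exact: measurable_funB.
exact: (measurableT_comp (measurable_ramp p) mt).
Qed.

Lemma measurable_dinterp (F : nat -> T -> R) (t : T -> R) :
  (forall k, measurable_fun setT (F k)) -> measurable_fun setT t ->
  measurable_fun setT (fun x => dinterp (fun k => F k x) (t x)).
Proof.
move=> mF mt; apply: measurable_sum => p.
apply: measurable_funM; first exact: measurable_funB.
apply: measurable_funM; first exact: measurable_cst.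
exact: (measurableT_comp (measurable_joint p) mt).
Qed.

End measurable_interp.

Section interp2_measurable_bounded.
Variables (c : nat -> nat -> R) (M : R).
Hypothesis cM : forall k m, `|c k m| <= M.

Lemma measurable_interp2 : measurable_fun setT (interp2 c : plane R -> R).
Proof. by apply: measurable_interp => // k; apply: measurable_interp. Qed.

Lemma measurable_d1interp2 : measurable_fun setT (d1interp2 c : plane R -> R).
Proof. by apply: measurable_dinterp => // k; apply: measurable_interp. Qed.

Lemma measurable_d2interp2 : measurable_fun setT (d2interp2 c : plane R -> R).
Proof. by apply: measurable_interp => // k; apply: measurable_dinterp. Qed.

Lemma interp2_bounded : exists K, forall x, `|interp2 c x| <= K.
Proof. by eexists => x; apply: interp_bound => k; apply: interp_bound. Qed.

Lemma d1interp2_bounded : exists K, forall x, `|d1interp2 c x| <= K.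
Proof. by eexists => x; apply: dinterp_bound => k; apply: interp_bound. Qed.

Lemma d2interp2_bounded : exists K, forall x, `|d2interp2 c x| <= K.
Proof. by eexists => x; apply: interp_bound => k; apply: dinterp_bound. Qed.

End interp2_measurable_bounded.

End interpolation.

(** * Weak derivatives of the interpolation *)

Section integration_by_parts_ramp.
Context {R : realType}.
Local Notation mu1 := (@lebesgue_measure R).
Variables (eps delta : R) (N : nat).
Hypotheses (delta0 : 0 < delta).
Variables (A B : R) (a a' : R -> R).
Hypotheses (AB : A <= B) (aa' : forall t : R, is_derive t 1 a (a' t))
  (ca' : continuous a') (aA : a A = 0) (aB : a B = 0).
Hypothesis joints : forall p, (p <= N)%N ->
  A <= joint_left eps delta p /\ joint_left eps delta p + delta <= B.

Let ca : continuous a. Proof. exact: is_derive_continuous aa'. Qed.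

Let bounded_mul (f g : R -> R) (K : R) : (forall t, `|f t| <= K) ->
  measurable_fun setT (f : measurableTypeR R -> R) -> continuous g ->
  mu1.-integrable `]A, B[ (EFin \o (fun t => f t * g t)).
Proof.
move=> fK mf cg; have [M M0 gM] := continuous_itv_bounded A B cg.
apply: (integrable_bounded_itv (M := K * M)).
  by apply: measurable_funM => //; exact: continuous_measurable_fun.
move=> t /=; rewrite in_itv/= => /andP[tA tB].
by rewrite normrM ler_pM// gM// !ltW.
Qed.

Let ramp_deriv (p : nat) (t : R) : R :=
  ramp eps delta p t * a' t + (delta^-1 * \1_(joint eps delta p) t) * a t.

Let iramp p : mu1.-integrable `]A, B[ (EFin \o ramp_deriv p).
Proof.
apply: (integrableD _ (@bounded_mul _ _ 1 _ _ ca') (@bounded_mul _ _ delta^-1 _ _ ca)) => //.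
- by move=> t; rewrite ger0_norm ?ramp_ge0// ramp_le1.
- exact: measurable_ramp.
- move=> t; rewrite normrM normfV (gtr0_norm delta0) ler_piMr ?invr_ge0 ?(ltW delta0)//.
  by rewrite indicE; case: (_ \in _); rewrite ?normr1 ?normr0.
- by apply: measurable_funM; [exact: measurable_cst|exact: measurable_joint].
Qed.

(** The integrand is the derivative of an affine function times a on the joint,
    that of a after it, and 0 before.  The two boundary terms at the end of the
    joint cancel, and a vanishes at B. *)
Lemma ramp_ibp p : (p <= N)%N ->
  (\int[mu1]_(t in `]A, B[) (ramp_deriv p t)%:E = 0)%E.
Proof.
move=> pN; have [sA sB] := joints pN; set s := joint_left eps delta p in sA sB *.
have dn0 : delta != 0 by rewrite gt_eqF.
pose f1 t := (delta^-1 * t + - (delta^-1 * s)) * a t.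
pose g1 t := (delta^-1 * t + - (delta^-1 * s)) * a' t + a t * delta^-1.
have df1 (t : R) : is_derive t 1 f1 (g1 t).
  have da : is_derive t 1 (fun t : R => delta^-1 * t + - (delta^-1 * s)) delta^-1.
    by apply: is_derive_eq; rewrite subr0 /GRing.scale/= mulr1.
  exact: (is_deriveM da (aa' t)).
have cg1 : continuous g1.
  move=> t; apply: cvgD; apply: cvgM.
  - by apply: cvgD; [apply: cvgM; [exact: cvg_cst|exact: cvg_id]|exact: cvg_cst].
  - exact: ca'.
  - exact: ca.
  - exact: cvg_cst.
pose I1 : set (measurableTypeR R) := joint eps delta p.
pose I2 : set (measurableTypeR R) := `[s + delta, +oo[%classic.
have I1E t : I1 t <-> s < t < s + delta by rewrite /I1 /joint/= in_itv.
have I2E t : I2 t <-> s + delta <= t by rewrite /I2/= in_itv/= andbT.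
have mI1 : measurable I1 by exact: measurable_itv.
have mI2 : measurable I2 by exact: measurable_itv.
have mD : measurable (`]A, B[%classic : set (measurableTypeR R)).
  exact: measurable_itv.
have cint g : continuous g -> mu1.-integrable `]A, B[ (EFin \o g).
  move=> cg; have [M M0 gM] := continuous_itv_bounded A B cg.
  apply: (integrable_bounded_itv (M := M)); first exact: continuous_measurable_fun.
  by move=> t /=; rewrite in_itv/= => /andP[tA tB]; rewrite gM// !ltW.
transitivity (\int[mu1]_(t in `]A, B[%classic : set (measurableTypeR R))
    (((EFin \o g1) \_ I1) t + ((EFin \o a') \_ I2) t))%E.
  apply: eq_integral => t _; rewrite /ramp_deriv /patch.
  have jI1 : (t \in joint eps delta p) = (t \in I1) by [].
  rewrite indicE jI1; have [t1|t1] := leP t s.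
    have nI1 : (t \in I1) = false.
      by apply: memNset => /I1E; rewrite ltNge t1.
    have nI2 : (t \in I2) = false.
      by apply: memNset => /I2E; have := delta0; lra.
    rewrite nI1 nI2 ramp_left// mulr0 !mul0r addr0.
    by transitivity (0 + 0 :> \bar R)%E; rewrite ?adde0.
  have [t2|t2] := ltP t (s + delta).
    have yI1 : (t \in I1) = true by apply: mem_set; apply/I1E; rewrite t1.
    have nI2 : (t \in I2) = false by apply: memNset => /I2E; rewrite leNgt t2.
    rewrite yI1 nI2 ramp_joint//; last by rewrite -/s !ltW.
    transitivity ((g1 t)%:E + 0 :> \bar R)%E; last by [].
    by rewrite adde0 /g1 -/s /=; congr (_%:E); ring.
  have nI1 : (t \in I1) = false.
    by apply: memNset => /I1E /andP[_]; rewrite ltNge t2.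
  have yI2 : (t \in I2) = true by apply: mem_set; apply/I2E.
  rewrite nI1 yI2 ramp_right// mul1r mulr0 mul0r addr0.
  by transitivity (0 + (a' t)%:E :> \bar R)%E; rewrite ?add0e.
have iD1 : mu1.-integrable `]A, B[ ((EFin \o g1) \_ I1).
  apply/(integrable_restrict mu1 mI1 mD).
  by apply: integrableS (cint _ cg1) => //; exact: measurableI.
have iD2 : mu1.-integrable `]A, B[ ((EFin \o a') \_ I2).
  apply/(integrable_restrict mu1 mI2 mD).
  by apply: integrableS (cint _ ca') => //; exact: measurableI.
rewrite integralD// -!integral_mkcondr.
have -> : `]A, B[ `&` I1 = `]s, (s + delta)[%classic.
  apply/seteqP; split => t; rewrite /= !in_itv/=; first by move=> [_ /I1E].
  move=> t12; split; last exact/I1E.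
  by move: t12 => /andP[h1 h2]; apply/andP; split; lra.
have -> : `]A, B[ `&` I2 = `[s + delta, B[%classic.
  apply/seteqP; split => t; rewrite /= !in_itv/=.
    by move=> [/andP[_ h1] /I2E h2]; apply/andP.
  move=> /andP[h1 h2]; split; last exact/I2E.
  by apply/andP; split => //; have := delta0; lra.
have -> : (\int[mu1]_(t in `[(s + delta)%R, B[) (EFin \o a') t =
           \int[mu1]_(t in `](s + delta)%R, B[) (EFin \o a') t)%E.
  apply: integral_itv_bndoo; apply: measurable_funTS; apply/measurable_EFinP.
  exact: continuous_measurable_fun.
have ssd : s <= s + delta by rewrite lerDl ltW.
rewrite (FTC_oo ssd df1 cg1) (FTC_oo sB aa' ca') aB -EFinD /f1.
by congr (_%:E); field.
Qed.

Lemma interp_ibp (F : nat -> R) :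
  (\int[mu1]_(t in `]A, B[)
    (interp eps delta N F t * a' t + dinterp eps delta N F t * a t)%:E = 0)%E.
Proof.
have ia' : mu1.-integrable `]A, B[ (EFin \o a').
  have [M M0 gM] := continuous_itv_bounded A B ca'.
  apply: (integrable_bounded_itv (M := M)); first exact: continuous_measurable_fun.
  by move=> t /=; rewrite in_itv/= => /andP[tA tB]; rewrite gM// !ltW.
have mD : measurable (`]A, B[%classic : set (measurableTypeR R)).
  exact: measurable_itv.
transitivity (\int[mu1]_(t in `]A, B[%classic : set (measurableTypeR R))
    ((F 0%N)%:E * (EFin \o a') t +
     \sum_(p < N.+1) (F p.+1 - F p)%:E * (EFin \o ramp_deriv p) t))%E.
  apply: eq_integral => t _; rewrite /= /interp /dinterp.
  under [X in (_ + X)%E]eq_bigr do rewrite -EFinM.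
  rewrite sumEFin -EFinM -EFinD; congr (_%:E).
  rewrite mulrDl -addrA; congr (_ + _).
  rewrite !mulr_suml -big_split /=; apply: eq_bigr => p _.
  by rewrite /ramp_deriv; ring.
rewrite integralD//; last 2 first.
- exact: integrableZl.
- by apply: integrable_sum => // p _; apply: integrableZl.
rewrite integralZl// (FTC_oo AB aa' ca') aA aB subrr mule0 add0e.
rewrite integral_sum//; last by move=> p; apply: integrableZl.
rewrite big1// => p _; rewrite integralZl//.
by rewrite [X in (_ * X)%E]ramp_ibp ?mule0// -ltnS.
Qed.

End integration_by_parts_ramp.

Section test_function_slices.
Context {R : realType}.
Variables (A B : R) (psi : R * R -> R).
Hypothesis tpsi : test_function (`]A, B[ `*` `]A, B[) psi.

Lemma test_function_out x : ~ (`]A, B[ `*` `]A, B[) x -> psi x = 0.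
Proof. by have [K [_ KU K0]] := tpsi.2 => Ux; apply: K0 => /KU. Qed.

Lemma test_function_continuous : continuous psi.
Proof. exact: (tpsi.1 0%N).1. Qed.

Lemma test_function_continuous_e1 : continuous ('D_e1 psi).
Proof. by have [_ [_ [[]]]] := tpsi.1 1%N. Qed.

Lemma test_function_continuous_e2 : continuous ('D_e2 psi).
Proof. by have [_ [_ [_ []]]] := tpsi.1 1%N. Qed.

Lemma is_derive_slice1 (x y : R) :
  is_derive x 1 (fun t => psi (t, y)) ('D_e1 psi (x, y)).
Proof.
have [_ [/(_ (x, y))[H _] _]] := tpsi.1 1%N.
by rewrite derivable_e1 in H; apply: DeriveDef => //; rewrite derive_e1.
Qed.

Lemma is_derive_slice2 (x y : R) :
  is_derive y 1 (fun t => psi (x, t)) ('D_e2 psi (x, y)).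
Proof.
have [_ [/(_ (x, y))[_ H] _]] := tpsi.1 1%N.
by rewrite derivable_e2 in H; apply: DeriveDef => //; rewrite derive_e2.
Qed.

End test_function_slices.

Section continuous_on_the_plane.
Context {R : realType}.

Lemma continuous_slice1 (f : R * R -> R) (y : R) :
  continuous f -> continuous (fun t => f (t, y)).
Proof.
move=> cf t; apply: (@continuous_comp _ _ _ (fun t => (t, y)) f); last exact: cf.
by apply: (@cvg_pair _ _ _ _ (nbhs t) (nbhs y)); [exact: cvg_id|exact: cvg_cst].
Qed.

Lemma continuous_slice2 (f : R * R -> R) (x : R) :
  continuous f -> continuous (fun t => f (x, t)).
Proof.
move=> cf t; apply: (@continuous_comp _ _ _ (fun t => (x, t)) f); last exact: cf.
by apply: (@cvg_pair _ _ _ _ (nbhs x) (nbhs t)); [exact: cvg_cst|exact: cvg_id].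
Qed.

Lemma continuous_rect_bounded (f : R * R -> R) (a b c d : R) : continuous f ->
  exists M, forall x, (`]a, b[ `*` `]c, d[) x -> `|f x| <= M.
Proof.
move=> cf; pose K : set (R * R) := `[a, b] `*` `[c, d].
have cK : compact K by apply: compact_setX; exact: segment_compact.
have := compact_bounded (continuous_compact (continuous_subspaceT cf) cK).
move=> [M [_ HM]]; exists (M + 1) => x [x1 x2].
apply: (HM (M + 1)); first by rewrite ltrDl.
exists x => //; split; exact: subset_itv_oo_cc.
Qed.

End continuous_on_the_plane.

Section weak_partials_of_interpolations.
Context {R : realType}.
Local Notation mu1 := (@lebesgue_measure R).
Local Notation mu2 := (@lebesgue2 R).
Variables (L eps delta : R) (N : nat).
Hypotheses (delta0 : 0 < delta) (delta_eps : 3 * delta < eps) (NE : N%:R * eps = L).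
Variables (c : nat -> nat -> R) (M : R).
Hypothesis cM : forall k m, `|c k m| <= M.

Local Notation U := (omega_delta L delta : set (plane R)).
Let A := - (delta / 2).
Let B := L + delta / 2.

Let eps0 : 0 < eps. Proof. have := delta0; have := delta_eps; lra. Qed.
Let L0 : 0 <= L. Proof. by rewrite -NE mulr_ge0// ltW. Qed.
Let AB : A <= B.
Proof. rewrite /A /B; have := L0; have := delta0; lra. Qed.

Let joints p : (p <= N)%N ->
  A <= joint_left eps delta p /\ joint_left eps delta p + delta <= B.
Proof.
move=> pN; rewrite /A /B /joint_left -NE; have e0 := eps0.
have : p%:R * eps <= N%:R * eps by rewrite ler_pM2r// ler_nat.
have : 0 <= p%:R * eps by rewrite mulr_ge0// ltW.
by have := delta0; move=> *; split; lra.
Qed.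

Let integrable_mul_test (f g : R * R -> R) (K : R) :
  measurable_fun setT (f : plane R -> R) -> (forall x, `|f x| <= K) ->
  continuous g -> mu2.-integrable U (EFin \o (fun x => f x * g x)).
Proof.
move=> mf fK cg; have [G gG] := continuous_rect_bounded A B A B cg.
apply: (integrable_bounded_rect (M := K * G)) => //.
  by apply: measurable_funM => //; exact: continuous_measurable_plane.
by move=> y Uy; rewrite normrM ler_pM// gG.
Qed.

Let opp_of_sum0 (f g : plane R -> R) :
  mu2.-integrable U (EFin \o f) -> mu2.-integrable U (EFin \o g) ->
  (\int[mu2]_(x in U) ((EFin \o f) \+ (EFin \o g)) x = 0)%E ->
  (\int[mu2]_(x in U) (f x)%:E = - \int[mu2]_(x in U) (g x)%:E)%E.
Proof.
have mU : measurable U by exact: measurable_rect.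
move=> fi gi; rewrite integralD_EFin//.
have := integrable_fin_num mU fi; have := integrable_fin_num mU gi.
move=> gf ff; rewrite /= -(fineK gf) -(fineK ff) -EFinD -EFinN.
by move=> [] /eqP; rewrite addr_eq0 => /eqP ->.
Qed.

(** Integration by parts on each horizontal line, where the interpolation is
    one-dimensional, and Fubini. *)
Lemma weak_partial_interp2_e1 : weak_partial (omega_delta L delta) e1
  (interp2 eps delta N c) (d1interp2 eps delta N c).
Proof.
move=> psi tpsi; have [K fK] := interp2_bounded eps delta N cM.
have [K' f'K] := d1interp2_bounded eps N delta0 cM.
have fi : mu2.-integrable U (EFin \o (fun x => interp2 eps delta N c x * 'D_e1 psi x)).
  apply: (integrable_mul_test (K := K)) => //; first exact: measurable_interp2.
  exact: (test_function_continuous_e1 tpsi).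
have gi : mu2.-integrable U (EFin \o (fun x => d1interp2 eps delta N c x * psi x)).
  apply: (integrable_mul_test (K := K')) => //; first exact: measurable_d1interp2.
  exact: (test_function_continuous tpsi).
apply: opp_of_sum0 => //; rewrite [LHS](fubini_rect2 _ _ (integrableD _ fi gi)).
- apply: integral0_eq => y _ /=.
  under eq_integral do rewrite -EFinD.
  apply: (@interp_ibp _ eps delta N delta0 A B (fun t => psi (t, y))
    (fun t => 'D_e1 psi (t, y)) AB _ _ _ _ joints (fun k => interp eps delta N (c k) y)).
  + by move=> t; exact: (is_derive_slice1 tpsi).
  + exact: (@continuous_slice1 _ _ y (test_function_continuous_e1 tpsi)).
  + by apply: (test_function_out tpsi) => -[/=]; rewrite in_itv/= ltxx.
  + by apply: (test_function_out tpsi) => -[/=]; rewrite in_itv/= ltxx andbF.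
- exact: measurable_itv.
- exact: measurable_itv.
- exact: measurable_rect.
Qed.

Lemma weak_partial_interp2_e2 : weak_partial (omega_delta L delta) e2
  (interp2 eps delta N c) (d2interp2 eps delta N c).
Proof.
move=> psi tpsi; have [K fK] := interp2_bounded eps delta N cM.
have [K' f'K] := d2interp2_bounded eps N delta0 cM.
have fi : mu2.-integrable U (EFin \o (fun x => interp2 eps delta N c x * 'D_e2 psi x)).
  apply: (integrable_mul_test (K := K)) => //; first exact: measurable_interp2.
  exact: (test_function_continuous_e2 tpsi).
have gi : mu2.-integrable U (EFin \o (fun x => d2interp2 eps delta N c x * psi x)).
  apply: (integrable_mul_test (K := K')) => //; first exact: measurable_d2interp2.
  exact: (test_function_continuous tpsi).
apply: opp_of_sum0 => //; rewrite [LHS](fubini_rect1 _ _ (integrableD _ fi gi)).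
- apply: integral0_eq => x _ /=.
  under eq_integral do rewrite -EFinD interp2_swap d2interp2_swap.
  apply: (@interp_ibp _ eps delta N delta0 A B (fun t => psi (x, t))
    (fun t => 'D_e2 psi (x, t)) AB _ _ _ _ joints
    (fun m => interp eps delta N (fun k => c k m) x)).
  + by move=> t; exact: (is_derive_slice2 tpsi).
  + exact: (@continuous_slice2 _ _ x (test_function_continuous_e2 tpsi)).
  + by apply: (test_function_out tpsi) => -[_ /=]; rewrite in_itv/= ltxx.
  + by apply: (test_function_out tpsi) => -[_ /=]; rewrite in_itv/= ltxx andbF.
- exact: measurable_itv.
- exact: measurable_itv.
- exact: measurable_rect.
Qed.

End weak_partials_of_interpolations.

(** * Membership in V *)

Section bounded_Lp.
Context {R : realType}.
Local Notation mu2 := (@lebesgue2 R).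

Lemma Lpoo_bounded (U : set (plane R)) (f : plane R -> R) (K : R) :
  measurable_fun setT f -> (forall x, `|f x| <= K) -> Lp mu2 +oo%E U f.
Proof.
move=> mf fK; split; first exact: measurable_funTS.
rewrite unlock; case: ifP => _; last exact: ltry.
apply: le_lt_trans (ltry K); apply/ess_supP; apply: aeW => x /=.
rewrite lee_fin /patch; case: ifP => _ //.
by rewrite normr0; apply: le_trans (fK x).
Qed.

Lemma Lp2_bounded (a b c d : R) (f : plane R -> R) (K : R) :
  a <= b -> c <= d -> measurable_fun setT f -> (forall x, `|f x| <= K) ->
  Lp mu2 2%:E (`]a, b[ `*` `]c, d[) f.
Proof.
move=> ab cd mf fK; split; first exact: measurable_funTS.
rewrite unlock /=; apply: poweR_lty.
set D : set (plane R) := `]a, b[ `*` `]c, d[.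
have mD : measurable D by exact: measurable_rect.
have K0 : 0 <= K by apply: le_trans (fK (0, 0)).
apply: (@le_lt_trans _ _ (\int[mu2]_(x in D) (K ^+ 2)%:E)%E).
  rewrite [leRHS]integral_mkcond; apply: ge0_le_integral_dominated => x _.
    by rewrite lee_fin powR_ge0.
  rewrite /patch /=; case: ifPn => xD.
    by rewrite lee_fin powR_mulrn// lerXn2r ?nnegrE.
  by rewrite normr0 powR0.
rewrite integral_cst//.
apply: (@le_lt_trans _ _ ((K ^+ 2)%:E * ((b - a) * (d - c))%:E)%E).
  by rewrite -lebesgue2_rect.
by rewrite -EFinM ltry.
Qed.

End bounded_Lp.

Section interpolation_in_V.
Context {R : realType}.
Local Notation mu2 := (@lebesgue2 R).

Lemma admissibleP (L l eps delta : R) : 0 < l -> l < L ->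
  admissible L l eps delta ->
  [/\ 0 < delta, 3 * delta < eps, (Neps L eps)%:R * eps = L &
      exists2 nl : nat, (nl < Neps L eps)%N & nl%:R * eps = l].
Proof.
move=> l0 lL [d0 de _ LN lN].
have eps0 : 0 < eps by lra.
have natE (y : R) : y / eps \is a Num.nat -> (Num.truncn (y / eps))%:R * eps = y.
  by move=> yN; rewrite truncnK// divfK// gt_eqF.
split; [lra|lra|exact: natE|].
exists (Num.truncn (l / eps)); last exact: natE.
have := natE _ LN; have := natE _ lN.
rewrite -(ltr_nat R) -(ltr_pM2r eps0) /Neps => -> ->; exact: lL.
Qed.

Variables (L l eps delta : R) (nl : nat).
Local Notation N := (Neps L eps).
Hypotheses (delta0 : 0 < delta) (delta_eps : 3 * delta < eps)
  (NE : N%:R * eps = L) (nlN : (nl < N)%N) (nlE : nl%:R * eps = l).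
Variables (c : nat -> nat -> R) (M : R).
Hypothesis cM : forall k m, `|c k m| <= M.
Hypothesis c_edge1 : forall k m, (k <= 1)%N -> (m <= nl.+1)%N -> c k m = 0.
Hypothesis c_edge2 : forall k m, (m <= 1)%N -> (k <= nl.+1)%N -> c k m = 0.

Local Notation f := (interp2 eps delta N c).
Local Notation d1f := (d1interp2 eps delta N c).
Local Notation d2f := (d2interp2 eps delta N c).

Let eps0 : 0 < eps. Proof. have := delta0; have := delta_eps; lra. Qed.

(* Up to the n-th joint, t lies between the neighbours of one of the joints
   0, ..., n, where the local formula of the interpolation applies. *)
Let near_joint (n : nat) (t : R) : - (delta / 2) <= t -> t <= n%:R * eps + delta / 2 ->
  exists2 P, (P <= n)%N & (P%:R - 1) * eps + delta / 2 <= t /\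
                          t <= (P%:R + 1) * eps - delta / 2.
Proof.
move=> t0; have d0 := delta0; have de := delta_eps.
elim: n => [|n IH] tn.
  by exists 0%N => //; move: tn; rewrite mul0r add0r; split; lra.
have [/IH[P Pn HP]|h] := leP t (n%:R * eps + delta / 2).
  by exists P => //; exact: leqW.
by exists n.+1 => //; move: tn; rewrite -natr1; split; lra.
Qed.

Let interp_zero (F : nat -> R) (t : R) : - (delta / 2) <= t -> t <= l + delta / 2 ->
  (forall m, (m <= nl.+1)%N -> F m = 0) -> interp eps delta N F t = 0.
Proof.
rewrite -nlE => t0 tl F0; have [P Pn [h1 h2]] := near_joint t0 tl.
rewrite (interp_loc delta0 delta_eps F (leq_trans Pn (ltnW nlN)) h1 h2).
by rewrite !F0 ?subrr ?mul0r ?addr0//; exact: leqW.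
Qed.

Let interp_zero0 (F : nat -> R) (t : R) : - (delta / 2) <= t -> t <= delta / 2 ->
  (forall k, (k <= 1)%N -> F k = 0) -> interp eps delta N F t = 0.
Proof.
move=> t0 t1 F0; have d0 := delta0; have de := delta_eps.
rewrite (@interp_loc _ _ _ _ delta0 delta_eps F 0%N)//; [|lra|lra].
by rewrite !F0// subrr mul0r addr0.
Qed.

Let f_zero1 (x : R * R) : - (delta / 2) <= x.1 -> x.1 <= delta / 2 ->
  - (delta / 2) <= x.2 -> x.2 <= l + delta / 2 -> f x = 0.
Proof.
move=> h1 h2 h3 h4; apply: interp_zero0 => // k k1.
by apply: interp_zero => // m mn; exact: c_edge1.
Qed.

Let f_zero2 (x : R * R) : - (delta / 2) <= x.2 -> x.2 <= delta / 2 ->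
  - (delta / 2) <= x.1 -> x.1 <= l + delta / 2 -> f x = 0.
Proof.
case: x => x1 x2 /= h1 h2 h3 h4; rewrite interp2_swap.
apply: interp_zero0 => // k k1.
by apply: interp_zero => // m mn; exact: c_edge2.
Qed.

Let zero_trace (x : R * R) :
  (forall y, omega_delta L delta y -> `|x.1 - y.1| < delta / 2 ->
     `|x.2 - y.2| < delta / 2 -> f y = 0) ->
  zero_trace_at (omega_delta L delta) f x.
Proof.
move=> H; apply: cvg_near_cst; near=> r.
rewrite integral0_eq ?mule0// => y [Uy [b1 b2]].
have rd : r < delta / 2 by near: r; apply: nbhs_right_lt; rewrite divr_gt0.
by rewrite H ?normr0//; [exact: lt_trans b1 rd|exact: lt_trans b2 rd].
Unshelve. all: by end_near. Qed.

(** All the values that enter the interpolation within delta / 2 of gamma are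
    those of edge cells, so that the function vanishes there. *)
Lemma zero_on_gamma_interp2 : zero_on_gamma l (omega_delta L delta) f.
Proof.
have d0 := delta0.
apply: aeW => t /andP[t0 tl]; split; apply: zero_trace => // -[y1 y2] [/=];
  rewrite !in_itv/= => /andP[u1 u2] /andP[v1 v2];
  rewrite !ltr_norml => /andP[h1 h2] /andP[h3 h4].
- by apply: f_zero1 => /=; lra.
- by apply: f_zero2 => /=; lra.
Qed.

Lemma sobolev1_interp2_oo : sobolev1 +oo%E (omega_delta L delta) f d1f d2f.
Proof.
have [K fK] := interp2_bounded eps delta N cM.
have [K1 f1K] := d1interp2_bounded eps N delta0 cM.
have [K2 f2K] := d2interp2_bounded eps N delta0 cM.
split.
- exact: (Lpoo_bounded _ (measurable_interp2 eps delta N c) fK).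
- exact: (Lpoo_bounded _ (measurable_d1interp2 eps delta N c) f1K).
- exact: (Lpoo_bounded _ (measurable_d2interp2 eps delta N c) f2K).
- exact: weak_partial_interp2_e1 cM.
- exact: weak_partial_interp2_e2 cM.
Qed.

Lemma sobolev1_interp2_2 : sobolev1 2%:E (omega_delta L delta) f d1f d2f.
Proof.
have [_ _ _ W1 W2] := sobolev1_interp2_oo.
have [K fK] := interp2_bounded eps delta N cM.
have [K1 f1K] := d1interp2_bounded eps N delta0 cM.
have [K2 f2K] := d2interp2_bounded eps N delta0 cM.
have AB : - (delta / 2) <= L + delta / 2.
  have : 0 <= L by rewrite -NE mulr_ge0// ltW.
  by have := delta0; lra.
split => //.
- exact: (Lp2_bounded AB AB (measurable_interp2 eps delta N c) fK).
- exact: (Lp2_bounded AB AB (measurable_d1interp2 eps delta N c) f1K).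
- exact: (Lp2_bounded AB AB (measurable_d2interp2 eps delta N c) f2K).
Qed.

Let not_joint (p : nat) (t : R) :
  p%:R * eps + delta / 2 < t -> t < p.+1%:R * eps - delta / 2 ->
  forall r, ~ joint eps delta r t.
Proof.
have d0 := delta0; move=> h1 h2 r; rewrite /joint /joint_left/= in_itv/= => /andP[h3 h4].
have [rp|pr] := leqP r p.
  have : r%:R * eps <= p%:R * eps by rewrite ler_pM2r// ler_nat.
  lra.
have : p.+1%:R * eps <= r%:R * eps by rewrite ler_pM2r// ler_nat.
lra.
Qed.

Lemma d1interp2_cellH (x : R * R) : omegaH L eps delta x -> d1f x = 0.
Proof.
move=> [p [q [pN qN [/=]]]]; rewrite !in_itv/= => /andP[h1 h2] _.
by apply: dinterp_out; exact: not_joint h1 h2.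
Qed.

Lemma d2interp2_cellH (x : R * R) : omegaH L eps delta x -> d2f x = 0.
Proof.
move=> [p [q [pN qN [/=]]]]; rewrite !in_itv/= => _ /andP[h1 h2].
case: x h1 h2 => x1 x2 /= h1 h2; rewrite d2interp2_swap.
by apply: dinterp_out; exact: not_joint h1 h2.
Qed.

Lemma grid_interpolation_interp2 : grid_interpolation L eps delta f.
Proof.
have d0 := delta0; have de := delta_eps.
have dn0 : delta != 0 by rewrite gt_eqF.
have inside F (p : nat) t : (p < N)%N ->
    p%:R * eps + delta / 2 <= t -> t <= (p%:R + 1) * eps - delta / 2 ->
    interp eps delta N F t = F p.+1.
  move=> pN h1 h2; rewrite (@interp_loc _ _ _ _ delta0 delta_eps F p)//; [|exact: ltnW|lra].
  by rewrite ramp_right// /joint_left; [ring|lra].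
have across F (p : nat) z : (p <= N)%N -> Iint delta z ->
    interp eps delta N F (p%:R * eps + z) =
    F p.+1 * ((delta + 2 * z) / (2 * delta)) + F p * ((delta - 2 * z) / (2 * delta)).
  rewrite /Iint/= in_itv/= => pN /andP[z1 z2].
  rewrite (@interp_loc _ _ _ _ delta0 delta_eps F p)//; [|lra|lra].
  rewrite ramp_joint// /joint_left; first by field.
  by apply/andP; split; lra.
have absS (p : nat) : absz (p%:Z + 1) = p.+1 by lia.
have abs0 (p : nat) : absz (p%:Z - 1 + 1) = p by lia.
have [cc [c11 c10 c01 c00]] : exists cc : int -> int -> R,
    [/\ forall p q : nat, cc p%:Z q%:Z = c p.+1 q.+1,
        forall p q : nat, cc p%:Z (q%:Z - 1) = c p.+1 q,
        forall p q : nat, cc (p%:Z - 1) q%:Z = c p q.+1 &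
        forall p q : nat, cc (p%:Z - 1) (q%:Z - 1) = c p q].
  (* Undo the shift of the indices, which puts the row -1 at 0. *)
  exists (fun p q => c (absz (p + 1)) (absz (q + 1))).
  by split => p q; rewrite ?absS ?abs0.
exists cc; split.
- move=> p q pN qN x [/=]; rewrite !in_itv/= -(natr1 p) -(natr1 q).
  move=> /andP[h1 h2] /andP[h3 h4].
  rewrite c11 /interp2 (inside _ p)//; [|lra|lra].
  by rewrite (inside _ q)//; lra.
- move=> p q pN qN z1 z2; rewrite {1}/Iint/= in_itv/= => /andP[h1 h2] h3.
  rewrite c11 c10 /interp2 /= (inside _ p)//; [|lra|lra].
  exact: across.
- move=> p q pN qN z1 z2 h3; rewrite {1}/Iint/= in_itv/= => /andP[h1 h2].
  rewrite c11 c01 /interp2 /= across//.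
  by rewrite !(inside _ q)//; lra.
- move=> p q pN qN z1 z2 h1 h2.
  rewrite c11 c10 c01 c00 /interp2 /= across// !across//; ring.
Qed.

Lemma interp2_in_V : V L l eps delta f.
Proof.
exists d1f, d2f; split.
- exact: sobolev1_interp2_2.
- by apply: aeW => x Hx; split; [exact: d1interp2_cellH|exact: d2interp2_cellH].
- exact: zero_on_gamma_interp2.
- exact: grid_interpolation_interp2.
Qed.

End interpolation_in_V.

(** * Reduction to bounded representatives *)

Section almost_everywhere_bounds.
Context d (T : measurableType d) (R : realType).
Variable mu : {measure set T -> \bar R}.

(** Giving B the value +oo on the exceptional null set turns the bound into one
    that holds everywhere, and does not change the integral of B. *)
Lemma ge0_le_integral_ae (U : set T) (f B : T -> \bar R) :
  measurable U -> (forall x, U x -> 0 <= f x)%E ->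
  measurable_fun U B -> (forall x, U x -> 0 <= B x)%E ->
  {ae mu, forall x, U x -> (f x <= B x)%E} ->
  (\int[mu]_(x in U) f x <= \int[mu]_(x in U) B x)%E.
Proof.
move=> mU f0 mB B0 [A [mA A0 fB]].
have mc : measurable_fun U ((cst +oo%E : T -> \bar R) \_ A).
  by apply/(measurable_restrict _ mA mU); exact: measurable_cst.
have c0 x : (0 <= ((cst +oo%E : T -> \bar R) \_ A) x)%E.
  by rewrite /patch; case: ifP => // _; exact: leey.
apply: (@le_trans _ _ (\int[mu]_(x in U) (B x + ((cst +oo%E) \_ A) x))%E).
  apply: ge0_le_integral_dominated => // x Ux.
  have [Ax|nAx] := pselect (A x).
    have -> : ((cst +oo%E : T -> \bar R) \_ A) x = +oo%E by rewrite /patch mem_set.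
    rewrite addey ?leey//.
    by rewrite gt_eqF//; apply: lt_le_trans (B0 _ Ux); exact: ltNy0.
  have -> : ((cst +oo%E : T -> \bar R) \_ A) x = 0%E by rewrite /patch memNset.
  rewrite adde0; apply: contrapT => H; apply: nAx; apply: fB => /= H'.
  exact/H/H'.
rewrite ge0_integralD// -integral_mkcondr integral_cst; last exact: measurableI.
have -> : mu (U `&` A) = 0%E.
  apply/eqP; rewrite eq_le measure_ge0 andbT -A0.
  by apply: le_measure; rewrite ?inE//; exact: measurableI.
by rewrite mule0 adde0.
Qed.

Lemma Lp_dist2_le_ae (U : set T) (f g : T -> R) (B : T -> \bar R) (eta : R) :
  measurable U -> measurable_fun U B -> (forall x, U x -> 0 <= B x)%E -> 0 < eta ->
  {ae mu, forall x, U x -> ((`|f x - g x| ^+ 2)%:E <= B x)%E} ->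
  (\int[mu]_(x in U) B x <= (eta ^+ 2)%:E)%E ->
  (Lp_dist mu 2%:E U f g <= eta%:E)%E.
Proof.
move=> mU mB B0 eta0 fgB HB.
apply: (Lp_dist2_le (B := fun x => (`|f x - g x| ^+ 2)%:E)) => //.
by apply: le_trans HB; apply: ge0_le_integral_ae.
Qed.

End almost_everywhere_bounds.

Section bounded_representatives.
Context {R : realType}.
Local Notation mu2 := (@lebesgue2 R).
Variable L : R.
Hypothesis L0 : 0 < L.
Local Notation om := (omega L : set (plane R)).

Let mom : measurable om. Proof. exact: measurable_omega. Qed.

Definition equal_ae_om (f g : plane R -> R) : Prop :=
  {ae mu2, forall x, om x -> f x = g x}.

(** Extend g by 0 outside omega and truncate at its L^oo norm. *)
Lemma bounded_representative (g : plane R -> R) : Lp mu2 +oo%E om g ->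
  exists C, exists2 h : plane R -> R, equal_ae_om h g &
    measurable_fun setT h /\ forall x, `|h x| <= C.
Proof.
move=> [mg gfin].
have muT : (0 < mu2 setT)%E.
  apply: (@lt_le_trans _ _ (L * L)%:E); first by rewrite lte_fin mulr_gt0.
  rewrite -lebesgue2_omega ?(ltW L0)//; apply: le_measure; rewrite ?inE//.
set S := (X in (X < _)%E) in gfin.
have S0 : (0 <= S)%E by exact: Lnorm_ge0.
have Sfin : S \is a fin_num by rewrite ge0_fin_numE.
pose C := fine S.
have C0 : 0 <= C by exact: fine_ge0.
have gC : {ae mu2, forall x, `|(g \_ om) x| <= C}.
  have : (ess_sup mu2 (abse \o (EFin \o (g \_ om))) <= S)%E.
    by rewrite /S unlock muT.
  move=> /ess_supP; apply: filterS => x /=.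
  by rewrite -{1}(fineK Sfin) lee_fin.
exists C, (fun x => Num.max (- C) (Num.min C ((g \_ om) x))).
  apply: filterS gC => x gx omx; move: gx; rewrite /patch mem_set// ler_norml.
  by move=> /andP[h1 h2]; rewrite (min_idPr h2) (max_idPr h1).
split.
  apply: measurable_maxr; first exact: measurable_cst.
  apply: measurable_minr; first exact: measurable_cst.
  by apply/(measurable_restrictT _ mom).
move=> x; rewrite ler_norml le_max lexx /= ge_max ge_min lexx andbT.
by lra.
Qed.

Let ae_integral (f g h k : plane R -> R) (P : set (plane R)) :
  measurable P -> P `<=` om -> equal_ae_om f g ->
  measurable_fun P (EFin \o h) -> measurable_fun P (EFin \o k) ->
  (forall x, f x = g x -> h x = k x) ->
  (\int[mu2]_(x in P) (h x)%:E = \int[mu2]_(x in P) (k x)%:E)%E.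
Proof.
move=> mP Pom fg mh mk hk; apply: ae_eq_integral => //.
by apply: filterS fg => x fgx /Pom /fgx /hk /= ->.
Qed.

Lemma zero_trace_equal_ae (f g : plane R -> R) x :
  measurable_fun om f -> measurable_fun om g -> equal_ae_om f g ->
  zero_trace_at (omega L) f x -> zero_trace_at (omega L) g x.
Proof.
move=> mf mg fg; rewrite /zero_trace_at.
suff -> : (fun r : R => (r ^- 2)%:E * \int[mu2]_(y in omega L `&` ball x r) `|f y|%:E)%E =
  (fun r : R => (r ^- 2)%:E * \int[mu2]_(y in omega L `&` ball x r) `|g y|%:E)%E by [].
apply/funext => r; congr (_ * _)%E.
have mball : measurable (ball x r : set (plane R)).
  have [r0|r0] := ltP 0 r; first by apply: open_measurable_plane; exact: ball_open.
  rewrite [X in measurable X](_ : _ = set0); first exact: measurable0.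
  apply/seteqP; split => // -[u v] [+ _]; rewrite /ball/= => ur.
  by have := le_lt_trans (normr_ge0 _) ur; lra.
have mP : measurable (om `&` ball x r) by exact: measurableI.
have sub : om `&` ball x r `<=` om by move=> y [].
apply: (ae_integral mP sub fg).
- apply/measurable_EFinP; apply: measurableT_comp => //.
  exact: measurable_funS mf.
- apply/measurable_EFinP; apply: measurableT_comp => //.
  exact: measurable_funS mg.
- by move=> y ->.
Qed.

Lemma weak_partial_equal_ae (v : R * R) (f g f' g' : plane R -> R) :
  (forall psi, test_function (omega L) psi ->
     continuous psi /\ continuous ('D_v psi)) ->
  measurable_fun om f -> measurable_fun om g ->
  measurable_fun om f' -> measurable_fun om g' ->
  equal_ae_om f f' -> equal_ae_om g g' ->
  weak_partial (omega L) v f' g' -> weak_partial (omega L) v f g.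
Proof.
move=> Hc mf mg mf' mg' ff' gg' W psi tpsi; have [c1 c2] := Hc _ tpsi.
have m1 := continuous_measurable_plane c1.
have m2 := continuous_measurable_plane c2.
have mM (h k : plane R -> R) : measurable_fun om h -> measurable_fun setT k ->
    measurable_fun om (EFin \o (fun x => h x * k x)).
  move=> mh mk; apply/measurable_EFinP; apply: measurable_funM => //.
  exact: measurable_funTS.
have sub : om `<=` om by [].
rewrite (ae_integral mom sub ff' (mM _ _ mf m2) (mM _ _ mf' m2)); last by move=> x ->.
rewrite (ae_integral mom sub gg' (mM _ _ mg m1) (mM _ _ mg' m1)); last by move=> x ->.
exact: W.
Qed.

Lemma ae_fst (P : plane R -> Prop) :
  {ae mu2, forall x, P x} -> {ae @lebesgue4 R, forall z, P z.1}.
Proof.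
move=> [A [mA A0 PA]]; exists (A `*` setT); split.
- exact: measurableX.
- have -> : (@lebesgue4 R) (A `*` setT) = (mu2 A * mu2 setT)%E.
    by apply: product_measure1E.
  by rewrite [X in (X * _)%E]A0 mul0e.
- by move=> [x y] /= H; split => //; exact: PA.
Qed.

End bounded_representatives.

(** * Convergence of the recovery sequence *)

Section convergence.
Context {R : realType}.
Local Notation mu2 := (@lebesgue2 R).
Local Notation mu4 := (@lebesgue4 R).
Variables (L l : R) (phi d1 d2 : plane R -> R) (C Cs : R).
Hypotheses (l0 : 0 < l) (lL : l < L) (C0 : 0 < C) (Cs1 : 1 <= Cs).
Hypothesis step_bump_Cs :
  forall t : R, `|smooth_step t| <= Cs /\ `|smooth_bump t| <= Cs.
Hypotheses (mphi : measurable_fun setT phi) (md1 : measurable_fun setT d1)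
           (md2 : measurable_fun setT d2).
Hypotheses (phiC : forall x, `|phi x| <= C) (d1C : forall x, `|d1 x| <= C)
           (d2C : forall x, `|d2 x| <= C).
Hypotheses (W1 : weak_partial (omega L) e1 phi d1)
           (W2 : weak_partial (omega L) e2 phi d2).
Hypothesis tr : zero_on_gamma l (omega L) phi.
Local Notation om := (omega L : set (plane R)).

Let L0 : 0 < L. Proof. exact: lt_trans lL. Qed.
Let B := coef_const C Cs.
Let B0 : 0 < B. Proof. exact: coef_const_gt0. Qed.
Let mom : measurable om. Proof. exact: measurable_omega. Qed.

Definition recovery_coef (eps : R) := coef L l phi eps (Neps L eps).

Section fixed_parameters.
Variables (eps delta : R).
Hypothesis adm : admissible L l eps delta.
Local Notation N := (Neps L eps).
Local Notation c := (recovery_coef eps).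

Lemma recovery_in_V :
  sobolev1 +oo%E (omega_delta L delta) (interp2 eps delta N c)
    (d1interp2 eps delta N c) (d2interp2 eps delta N c) /\
  V L l eps delta (interp2 eps delta N c).
Proof.
have [delta0 de NE [nl nlN nlE]] := admissibleP l0 lL adm.
have eps0 : 0 < eps by lra.
have cM := coef_bound l0 lL C0 Cs1 step_bump_Cs mphi phiC N eps0.
have cell0 k : (k <= 1)%N -> cell_of N k = 0%N.
  by clear; rewrite /cell_of; lia.
have celln m : (m <= nl.+1)%N -> (cell_of N m)%:R * eps <= l.
  move=> mn; rewrite -nlE ler_pM2r// ler_nat.
  by move: mn; clear; rewrite /cell_of; lia.
split; first exact: (sobolev1_interp2_oo delta0 de NE cM).
apply: (interp2_in_V delta0 de NE nlN nlE cM).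
- move=> k m k1 mn; apply: coef_edge; rewrite /edge_cell.
  by rewrite (cell0 _ k1) eqxx (celln _ mn).
- move=> k m m1 kn; apply: coef_edge; rewrite /edge_cell.
  by rewrite (cell0 _ m1) eqxx (celln _ kn) orbT.
Qed.

Let floor_cell (t : R) : 0 < t -> t < L -> exists2 p : nat, (p < N)%N &
  p%:R * eps <= t < p.+1%:R * eps /\ (Num.floor (t / eps))%:~R = p%:R :> R.
Proof.
have [delta0 de NE _] := admissibleP l0 lL adm; have eps0 : 0 < eps by lra.
move=> t0 tL; have f0 : 0 <= Num.floor (t / eps).
  by rewrite floor_ge0 divr_ge0// ltW.
exists (absz (Num.floor (t / eps))).
  rewrite -(ltr_nat R) -(ltr_pM2r eps0) NE natr_absz ger0_norm//.
  apply: le_lt_trans tL; rewrite -ler_pdivlMr//; exact: floor_le.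
have E : (absz (Num.floor (t / eps)))%:R = (Num.floor (t / eps))%:~R :> R.
  by rewrite natr_absz ger0_norm.
split; last by rewrite E.
rewrite -natr1 E -ler_pdivlMr// -ltr_pdivrMr// floor_le /=.
have := floorD1_gt (t / eps); rewrite intrD; exact.
Qed.

(** The value at x is a convex combination, in each of the two directions, of
    values of cells around x. *)
Lemma recovery_majorant x : om x ->
  ((`|interp2 eps delta N c x - phi x| ^+ 2)%:E <= majorant L B phi eps x)%E.
Proof.
have [delta0 de NE [nl nlN nlE]] := admissibleP l0 lL adm.
have eps0 : 0 < eps by lra.
move: x => [x1 x2] omx; have := omx.
move=> [/=]; rewrite !in_itv/= => /andP[h1 h2] /andP[h3 h4].
have [p pN [px _]] := floor_cell h1 h2; have [q qN [qx _]] := floor_cell h3 h4.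
have /andP[p1 /ltW p2] := px; have /andP[q1 /ltW q2] := qx.
have [k kp Hk] := interp_near delta0 de (fun k => interp eps delta N (c k) x2)
  (phi (x1, x2)) pN p1 p2.
have [m mq Hm] := interp_near delta0 de (c k) (phi (x1, x2)) qN q1 q2.
have H := le_trans Hk Hm.
apply: le_majorant.
- apply: le_trans H _.
  exact: (coef_dist l0 lL C0 Cs1 step_bump_Cs mphi phiC N eps0).
- apply: (@le_trans _ _ `|c k m - phi (x1, x2)|%:E); first by rewrite lee_fin.
  exact: (coef_near l0 lL C0 Cs1 step_bump_Cs mphi phiC eps0 NE omx pN qN px qx kp mq).
Qed.

(** For x in the cell (p, q), T1 evaluates the derivative in the joint of the
    node q eps.  There the slope in direction 2 is (c_{.,q} - c_{.,q-1}) / delta,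
    interpolated in direction 1; the factor delta / eps turns it into a convex
    combination of difference quotients, each an average of d2 around x. *)
Lemma recovery_T1_majorant z : (om `*` @Y1 R) z ->
  ((`|delta / eps * T1 eps delta (d2interp2 eps delta N c) z - d2 z.1| ^+ 2)%:E <=
   majorant L B d2 eps z.1)%E.
Proof.
have [delta0 de NE [nl nlN nlE]] := admissibleP l0 lL adm.
have eps0 : 0 < eps by lra.
have en0 : eps != 0 by rewrite gt_eqF.
have dn0 : delta != 0 by rewrite gt_eqF.
move: z => [[x1 x2] [y1 y2]] [/= omx [/=]]; rewrite /Iint/= !in_itv/=.
move=> /andP[y10 y11] /andP[y20 y21]; have := omx.
move=> [/=]; rewrite !in_itv/= => /andP[h1 h2] /andP[h3 h4].
have [p pN [px pf]] := floor_cell h1 h2; have [q qN [qx qf]] := floor_cell h3 h4.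
set t := eps * p%:R + eps * y1.
have t1 : p%:R * eps <= t by rewrite /t mulrC lerDl mulr_ge0// ltW.
have t2 : t <= p.+1%:R * eps.
  by rewrite /t -natr1 -mulrDr mulrC ler_pM2r// lerD2l ltW.
have E : delta / eps * T1 eps delta (d2interp2 eps delta N c) ((x1, x2), (y1, y2)) =
    interp eps delta N (fun k => (c k q.+1 - c k q) / eps) t.
  rewrite /T1 /d2interp2 /= pf qf -/t -interpZ; congr (interp _ _ _ _ _).
  apply/funext => k; rewrite (@dinterp_loc _ _ _ _ delta0 de _ q); first by field; apply/andP.
    exact: ltnW.
  rewrite /joint /joint_left/= in_itv/= mulrC.
  have g1 : delta * - 2^-1 < delta * y2 by rewrite ltr_pM2l//; lra.
  have g2 : delta * y2 < delta * 2^-1 by rewrite ltr_pM2l//; lra.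
  by apply/andP; split; lra.
have [k kp Hk] := interp_near delta0 de (fun k => (c k q.+1 - c k q) / eps)
  (d2 (x1, x2)) pN t1 t2.
rewrite E; apply: le_majorant.
- apply: le_trans Hk _.
  exact: (quotient2_dist l0 lL C0 Cs1 step_bump_Cs mphi md1 md2 phiC d1C d2C W1 W2 tr
    eps0 NE nlE).
- apply: (@le_trans _ _ `|(c k q.+1 - c k q) / eps - d2 (x1, x2)|%:E).
    by rewrite lee_fin.
  exact: (quotient2_near l0 lL C0 Cs1 step_bump_Cs mphi md1 md2 phiC d1C d2C W1 W2 tr
    eps0 NE nlE omx pN qN px qx).
Qed.

Lemma recovery_T2_majorant z : (om `*` @Y2 R) z ->
  ((`|delta / eps * T2 eps delta (d1interp2 eps delta N c) z - d1 z.1| ^+ 2)%:E <=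
   majorant L B d1 eps z.1)%E.
Proof.
have [delta0 de NE [nl nlN nlE]] := admissibleP l0 lL adm.
have eps0 : 0 < eps by lra.
have en0 : eps != 0 by rewrite gt_eqF.
have dn0 : delta != 0 by rewrite gt_eqF.
move: z => [[x1 x2] [y1 y2]] [/= omx [/=]]; rewrite /Iint/= !in_itv/=.
move=> /andP[y10 y11] /andP[y20 y21]; have := omx.
move=> [/=]; rewrite !in_itv/= => /andP[h1 h2] /andP[h3 h4].
have [p pN [px pf]] := floor_cell h1 h2; have [q qN [qx qf]] := floor_cell h3 h4.
set t := eps * q%:R + eps * y2.
have t1 : q%:R * eps <= t by rewrite /t mulrC lerDl mulr_ge0// ltW.
have t2 : t <= q.+1%:R * eps.
  by rewrite /t -natr1 -mulrDr mulrC ler_pM2r// lerD2l ltW.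
have E : delta / eps * T2 eps delta (d1interp2 eps delta N c) ((x1, x2), (y1, y2)) =
    interp eps delta N (fun m => (c p.+1 m - c p m) / eps) t.
  rewrite /T2 /= pf qf -/t.
  rewrite -(d2interp2_swap eps delta N (fun m k => c k m)) /d2interp2 /= -interpZ.
  congr (interp _ _ _ _ _).
  apply/funext => k; rewrite (@dinterp_loc _ _ _ _ delta0 de _ p); first by field; apply/andP.
    exact: ltnW.
  rewrite /joint /joint_left/= in_itv/= mulrC.
  have g1 : delta * - 2^-1 < delta * y1 by rewrite ltr_pM2l//; lra.
  have g2 : delta * y1 < delta * 2^-1 by rewrite ltr_pM2l//; lra.
  by apply/andP; split; lra.
have [m mq Hm] := interp_near delta0 de (fun m => (c p.+1 m - c p m) / eps)
  (d1 (x1, x2)) qN t1 t2.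
rewrite E; apply: le_majorant.
- apply: le_trans Hm _.
  exact: (quotient1_dist l0 lL C0 Cs1 step_bump_Cs mphi md1 md2 phiC d1C d2C W1 W2 tr
    eps0 NE nlE).
- apply: (@le_trans _ _ `|(c p.+1 m - c p m) / eps - d1 (x1, x2)|%:E).
    by rewrite lee_fin.
  exact: (quotient1_near l0 lL C0 Cs1 step_bump_Cs mphi md1 md2 phiC d1C d2C W1 W2 tr
    eps0 NE nlE omx pN qN px qx).
Qed.

End fixed_parameters.

#[global] Instance params_to0_filter : Filter (params_to0 L l).
Proof.
apply: filter_from_filter; first by exists 1; rewrite /= ltr01.
move=> r s r0 s0; exists (Num.min r s); first by rewrite /= lt_min; apply/andP.
by move=> e [adm]; rewrite /= !lt_min => /andP[? ?] /andP[? ?] /andP[? ?].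
Qed.

Let small_params (f : R * R -> \bar R) : (forall e, 0 <= f e)%E ->
  (forall eta, 0 < eta -> exists2 r0 : R, 0 < r0 & forall e : R * R,
    admissible L l e.1 e.2 -> e.1 < r0 -> (f e <= eta%:E)%E) ->
  f e @[e --> params_to0 L l] --> 0%E.
Proof.
move=> f0 H; apply: ge0_cvge0 => // eta eta0; have [r r0 Hr] := H _ eta0.
by exists r => // e [adm er _ _]; exact: Hr.
Qed.

Let eps_gt0 (eps delta : R) : admissible L l eps delta -> 0 < eps.
Proof. by move=> [? ? _ _ _]; lra. Qed.

Local Notation N := (Neps L).
Local Notation c := recovery_coef.

Lemma recovery_cvg (phi0 : plane R -> R) : equal_ae_om L phi phi0 ->
  Lp_dist mu2 2%:E om (fun x => interp2 e.1 e.2 (N e.1) (c e.1) x) phi0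
    @[e --> params_to0 L l] --> 0%E.
Proof.
move=> phi_ae; apply: small_params => [e|eta eta0]; first exact: Lnorm_ge0.
have e20 : 0 < eta ^+ 2 by rewrite exprn_gt0.
have [r r0 Hr] := integral_majorant L0 B0 (osc_vanishes_bounded L0 mphi phiC) e20.
exists r => // e adm er; have e0 := eps_gt0 adm.
apply: (Lp_dist2_le_ae (B := majorant L B phi e.1)) => //.
- by apply: measurable_funTS; exact: measurable_majorant.
- by move=> x _; apply: majorant_ge0; exact: ltW.
- apply: filterS phi_ae => x xE omx; rewrite -xE//.
  exact: recovery_majorant.
- exact: Hr.
Qed.

Let lebesgue2_Y1 : mu2 (@Y1 R) = 1%:E.
Proof.
rewrite /Y1 /Iint lebesgue2_rect//; first by congr (_%:E); lra.
lra.
Qed.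

Let lebesgue2_Y2 : mu2 (@Y2 R) = 1%:E.
Proof.
rewrite /Y2 /Iint lebesgue2_rect//; first by congr (_%:E); lra.
lra.
Qed.

Let cvg4 (Y : set (plane R)) (h h0 : plane R -> R)
    (f : R * R -> plane R * plane R -> R) :
  measurable Y -> mu2 Y = 1%:E -> measurable_fun setT h -> (forall x, `|h x| <= C) ->
  equal_ae_om L h h0 ->
  (forall e, admissible L l e.1 e.2 -> forall z, (om `*` Y) z ->
    ((`|f e z - h z.1| ^+ 2)%:E <= majorant L B h e.1 z.1)%E) ->
  Lp_dist mu4 2%:E (om `*` Y) (f e) (fun z => h0 z.1)
    @[e --> params_to0 L l] --> 0%E.
Proof.
move=> mY Y1 mh hC h_ae fB; apply: small_params => [e|eta eta0].
  exact: Lnorm_ge0.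
have e20 : 0 < eta ^+ 2 by rewrite exprn_gt0.
have [r r0 Hr] := integral_majorant L0 B0 (osc_vanishes_bounded L0 mh hC) e20.
exists r => // e adm er; have e0 := eps_gt0 adm.
have mM := measurable_majorant L B e.1 mh.
have M0 x : (0 <= majorant L B h e.1 x)%E by apply: majorant_ge0; exact: ltW.
apply: (Lp_dist2_le_ae (B := fun z => majorant L B h e.1 z.1)) => //.
- exact: measurableX.
- by apply: measurable_funTS; exact: measurableT_comp mM measurable_fst.
- apply: filterS (ae_fst h_ae) => z zE [omz Yz]; rewrite -zE//.
  exact: fB.
- by rewrite integral_fst_rect//; exact: Hr.
Qed.

Lemma recovery_T1_cvg (d20 : plane R -> R) : equal_ae_om L d2 d20 ->
  Lp_dist mu4 2%:E (om `*` @Y1 R)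
    (fun z => e.2 / e.1 * T1 e.1 e.2 (d2interp2 e.1 e.2 (N e.1) (c e.1)) z)
    (fun z => d20 z.1) @[e --> params_to0 L l] --> 0%E.
Proof.
move=> d2_ae; apply: (cvg4 (h := d2)) => //; first exact: measurable_rect.
by move=> e adm z; exact: recovery_T1_majorant.
Qed.

Lemma recovery_T2_cvg (d10 : plane R -> R) : equal_ae_om L d1 d10 ->
  Lp_dist mu4 2%:E (om `*` @Y2 R)
    (fun z => e.2 / e.1 * T2 e.1 e.2 (d1interp2 e.1 e.2 (N e.1) (c e.1)) z)
    (fun z => d10 z.1) @[e --> params_to0 L l] --> 0%E.
Proof.
move=> d1_ae; apply: (cvg4 (h := d1)) => //; first exact: measurable_rect.
by move=> e adm z; exact: recovery_T2_majorant.
Qed.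

End convergence.

Theorem lemmaB3 (R : realType) (L l : R) (l_gt0 : 0 < l) (l_lt_L : l < L)
    (phi d1phi d2phi : R * R -> R)
    (phi_W1oo : sobolev1 +oo%E (omega L) phi d1phi d2phi)
    (phi_gamma : zero_on_gamma l (omega L) phi) :
  exists phi_ d1phi_ d2phi_ : R -> R -> R * R -> R,
    (forall eps delta : R, admissible L l eps delta ->
       sobolev1 +oo%E (omega_delta L delta)
         (phi_ eps delta) (d1phi_ eps delta) (d2phi_ eps delta) /\
       V L l eps delta (phi_ eps delta)) /\
    [/\ Lp_dist (@lebesgue2 R) 2%:E (omega L) (phi_ e.1 e.2) phi
          @[e --> params_to0 L l] --> 0%E,
        Lp_dist (@lebesgue4 R) 2%:E (omega L `*` @Y1 R)
          (fun z => e.2 / e.1 * T1 e.1 e.2 (d2phi_ e.1 e.2) z)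
          (fun z => d2phi z.1)
          @[e --> params_to0 L l] --> 0%E &
        Lp_dist (@lebesgue4 R) 2%:E (omega L `*` @Y2 R)
          (fun z => e.2 / e.1 * T2 e.1 e.2 (d1phi_ e.1 e.2) z)
          (fun z => d1phi z.1)
          @[e --> params_to0 L l] --> 0%E].
Proof.
have L_gt0 : 0 < L by exact: lt_trans l_lt_L.
have [Lphi Ld1 Ld2 W1 W2] := phi_W1oo.
have [C1 [f f_ae [mf fC]]] := bounded_representative L_gt0 Lphi.
have [C2 [g1 g1_ae [mg1 g1C]]] := bounded_representative L_gt0 Ld1.
have [C3 [g2 g2_ae [mg2 g2C]]] := bounded_representative L_gt0 Ld2.
(* One bound for the function and its two derivatives, positive in all cases. *)
pose C := 1 + `|C1| + `|C2| + `|C3|.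
have [C10 C20 C30] := And3 (normr_ge0 C1) (normr_ge0 C2) (normr_ge0 C3).
have [C1C C2C C3C C_gt0] : [/\ `|C1| <= C, `|C2| <= C, `|C3| <= C & 0 < C].
  by rewrite /C; split; lra.
have [Cs Cs1 HCs] := @smooth_step_bump_bounded R.
have {}fC x : `|f x| <= C by rewrite (le_trans (fC x))// (le_trans (ler_norm _)).
have {}g1C x : `|g1 x| <= C by rewrite (le_trans (g1C x))// (le_trans (ler_norm _)).
have {}g2C x : `|g2 x| <= C by rewrite (le_trans (g2C x))// (le_trans (ler_norm _)).
have {}W1 : weak_partial (omega L) e1 f g1.
  apply: (weak_partial_equal_ae _ _ _ Lphi.1 Ld1.1 f_ae g1_ae W1) => //.
  - move=> psi tpsi; split; first exact: (test_function_continuous tpsi).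
    exact: (test_function_continuous_e1 tpsi).
  - exact: measurable_funTS.
  - exact: measurable_funTS.
have {}W2 : weak_partial (omega L) e2 f g2.
  apply: (weak_partial_equal_ae _ _ _ Lphi.1 Ld2.1 f_ae g2_ae W2) => //.
  - move=> psi tpsi; split; first exact: (test_function_continuous tpsi).
    exact: (test_function_continuous_e2 tpsi).
  - exact: measurable_funTS.
  - exact: measurable_funTS.
have f_gamma : zero_on_gamma l (omega L) f.
  have ae_f : equal_ae_om L phi f by apply: filterS f_ae => x H /H ->.
  have mf' : measurable_fun (omega L : set (plane R)) f by exact: measurable_funTS.
  have [A [mA A0 phiA]] := phi_gamma; exists A; split => // t nt; apply: phiA => Ht.
  apply: nt => /Ht[t1 t2].
  by split; apply: (zero_trace_equal_ae Lphi.1 mf' ae_f).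
exists (fun eps delta => interp2 eps delta (Neps L eps) (recovery_coef L l f eps)).
exists (fun eps delta => d1interp2 eps delta (Neps L eps) (recovery_coef L l f eps)).
exists (fun eps delta => d2interp2 eps delta (Neps L eps) (recovery_coef L l f eps)).
split; first by move=> eps delta; exact: (recovery_in_V l_gt0 l_lt_L C_gt0 Cs1 HCs mf fC).
split.
- exact: (recovery_cvg l_gt0 l_lt_L C_gt0 Cs1 HCs mf fC).
- exact: (recovery_T1_cvg l_gt0 l_lt_L C_gt0 Cs1 HCs mf mg1 mg2 fC g1C g2C W1 W2 f_gamma).
- exact: (recovery_T2_cvg l_gt0 l_lt_L C_gt0 Cs1 HCs mf mg1 mg2 fC g1C g2C W1 W2 f_gamma).
Qed.
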